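(* Let $W=S_n$ and let $\mathfrak h=\mathbb C^{n-1}$ be its reflection representation. Then the set $\Sigma(W,\mathfrak h)$ of aspherical parameter values is the set $Q_n$ of rational numbers in $(-1,0)$ with denominator (in lowest terms) $\le n$.
   Context: Let $S$ be the set of reflections (transpositions) of $S_n$ in $\mathfrak h$; for $s\in S$, $\alpha_s\in\mathfrak h^*$, $\alpha_s^\vee\in\mathfrak h$ span the $-1$-eigenspaces of $s$, with $(\alpha_s,\alpha_s^\vee)=2$. For $c\in\mathbb C$, $H_c(S_n,\mathfrak h)$ is the quotient of $\mathbb C[S_n]\ltimes T(\mathfrak h\oplus\mathfrak h^* )$ by $[x,x']=0$, $[y,y']=0$, $[y,x]=(y,x)-c\sum_{s\in S}(y,\alpha_s)(x,\alpha_s^\vee)s$ ($x,x'\in\mathfrak h^*$, $y,y'\in\mathfrak h$). $\mathcal O_c(S_n,\mathfrak h)_0$ is the category of $H_c(S_n,\mathfrak h)$-modules finitely generated over $\mathbb C[\mathfrak h]$ on which $\mathfrak h$ acts locally nilpotently. Let $e_W=\frac1{|W|}\sum_{w\in W}w$. A nonzero $H_c(W,\mathfrak h)$-module $M$ is aspherical if $e_WM=0$. The value $c$ is aspherical if $H_c(W,\mathfrak h)$ has an aspherical representation belonging to $\mathcal O_c(W,\mathfrak h)_0$; $\Sigma(W,\mathfrak h)$ is the set of aspherical values. *)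

(* Defs.v *)
From HB Require Import structures.
From mathcomp Require Import all_boot all_order all_algebra all_fingroup.
From mathcomp Require Import boolp classical_sets reals.
From mathcomp Require Import complex generic_quotient.

Set Implicit Arguments.
Unset Strict Implicit.
Unset Printing Implicit Defensive.

Import Order.TTheory GRing.Theory Num.Theory.
Local Open Scope ring_scope.
Local Open Scope quotient_scope.

(** * Associative unital algebras given by generators and relations *)

Inductive term (K G : Type) : Type :=
| Cst of K
| Gen of G
| Add of term K G & term K G
| Mul of term K G & term K G.

Arguments Cst {K G}.
Arguments Gen {K G}.
Arguments Add {K G}.
Arguments Mul {K G}.

Definition Minus (K : pzRingType) (G : Type) (t u : term K G) : term K G :=
  Add t (Mul (Cst (-1)) u).

HB.instance Definition _ (K G : Type) := gen_eqMixin (term K G).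
HB.instance Definition _ (K G : Type) := gen_choiceMixin (term K G).

Section Presentation.
Variables (K : comPzRingType) (G : Type) (rel : term K G -> term K G -> Prop).

(* The least congruence containing [rel] whose quotient is an associative
   unital K-algebra, K being embedded through [Cst].  *)
Inductive cong : term K G -> term K G -> Prop :=
| cong_rel t u : rel t u -> cong t u
| cong_refl t : cong t t
| cong_sym t u : cong t u -> cong u t
| cong_trans t u v : cong t u -> cong u v -> cong t v
| cong_add t t' u u' : cong t t' -> cong u u' -> cong (Add t u) (Add t' u')
| cong_mul t t' u u' : cong t t' -> cong u u' -> cong (Mul t u) (Mul t' u')
| cong_addA t u v : cong (Add t (Add u v)) (Add (Add t u) v)
| cong_addC t u : cong (Add t u) (Add u t)
| cong_add0 t : cong (Add (Cst 0) t) t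
| cong_mulA t u v : cong (Mul t (Mul u v)) (Mul (Mul t u) v)
| cong_mul1l t : cong (Mul (Cst 1) t) t
| cong_mul1r t : cong (Mul t (Cst 1)) t
| cong_mulDl t u v : cong (Mul (Add t u) v) (Add (Mul t v) (Mul u v))
| cong_mulDr t u v : cong (Mul t (Add u v)) (Add (Mul t u) (Mul t v))
| cong_mul0 t : cong (Mul (Cst 0) t) (Cst 0)
| cong_cstD a b : cong (Cst (a + b)) (Add (Cst a) (Cst b))
| cong_cstM a b : cong (Cst (a * b)) (Mul (Cst a) (Cst b))
| cong_cstC a t : cong (Mul (Cst a) t) (Mul t (Cst a)).

Definition congb (t u : term K G) : bool := `[< cong t u >].

Fact congb_refl : reflexive congb.
Proof. by move=> t; apply/asboolP; apply: cong_refl. Qed.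
Fact congb_sym : symmetric congb.
Proof. by move=> t u; apply/asboolP/asboolP; apply: cong_sym. Qed.
Fact congb_trans : transitive congb.
Proof.
by move=> u t v /asboolP tu /asboolP uv; apply/asboolP; apply: cong_trans uv.
Qed.

Canonical cong_equiv := EquivRel congb congb_refl congb_sym congb_trans.

Definition presented : Type := {eq_quot cong_equiv}.
HB.instance Definition _ := Choice.on presented.
HB.instance Definition _ := EqQuotient.on presented.

Definition pcls (t : term K G) : presented := \pi_presented t.

Definition padd (p q : presented) := pcls (Add (repr p) (repr q)).
Definition pmul (p q : presented) := pcls (Mul (repr p) (repr q)).
Definition popp (p : presented) := pcls (Mul (Cst (-1)) (repr p)).

Fact pclsP t u : pcls t = pcls u <-> cong t u.
Proof.
split=> [/eqmodP/asboolP//|tu].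
by apply/eqmodP/asboolP.
Qed.

Fact repr_pcls t : cong (repr (pcls t)) t.
Proof. by apply/pclsP; rewrite /pcls reprK. Qed.

Fact pcls_ind (P : presented -> Prop) : (forall t, P (pcls t)) -> forall p, P p.
Proof. by move=> Pt p; rewrite -[p]reprK; apply: Pt. Qed.

Fact paddE t u : padd (pcls t) (pcls u) = pcls (Add t u).
Proof. by apply/pclsP/cong_add; apply: repr_pcls. Qed.
Fact pmulE t u : pmul (pcls t) (pcls u) = pcls (Mul t u).
Proof. by apply/pclsP/cong_mul; apply: repr_pcls. Qed.
Fact poppE t : popp (pcls t) = pcls (Mul (Cst (-1)) t).
Proof. by apply/pclsP/cong_mul; [apply: cong_refl|apply: repr_pcls]. Qed.

Fact paddA : associative padd.
Proof.
elim/pcls_ind=> t; elim/pcls_ind=> u; elim/pcls_ind=> v.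
by rewrite !paddE; apply/pclsP/cong_addA.
Qed.
Fact paddC : commutative padd.
Proof.
elim/pcls_ind=> t; elim/pcls_ind=> u; rewrite !paddE.
exact/pclsP/cong_addC.
Qed.
Fact padd0 : left_id (pcls (Cst 0)) padd.
Proof. by elim/pcls_ind=> t; rewrite paddE; apply/pclsP/cong_add0. Qed.
Fact paddN : left_inverse (pcls (Cst 0)) popp padd.
Proof.
elim/pcls_ind=> t; rewrite poppE paddE; apply/pclsP.
apply: cong_trans (cong_mul0 t).
apply: (@cong_trans _ (Mul (Add (Cst (-1)) (Cst 1)) t)).
  apply: cong_trans (cong_sym (cong_mulDl _ _ _)).
  by apply: cong_add; [apply: cong_refl|apply/cong_sym/cong_mul1l].
apply: cong_mul; last exact: cong_refl.
by apply: cong_sym; rewrite -[X in Cst X](addNr 1); apply: cong_cstD.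
Qed.
Fact pmulA : associative pmul.
Proof.
elim/pcls_ind=> t; elim/pcls_ind=> u; elim/pcls_ind=> v.
by rewrite !pmulE; apply/pclsP/cong_mulA.
Qed.
Fact pmul1l : left_id (pcls (Cst 1)) pmul.
Proof. by elim/pcls_ind=> t; rewrite pmulE; apply/pclsP/cong_mul1l. Qed.
Fact pmul1r : right_id (pcls (Cst 1)) pmul.
Proof. by elim/pcls_ind=> t; rewrite pmulE; apply/pclsP/cong_mul1r. Qed.
Fact pmulDl : left_distributive pmul padd.
Proof.
elim/pcls_ind=> t; elim/pcls_ind=> u; elim/pcls_ind=> v.
by rewrite !(paddE, pmulE); apply/pclsP/cong_mulDl.
Qed.
Fact pmulDr : right_distributive pmul padd.
Proof.
elim/pcls_ind=> t; elim/pcls_ind=> u; elim/pcls_ind=> v.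
by rewrite !(paddE, pmulE); apply/pclsP/cong_mulDr.
Qed.

HB.instance Definition _ := GRing.isZmodule.Build presented
  paddA paddC padd0 paddN.
HB.instance Definition _ := GRing.Zmodule_isPzRing.Build presented
  pmulA pmul1l pmul1r pmulDl pmulDr.

Fact pclsD t u : pcls (Add t u) = pcls t + pcls u.
Proof. by rewrite -paddE. Qed.
Fact pclsM t u : pcls (Mul t u) = pcls t * pcls u.
Proof. by rewrite -pmulE. Qed.
Fact pclsB t u : pcls (Minus t u) = pcls t - pcls u.
Proof. by rewrite /Minus pclsD -poppE. Qed.
Fact pcls_sum (I : Type) (r : seq I) (P : pred I) (F : I -> term K G) :
  pcls (\big[Add/Cst 0]_(i <- r | P i) F i) = \sum_(i <- r | P i) pcls (F i).
Proof. by apply: (big_morph pcls pclsD). Qed.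

End Presentation.

Arguments presented {K G} rel.
Arguments pcls {K G} rel t.

(** * The reflection representation of the symmetric group *)

Section Reflection.
Variables (K : fieldType) (n : nat).

Definition coord_sum (v : 'rV[K]_n) : K^o := \sum_i v 0 i.

Fact coord_sum_is_linear : linear coord_sum.
Proof.
move=> a u v; rewrite /coord_sum scaler_sumr -big_split.
by apply: eq_bigr => i _; rewrite !mxE.
Qed.
HB.instance Definition _ := GRing.isLinear.Build K 'rV[K]_n K^o *:%R
  coord_sum coord_sum_is_linear.

Definition sum0 : {vspace 'rV[K]_n} := lker (linfun coord_sum).
Definition refl_rep : vectType K := subvs_of sum0.
Definition refl_dual : vectType K := 'Hom(refl_rep, K^o).

Definition hcoord (y : refl_rep) (i : 'I_n) : K := (vsval y) 0 i.

(* The product of permutations of the library is (u * v) i = v (u i), so that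
   (w y)_i = y_(w i) defines a left action: see [hactM]. The vector
   [col_perm w y] belongs to [sum0], so that [vsproj] only retypes it: see
   [hactE]. *)
Definition hact (w : 'S_n) : 'End(refl_rep) :=
  linfun (vsproj sum0 \o col_perm w \o vsval).

(* The contragredient action. *)
Definition dact (w : 'S_n) (x : refl_dual) : refl_dual :=
  (x \o hact w^-1%g)%VF.

(* The roots of the reflection [tperm i j] are e_i^* - e_j^* in the dual and
   e_i - e_j in the representation. *)
Definition hroot (i j : 'I_n) : refl_dual :=
  linfun (fun y : refl_rep => hcoord y i - hcoord y j : K^o).
Definition hcoroot (i j : 'I_n) : refl_rep :=
  vsproj sum0 (delta_mx 0 i - delta_mx 0 j).

Fact mem_sum0 (v : 'rV[K]_n) : (v \in sum0) = (\sum_i v 0 i == 0).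
Proof. by rewrite memv_ker lfunE. Qed.

Fact hcoordP (y z : refl_rep) : hcoord y =1 hcoord z -> y = z.
Proof. by move=> yz; apply/val_inj/rowP => i; apply: yz. Qed.

Fact sum_hcoord (y : refl_rep) : \sum_i hcoord y i = 0.
Proof. by apply/eqP; rewrite -mem_sum0 subvsP. Qed.

Fact hactE (w : 'S_n) (y : refl_rep) i : hcoord (hact w y) i = hcoord y (w i).
Proof.
rewrite /hcoord lfunE /= vsprojK ?mxE // mem_sum0.
under eq_bigr do rewrite mxE.
apply/eqP; have := sum_hcoord y; rewrite (reindex_inj (@perm_inj _ w)).
exact.
Qed.

Fact hact1 (y : refl_rep) : hact 1%g y = y.
Proof. by apply: hcoordP => i; rewrite hactE perm1. Qed.

Fact hactM (u v : 'S_n) (y : refl_rep) : hact (u * v)%g y = hact u (hact v y).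
Proof. by apply: hcoordP => i; rewrite !hactE permM. Qed.

Fact dactM (u v : 'S_n) (x : refl_dual) : dact (u * v)%g x = dact u (dact v x).
Proof. by apply/lfunP => y; rewrite !comp_lfunE invMg hactM. Qed.

Fact hroot_is_linear i j :
  linear (fun y : refl_rep => hcoord y i - hcoord y j : K^o).
Proof.
move=> a y z; rewrite /hcoord !mxE /GRing.scale /= mulrBr opprD.
by rewrite addrACA.
Qed.

Fact hrootE i j (y : refl_rep) : hroot i j y = hcoord y i - hcoord y j.
Proof.
pose L := GRing.isLinear.Build K refl_rep K^o *:%R _ (hroot_is_linear i j).
pose f : {linear refl_rep -> K^o} := HB.pack
  (fun y : refl_rep => hcoord y i - hcoord y j : K^o) L.
exact: (lfunE f).
Qed.

Fact hcorootE i j k : hcoord (hcoroot i j) k = (k == i)%:R - (k == j)%:R.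
Proof.
rewrite /hcoord vsprojK ?mxE ?eqxx // mem_sum0.
have sum_delta l : \sum_m (delta_mx 0 l : 'rV[K]_n) 0 m = 1.
  rewrite (bigD1 l) //= mxE !eqxx big1 ?addr0 // => m /negPf ml.
  by rewrite mxE ml.
under eq_bigr do rewrite mxE [X in _ + X]mxE.
by rewrite big_split /= sumrN !sum_delta subrr.
Qed.

Fact hroot_hcoroot i j : i != j -> hroot i j (hcoroot i j) = 2.
Proof.
move=> ij; rewrite hrootE !hcorootE !eqxx (negPf ij) eq_sym (negPf ij).
by rewrite mulr0n mulr1n subr0 sub0r opprK.
Qed.

Fact hact_tperm i j (y : refl_rep) :
  hact (tperm i j) y = y - hroot i j y *: hcoroot i j.
Proof.
apply: hcoordP => k; rewrite hactE hrootE.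
have -> : forall b, hcoord (y - b *: hcoroot i j) k =
    hcoord y k - b * hcoord (hcoroot i j) k.
  by move=> b; rewrite /hcoord !mxE.
rewrite hcorootE.
case: tpermP => [->|->|/eqP/negPf-> /eqP/negPf->].
- rewrite eqxx; have [->|_] := eqVneq i j; first by rewrite subrr mul0r subr0.
  by rewrite subr0 mulr1 opprB addrC subrK.
- rewrite eqxx; have [->|_] := eqVneq j i; first by rewrite subrr mul0r subr0.
  by rewrite sub0r mulrN mulr1 opprK addrC subrK.
- by rewrite subrr mulr0 subr0.
Qed.

Fact dact_tperm i j (x : refl_dual) :
  dact (tperm i j) x = x - x (hcoroot i j) *: hroot i j.
Proof.
apply/lfunP => y; rewrite comp_lfunE tpermV hact_tperm linearB linearZ /=.
by rewrite add_lfunE opp_lfunE scale_lfunE /GRing.scale /= mulrC.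
Qed.

End Reflection.

Arguments hact {K n} w.
Arguments hroot {K n} i j.
Arguments hcoroot {K n} i j.

(** * The rational Cherednik algebra of the symmetric group *)

Section Cherednik.
Variables (K : fieldType) (n : nat) (c : K).

Inductive rca_gen : Type :=
| Grp of 'S_n
| Pos of refl_dual K n
| Mom of refl_rep K n.

Local Notation W w := (Gen (Grp w)).
Local Notation X x := (Gen (Pos x)).
Local Notation Y y := (Gen (Mom y)).

(* The first eight relations present the smash product of the group algebra
   with the tensor algebra of the sum of the reflection representation and its
   dual. The transpositions are enumerated as [tperm i j] with i < j. *)
Inductive rca_rel : term K rca_gen -> term K rca_gen -> Prop :=
| rca_grp1 : rca_rel (W 1%g) (Cst 1)
| rca_grpM u v : rca_rel (W (u * v)%g) (Mul (W u) (W v))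
| rca_posD x x' : rca_rel (X (x + x')) (Add (X x) (X x'))
| rca_posZ a x : rca_rel (X (a *: x)) (Mul (Cst a) (X x))
| rca_momD y y' : rca_rel (Y (y + y')) (Add (Y y) (Y y'))
| rca_momZ a y : rca_rel (Y (a *: y)) (Mul (Cst a) (Y y))
| rca_grp_pos w x : rca_rel (Mul (W w) (X x)) (Mul (X (dact w x)) (W w))
| rca_grp_mom w y : rca_rel (Mul (W w) (Y y)) (Mul (Y (hact w y)) (W w))
| rca_pos_pos x x' : rca_rel (Minus (Mul (X x) (X x')) (Mul (X x') (X x))) (Cst 0)
| rca_mom_mom y y' : rca_rel (Minus (Mul (Y y) (Y y')) (Mul (Y y') (Y y))) (Cst 0)
| rca_mom_pos y x :
    rca_rel (Minus (Mul (Y y) (X x)) (Mul (X x) (Y y)))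
      (Minus (Cst (x y : K))
        (Mul (Cst c)
          (\big[Add/Cst 0]_(p : 'I_n * 'I_n | (p.1 < p.2)%N)
            Mul (Cst (hroot p.1 p.2 y * x (hcoroot p.1 p.2)))
                (W (tperm p.1 p.2))))).

Definition rca : pzRingType := presented rca_rel.

Definition rca_cst (a : K) : rca := pcls rca_rel (Cst a).
Definition rca_grp (w : 'S_n) : rca := pcls rca_rel (W w).
Definition rca_pos (x : refl_dual K n) : rca := pcls rca_rel (X x).
Definition rca_mom (y : refl_rep K n) : rca := pcls rca_rel (Y y).

Fact rca_commutator (y : refl_rep K n) (x : refl_dual K n) :
  rca_mom y * rca_pos x - rca_pos x * rca_mom y =
  rca_cst (x y) - rca_cst c * \sum_(p : 'I_n * 'I_n | (p.1 < p.2)%N)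
    rca_cst (hroot p.1 p.2 y * x (hcoroot p.1 p.2)) * rca_grp (tperm p.1 p.2).
Proof.
have /pclsP := cong_rel (rca_mom_pos y x).
rewrite !pclsB !pclsM pcls_sum => ->; congr (_ - _ * _).
by apply: eq_bigr => p _; rewrite pclsM.
Qed.

(* The image of the algebra of polynomial functions on [refl_rep]. *)
Inductive rca_poly : rca -> Prop :=
| rca_poly_cst a : rca_poly (rca_cst a)
| rca_poly_pos x : rca_poly (rca_pos x)
| rca_poly_add f g : rca_poly f -> rca_poly g -> rca_poly (f + g)
| rca_poly_mul f g : rca_poly f -> rca_poly g -> rca_poly (f * g).

Definition rca_sym : rca :=
  rca_cst (#|[set: 'S_n]|%:R^-1) * \sum_(w : 'S_n) rca_grp w.

Section Modules.
Variable M : lmodType rca.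

Definition fin_gen_over_poly : Prop :=
  exists (r : nat) (g : 'I_r -> M), forall m : M,
    exists2 f : 'I_r -> rca, forall i, rca_poly (f i)
      & m = \sum_(i < r) f i *: g i.

Definition mom_locally_nilpotent : Prop :=
  forall m : M, exists N : nat, forall ys : seq (refl_rep K n),
    size ys = N -> foldr (fun y v => rca_mom y *: v) m ys = 0.

Definition in_category_O : Prop := fin_gen_over_poly /\ mom_locally_nilpotent.

Definition aspherical_module : Prop :=
  (exists m : M, m <> 0) /\ (forall m : M, rca_sym *: m = 0).

End Modules.

Definition aspherical_value : Prop :=
  exists M : lmodType rca, in_category_O M /\ aspherical_module M.

End Cherednik.

Definition Sigma (R : realType) (n : nat) : set R[i] :=
  [set c | aspherical_value n c]%classic.

(* [denq q] is the positive denominator of q in lowest terms. *)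
Definition Qset (R : realType) (n : nat) : set R[i] :=
  [set c | exists q : rat,
     [/\ -1 < q, q < 0, denq q <= n%:Z & c = ratr q]]%classic.

Arguments Sigma R n : clear implicits.
Arguments Qset R n : clear implicits.

(* Main.v *)
(** Let [c = - r / d] with [0 < r < d <= n], and let [S_n] act on polynomials
    with a twist by the sign. The generating function
    [\prod_(j < d) (1 - u x_j) ^ (r / d) / (1 - u x_i)] has as its coefficient of
    degree [r] a polynomial [f_i], monic in [x_i], killed by the Dunkl operators
    of [S_d]. The largest [S_n]-stable ideal inside [(f_1, ..., f_d)] is a
    submodule for [S_n], since the roots outside [S_d] are not zero divisors
    modulo [(f_i)]. Reducing exponents below [r < d], every polynomial has its
    antisymmetrization over [S_d] in the ideal by the pigeonhole principle, so
    the quotient is aspherical; evaluation at [0] shows that it is not zero.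

    Conversely let [M] be aspherical. A maximal set of roots whose product
    [delta] is not nilpotent on [M] yields a point [b] with [delta (b) != 0];
    the annihilator of [M] is stable under the Euler field and under
    [delta \partial_b], so that its elements vanish at [b], and the fiber of [M]
    along [b] is a nonzero space of finite dimension. It carries an action of
    the Cherednik algebra of the stabilizer [W_b], in which the sum of [W_b]
    vanishes because [M] is aspherical. Build this sum one letter at a time:
    if the letter [i] comes after [m] others in its block, of size [d], and
    [u], [u'] are the sums before and after, then taking the trace of [u]
    times the commutator of [x_i] with a vector fixed by the previous letters
    gives [c d Tr u' = (c d + m) Tr u]. As [Tr 1 != 0], some [c d + m] is zero. *)

From HB Require Import structures.
From mathcomp Require Import all_boot all_order all_algebra all_fingroup.
From mathcomp Require Import boolp ring_quotient generic_quotient.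
From mathcomp Require Import ring zify.
From mathcomp Require Import mpoly.
From mathcomp Require Import reals complex.
Require Import Defs.

Set Implicit Arguments.
Unset Strict Implicit.
Unset Printing Implicit Defensive.

Import Order.TTheory GRing.Theory Num.Theory.
Local Open Scope ring_scope.

(** The twist by the sign turns the vanishing of the symmetrizer into that of the antisymmetrizer,
    and the parameter [c] of the Dunkl operators into [- c]. Polynomials are kept in all [n]
    variables, where the permutations and the operators have their simplest form; functions on the
    reflection representation appear only after division by the sum of the variables, which momenta
    of coordinate sum zero respect. For the converse, the difficulty is to restrict [M] to a
    neighbourhood of [b]. Instead of a completion, one takes the elements that a power of [delta]
    sends into the multiples of the equations of [b] in the fixed space of [W_b], and divides by
    them. Modulo these elements the variables are scalars plus nilpotents, so that everything
    becomes matrices over the base field. Only the coincidences between the coordinates of [b]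
    matter, so that they can be taken rational. Reflections outside [W_b] have invertible roots
    there, and their part can be subtracted from the momenta, which leaves the relations of the
    smaller algebra. *)

(** * Induction on polynomials, derivatives of variables, sums over pairs *)

Lemma mpoly_ring_ind (K : comNzRingType) n (Q : {mpoly K[n]} -> Prop) :
  (forall a, Q a%:MP) -> (forall i, Q 'X_i) ->
  (forall p q, Q p -> Q q -> Q (p + q)) ->
  (forall p q, Q p -> Q q -> Q (p * q)) -> forall p, Q p.
Proof.
move=> QC QX QD QM; elim/mpolyind=> [|a m p _ _ Qp]; first by rewrite -mpolyC0.
apply: (QD) => //; rewrite -mul_mpolyC; apply: (QM) => //.
rewrite mpolyXE_id; apply: (big_ind Q); [by rewrite -mpolyC1|exact: QM|move=> i _].
by elim: (m i) => [|e IH]; rewrite ?expr0 -?mpolyC1 // exprS; apply: (QM).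
Qed.

(** Serves identities known only through commutators with the variables, where the property need not
    be stable under products. *)
Lemma mpoly_mulX_ind (K : comNzRingType) n (Q : {mpoly K[n]} -> Prop) :
  (forall a, Q a%:MP) -> (forall p q, Q p -> Q q -> Q (p + q)) ->
  (forall i p, Q p -> Q ('X_i * p)) -> forall p, Q p.
Proof.
move=> QC QD QX; elim/mpolyind=> [|a m p _ _ Qp]; first by rewrite -mpolyC0.
apply: (QD) => //; rewrite mpolyXE_id -mul_mpolyC mulrC.
elim: (index_enum _) => [|i r IH]; first by rewrite big_nil mul1r.
rewrite big_cons -mulrA; elim: (m i) => [|e IHe]; first by rewrite mul1r.
by rewrite exprS -mulrA; apply: (QX).
Qed.

Lemma mderivXU (K : nzRingType) n (i l : 'I_n) :
  ('X_l : {mpoly K[n]})^`M(i) = (l == i)%:R.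
Proof.
rewrite mderivX mnm1E; case: eqP => [->|_]; last by rewrite scale0r.
have -> : (U_(i) - U_(i) = 0 :> 'X_{1..n})%MM.
  by apply/mnmP => j; rewrite mnmBE mnm0E subnn.
by rewrite mpolyX0 scale1r.
Qed.

Lemma mderiv_sum (K : nzRingType) n (a : 'I_n) (I : Type) (r : seq I)
    (Q : pred I) (F : I -> {mpoly K[n]}) :
  (\sum_(j <- r | Q j) F j)^`M(a) = \sum_(j <- r | Q j) (F j)^`M(a).
Proof. exact: raddf_sum. Qed.

Lemma sum_offdiag (V : nmodType) n (F : 'I_n -> 'I_n -> V) :
  \sum_i \sum_(j | j != i) F i j =
  \sum_(p : 'I_n * 'I_n | (p.1 < p.2)%N) (F p.1 p.2 + F p.2 p.1).
Proof.
rewrite pair_big_dep /= (bigID (fun p : 'I_n * 'I_n => (p.1 < p.2)%N)) /=.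
rewrite big_split /=; congr (_ + _).
  by apply: eq_bigl => -[i j] /=; rewrite -val_eqE /=; case: ltngtP.
rewrite (reindex (fun p : 'I_n * 'I_n => (p.2, p.1))) /=; last first.
  by exists (fun p : 'I_n * 'I_n => (p.2, p.1)) => -[].
by apply: eq_bigl => -[i j] /=; rewrite -val_eqE /=; case: ltngtP.
Qed.

(** * Dunkl operators *)

Section DividedDifferences.
Variables (K : fieldType) (n : nat).
Local Notation P := {mpoly K[n]}.
Implicit Types (p q : P) (i j l : 'I_n) (w : 'S_n).

Lemma msymX1 w i : msym w 'X_i = 'X_(w i) :> P.
Proof. by rewrite /msym mmapX mmap1U. Qed.

Lemma msymC w a : msym w a%:MP = a%:MP :> P.
Proof. by rewrite /msym mmapC. Qed.

Lemma msym_sum w (I : Type) (r : seq I) (Q : pred I) (F : I -> P) :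
  msym w (\sum_(j <- r | Q j) F j) = \sum_(j <- r | Q j) msym w (F j).
Proof. exact: raddf_sum. Qed.

Lemma divdiff_ex i j p :
  exists q, p - msym (tperm i j) p = ('X_i - 'X_j) * q.
Proof.
elim/mpoly_ring_ind: p => [a|l|p q [p' Hp] [q' Hq]|p q [p' Hp] [q' Hq]].
- by exists 0; rewrite msymC subrr mulr0.
- rewrite msymX1; case: tpermP => [->|->|_ _].
  + by exists 1; rewrite mulr1.
  + by exists (-1); rewrite mulrN1 opprB.
  + by exists 0; rewrite subrr mulr0.
- by exists (p' + q'); rewrite msymD opprD addrACA Hp Hq mulrDr.
- exists (p * q' + p' * msym (tperm i j) q).
  rewrite msymM mulrDr mulrCA -Hq mulrA -Hp mulrBr mulrBl.
  by rewrite addrA subrK.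
Qed.

Definition divdiff i j p : P := sval (cid (divdiff_ex i j p)).

Lemma divdiffE i j p : ('X_i - 'X_j) * divdiff i j p = p - msym (tperm i j) p.
Proof. by rewrite /divdiff; case: cid => q /= ->. Qed.

Lemma mpolyXB_neq0 i j : i != j -> 'X_i - 'X_j != 0 :> P.
Proof.
move=> ij; rewrite subr_eq0; apply: contraNneq ij => /(congr1 (mcoeff U_(i))).
rewrite !mcoeffXU eqxx eq_sym; case: (i == j) => // /eqP.
by rewrite oner_eq0.
Qed.

Lemma divdiff_uniq i j p q : i != j ->
  ('X_i - 'X_j) * q = p - msym (tperm i j) p -> divdiff i j p = q.
Proof.
by move=> /mpolyXB_neq0 ij Hq; apply: (mulfI ij); rewrite divdiffE.
Qed.

Lemma divdiffD i j p q : i != j ->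
  divdiff i j (p + q) = divdiff i j p + divdiff i j q.
Proof.
by move=> ij; apply: divdiff_uniq; rewrite // mulrDr !divdiffE msymD; ring.
Qed.

Lemma divdiffM i j p q : i != j ->
  divdiff i j (p * q) = p * divdiff i j q + divdiff i j p * msym (tperm i j) q.
Proof.
move=> ij; apply: divdiff_uniq => //.
by rewrite mulrDr mulrCA divdiffE mulrA divdiffE msymM; ring.
Qed.

Lemma divdiff_sym0 i j p : i != j ->
  msym (tperm i j) p = p -> divdiff i j p = 0.
Proof. by move=> ij Hp; apply: divdiff_uniq; rewrite // Hp subrr mulr0. Qed.

Lemma divdiffC i j a : i != j -> divdiff i j a%:MP = 0.
Proof. by move=> ij; apply: divdiff_sym0 => //; apply: msymC. Qed.

Lemma divdiffZ i j a p : i != j -> divdiff i j (a *: p) = a *: divdiff i j p.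
Proof.
by move=> ij; rewrite -!mul_mpolyC divdiffM // divdiffC // mul0r addr0.
Qed.

Lemma divdiffX i j l : i != j ->
  divdiff i j 'X_l = ((l == i)%:R - (l == j)%:R)%:MP.
Proof.
move=> ij; apply: divdiff_uniq => //; rewrite msymX1.
case: tpermP => [->|->|/eqP/negPf-> /eqP/negPf->].
- by rewrite eqxx (negPf ij) subr0 mpolyC1 mulr1.
- by rewrite eqxx eq_sym (negPf ij) sub0r mpolyCN mpolyC1 mulrN1 opprB.
- by rewrite !subrr mpolyC0 mulr0.
Qed.

Lemma divdiff_msym i j w p : i != j ->
  msym w (divdiff i j p) = divdiff (w i) (w j) (msym w p).
Proof.
move=> ij; apply/esym/divdiff_uniq; first by rewrite (inj_eq perm_inj).
have := congr1 (msym w) (divdiffE i j p).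
rewrite msymM !msymB !msymX1 => ->; congr (_ - _).
by rewrite -!msymMm -tpermJ conjgE !mulgA mulgV mul1g.
Qed.

End DividedDifferences.

(** The set [A] singles out a parabolic subgroup: singularity concerns the permutations of the first
    [d] letters, stability of the ideal all permutations, and the two operators have to be
    compared. *)
HB.lock Definition pdunkl (K : fieldType) n (A : {set 'I_n}) (k : K) (i : 'I_n)
  (p : {mpoly K[n]}) : {mpoly K[n]} :=
  p^`M(i) - k *: \sum_(j in A | j != i) divdiff i j p.

Section PartialDunkl.
Variables (K : fieldType) (n : nat) (A : {set 'I_n}) (k : K).
Local Notation P := {mpoly K[n]}.
Implicit Types (p q : P) (i j l : 'I_n) (w : 'S_n).
Local Notation dunkl := (pdunkl A k).

Lemma pdunklE i p :
  dunkl i p = p^`M(i) - k *: \sum_(j in A | j != i) divdiff i j p.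
Proof. by rewrite unlock. Qed.

Lemma pdunkl_is_linear i : linear (dunkl i).
Proof.
move=> a p q; rewrite !pdunklE linearP scalerBr.
have -> : \sum_(j in A | j != i) divdiff i j (a *: p + q) =
    a *: (\sum_(j in A | j != i) divdiff i j p) +
    \sum_(j in A | j != i) divdiff i j q.
  rewrite scaler_sumr -big_split; apply: eq_bigr => j /andP[_ ji].
  by rewrite divdiffD 1?eq_sym // divdiffZ 1?eq_sym.
by rewrite scalerDr !scalerA [k * a]mulrC opprD addrACA.
Qed.
HB.instance Definition _ i := GRing.isLinear.Build K P P *:%R (dunkl i)
  (pdunkl_is_linear i).

Lemma pdunklD i p q : dunkl i (p + q) = dunkl i p + dunkl i q.
Proof. exact: linearD. Qed.
Lemma pdunklB i p q : dunkl i (p - q) = dunkl i p - dunkl i q.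
Proof. exact: linearB. Qed.
Lemma pdunklZ i a p : dunkl i (a *: p) = a *: dunkl i p.
Proof. exact: linearZ. Qed.
Lemma pdunkl_sum i (I : Type) (r : seq I) (Q : pred I) (F : I -> P) :
  dunkl i (\sum_(j <- r | Q j) F j) = \sum_(j <- r | Q j) dunkl i (F j).
Proof. exact: raddf_sum. Qed.

Lemma pdunklC i a : dunkl i a%:MP = 0.
Proof.
rewrite pdunklE mderivC big1 ?scaler0 ?subr0 // => j /andP[_ ji].
by rewrite divdiffC // eq_sym.
Qed.

Lemma pdunklM i p q : dunkl i (p * q) = p * dunkl i q + p^`M(i) * q -
  k *: \sum_(j in A | j != i) divdiff i j p * msym (tperm i j) q.
Proof.
rewrite !pdunklE mderivM.
have -> : \sum_(j in A | j != i) divdiff i j (p * q) =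
    p * (\sum_(j in A | j != i) divdiff i j q) +
    \sum_(j in A | j != i) divdiff i j p * msym (tperm i j) q.
  rewrite mulr_sumr -big_split; apply: eq_bigr => j /andP[_ ji].
  by rewrite divdiffM // eq_sym.
by rewrite scalerDr mulrBr scalerAr; ring.
Qed.

Lemma pdunkl_mulX i l p : dunkl i ('X_l * p) = 'X_l * dunkl i p +
  (if l == i then p - k *: \sum_(j in A | j != i) msym (tperm i j) p
   else if l \in A then k *: msym (tperm i l) p else 0).
Proof.
have eD j : j \in A -> j != i -> divdiff i j 'X_l * msym (tperm i j) p =
    ((l == i)%:R - (l == j)%:R) *: msym (tperm i j) p.
  by move=> _ ji; rewrite divdiffX 1?eq_sym // mul_mpolyC.
rewrite pdunklM mderivXU -addrA; congr (_ + _).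
have -> : \sum_(j in A | j != i) divdiff i j 'X_l * msym (tperm i j) p =
    \sum_(j in A | j != i) ((l == i)%:R - (l == j)%:R) *: msym (tperm i j) p.
  by apply: eq_bigr => j /andP[]; apply: eD.
have [->|li] := eqVneq l i.
  rewrite mul1r; congr (_ - _ *: _); apply: eq_bigr => j /andP[_ ji].
  by rewrite eq_sym (negPf ji) subr0 scale1r.
rewrite mul0r add0r; case: ifP => lA; last first.
  rewrite big1 ?scaler0 ?oppr0 // => j /andP[jA ji].
  by case: eqP lA jA => [-> ->//|_ _ _]; rewrite subrr scale0r.
have -> : \sum_(j in A | j != i) (0 - (l == j)%:R) *: msym (tperm i j) p =
    - msym (tperm i l) p.
  rewrite (bigD1 l) ?lA //= eqxx big1 ?addr0 ?sub0r ?scaleN1r //.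
  by move=> j /andP[_ jl]; rewrite eq_sym (negPf jl) subr0 scale0r.
by rewrite scalerN opprK.
Qed.

End PartialDunkl.

(** * Equivariance and commutativity of the Dunkl operators *)

Section Dunkl.
Variables (K : fieldType) (n : nat) (k : K).
Local Notation P := {mpoly K[n]}.
Implicit Types (p q : P) (i j l : 'I_n) (w : 'S_n).
Local Notation dunkl := (pdunkl setT k).

Lemma dunklE i p : dunkl i p = p^`M(i) - k *: \sum_(j | j != i) divdiff i j p.
Proof.
rewrite pdunklE; congr (_ - _ *: _).
by apply: eq_bigl => j; rewrite inE.
Qed.

Lemma dunkl_mulX i l p : dunkl i ('X_l * p) = 'X_l * dunkl i p +
  (if l == i then p - k *: \sum_(j | j != i) msym (tperm i j) p
   else k *: msym (tperm i l) p).
Proof.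
rewrite pdunkl_mulX inE; congr (_ + _); case: eqP => // _.
by congr (_ - _ *: _); apply: eq_bigl => j; rewrite inE.
Qed.

Lemma dunkl_msym i w p : msym w (dunkl i p) = dunkl (w i) (msym w p).
Proof.
rewrite !dunklE msymB msymZ.
have -> : msym w (mderiv i p) = mderiv (w i) (msym w p).
  elim/mpoly_ring_ind: p => [a|l|p q Hp Hq|p q Hp Hq].
  - by rewrite mderivC msym0 msymC mderivC.
  - rewrite msymX1 !mderivXU (inj_eq perm_inj).
    by case: eqP => _; rewrite ?msym1 ?msym0.
  - by rewrite mderivD !msymD mderivD Hp Hq.
  - by rewrite mderivM msymD !msymM mderivM Hp Hq.
congr (_ - _ *: _); rewrite raddf_sum [RHS](reindex_inj (@perm_inj _ w)) /=.
apply: eq_big => [j|j ji]; first by rewrite (inj_eq perm_inj).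
by rewrite divdiff_msym // eq_sym.
Qed.

(** The transposition of [j] and [m] commutes with the operator in direction [i] unless [m = i],
    when it turns it into the one in direction [j]; the two isolated terms record that exception. *)
Lemma dunkl_sum_tperm i j p : i != j ->
  dunkl i (\sum_(m | m != j) msym (tperm j m) p) + dunkl j (msym (tperm i j) p) =
  \sum_(m | m != j) msym (tperm j m) (dunkl i p) + dunkl i (msym (tperm i j) p).
Proof.
move=> ij; rewrite pdunkl_sum (bigD1 i) //= [in RHS](bigD1 i) //=.
rewrite dunkl_msym tpermR [tperm j i]tpermC.
have -> : \sum_(m | (m != j) && (m != i)) msym (tperm j m) (dunkl i p) =
    \sum_(m | (m != j) && (m != i)) dunkl i (msym (tperm j m) p).
  by apply: eq_bigr => m /andP[mj mi]; rewrite dunkl_msym tpermD // eq_sym.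
by rewrite addrAC [RHS]addrAC; congr (_ + _); apply: addrC.
Qed.

(* The commutator of two Dunkl operators kills the constants and commutes with
   the multiplication by each variable. *)
Lemma dunkl_comm i j p : dunkl i (dunkl j p) = dunkl j (dunkl i p).
Proof.
have [->//|ij] := eqVneq i j; have ji : j != i by rewrite eq_sym.
elim/mpoly_mulX_ind: p => [a|p q Hp Hq|l p Hp].
- by rewrite !pdunklC.
- by rewrite !pdunklD Hp Hq.
(* The variable is one of the two directions; the claim is symmetric in them, so that one
   computation serves [l = i] and [l = j]. *)
have core a b : a != b ->
    dunkl b p - k *: (\sum_(m | m != a) msym (tperm a m) (dunkl b p)) +
      dunkl a (k *: msym (tperm b a) p) =
    k *: msym (tperm b a) (dunkl a p) +
      dunkl b (p - k *: \sum_(m | m != a) msym (tperm a m) p).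
  move=> ab; rewrite pdunklB !pdunklZ [msym _ (dunkl a p)]dunkl_msym tpermR.
  have := dunkl_sum_tperm p (_ : b != a); rewrite eq_sym => /(_ ab) H.
  have {}H : dunkl b (\sum_(m | m != a) msym (tperm a m) p) =
      \sum_(m | m != a) msym (tperm a m) (dunkl b p) +
      dunkl b (msym (tperm b a) p) - dunkl a (msym (tperm b a) p).
    by rewrite -H addrK.
  by rewrite H scalerBr scalerDr; ring.
rewrite (dunkl_mulX j l p) (dunkl_mulX i l p) pdunklD dunkl_mulX Hp.
rewrite (pdunklD _ _ j ('X_l * _)) (dunkl_mulX j l (dunkl i p)).
have cancel (u a b a' b' : P) : a + b = a' + b' -> u + a + b = u + a' + b'.
  by move=> H; rewrite -!addrA H.
apply: cancel.
have [->|li] := eqVneq l i; first by rewrite (negPf ij) core.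
have [->|lj] := eqVneq l j; first by rewrite -core.
have eij : tperm i l j = j by rewrite tpermD // eq_sym.
have eji : tperm j l i = i by rewrite tpermD // eq_sym.
by rewrite !pdunklZ !dunkl_msym eij eji; apply: addrC.
Qed.

End Dunkl.

(** * The polynomial representation and its quotients *)

Section Coordinates.
Variables (K : numFieldType) (n : nat).
Implicit Types (y : refl_rep K n) (x : refl_dual K n) (i j : 'I_n) (w : 'S_n).

Lemma hcoordD y z i : hcoord (y + z) i = hcoord y i + hcoord z i.
Proof. by rewrite /hcoord !mxE. Qed.

Lemma hcoordZ a y i : hcoord (a *: y) i = a * hcoord y i.
Proof. by rewrite /hcoord !mxE. Qed.

Lemma hcoord0 i : hcoord (0 : refl_rep K n) i = 0.
Proof. by rewrite /hcoord !mxE. Qed.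

Lemma hcoordB y z i : hcoord (y - z) i = hcoord y i - hcoord z i.
Proof. by rewrite /hcoord !mxE. Qed.

Lemma hcoord_sum (I : Type) (r : seq I) (Q : pred I) (F : I -> refl_rep K n) i :
  hcoord (\sum_(j <- r | Q j) F j) i = \sum_(j <- r | Q j) hcoord (F j) i.
Proof.
by apply: (big_morph (fun y => hcoord y i)) => [y z|]; rewrite ?hcoordD ?hcoord0.
Qed.

Definition hvec (v : 'I_n -> K) : refl_rep K n :=
  vsproj (sum0 K n) (\row_i v i).

Lemma hvecE v i : \sum_j v j = 0 -> hcoord (hvec v) i = v i.
Proof.
move=> v0; rewrite /hcoord vsprojK ?mxE // mem_sum0.
by rewrite (eq_bigr v) ?v0 // => j _; rewrite mxE.
Qed.

(** The projection of the [i]-th basis vector along the constant vectors. These [n] vectors are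
    permuted by the group but have sum zero, so that [hproj_sum] is an expansion in a spanning
    family and not in a basis. *)
Definition hproj i : refl_rep K n := hvec (fun j => (j == i)%:R - n%:R^-1).

Lemma hprojE i j : hcoord (hproj i) j = (j == i)%:R - n%:R^-1.
Proof.
have n0 : n%:R != 0 :> K by rewrite pnatr_eq0 -lt0n (leq_ltn_trans _ (ltn_ord i)).
apply: hvecE; rewrite sumrB sumr_const card_ord -[_ *+ n]mulr_natl mulfV //.
by rewrite (bigD1 i) //= eqxx big1 ?addr0 ?subrr // => l /negPf ->.
Qed.

Lemma hproj_sum y : y = \sum_i hcoord y i *: hproj i.
Proof.
apply: hcoordP => j; rewrite hcoord_sum.
under eq_bigr do rewrite hcoordZ hprojE mulrBr.
rewrite sumrB -mulr_suml sum_hcoord mul0r subr0 (bigD1 j) //= eqxx mulr1.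
by rewrite big1 ?addr0 // => i; rewrite eq_sym => /negPf ->; rewrite mulr0.
Qed.

Lemma hcoroot_hproj i j : hcoroot i j = hproj i - hproj j.
Proof.
apply: hcoordP => l; rewrite hcorootE hcoordB !hprojE.
by ring.
Qed.

Lemma hact_hproj w i : hact w (hproj i) = hproj (w^-1%g i).
Proof.
by apply: hcoordP => j; rewrite hactE !hprojE -[in RHS](inj_eq (@perm_inj _ w)) permKV.
Qed.

Lemma dact_hproj w x i : dact w x (hproj i) = x (hproj (w i)).
Proof. by rewrite comp_lfunE hact_hproj invgK. Qed.

Lemma dual_hproj x y : x y = \sum_i hcoord y i * x (hproj i).
Proof.
by rewrite [in LHS](hproj_sum y) linear_sum; under eq_bigr do rewrite linearZ.
Qed.

Lemma dual_hcoroot x i j : x (hcoroot i j) = x (hproj i) - x (hproj j).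
Proof. by rewrite hcoroot_hproj linearB. Qed.

Fact xcoord_is_linear i : linear (fun y => hcoord y i : K^o).
Proof. by move=> a y z; rewrite hcoordD hcoordZ. Qed.

Definition xcoord i : refl_dual K n := linfun (fun y => hcoord y i : K^o).

Lemma xcoordE i y : xcoord i y = hcoord y i.
Proof.
pose L := GRing.isLinear.Build K (refl_rep K n) K^o *:%R _ (xcoord_is_linear i).
pose f : {linear refl_rep K n -> K^o} := HB.pack (fun y => hcoord y i : K^o) L.
exact: (lfunE f).
Qed.

Lemma dual_xcoord x : x = \sum_i x (hproj i) *: xcoord i.
Proof.
apply/lfunP => y; rewrite dual_hproj sum_lfunE; apply: eq_bigr => i _.
by rewrite scale_lfunE xcoordE /GRing.scale /= mulrC.
Qed.

End Coordinates.

(** * The polynomial representation twisted by the sign *)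

Section PolynomialRepresentation.
Variables (K : numFieldType) (n : nat) (c : K).
Local Notation P := {mpoly K[n]}.
Local Notation D := (pdunkl setT (- c)).
Implicit Types (p q : P) (y : refl_rep K n) (x : refl_dual K n) (w : 'S_n).

(** The extension of [x] to the whole coordinate space by zero on the constant vectors. *)
Definition pos_form x : P := \sum_i x (hproj K i) *: 'X_i.
Definition mom_op y p : P := \sum_i hcoord y i *: D i p.
Definition grp_op w p : P := (-1) ^+ w *: msym w^-1%g p.

(** Terms act before any quotient is taken; compatibility with the presentation is then the single
    statement [term_op_cong]. *)
Fixpoint term_op (t : term K (rca_gen K n)) (p : P) : P :=
  match t with
  | Cst a => a *: p
  | Gen (Grp w) => grp_op w p
  | Gen (Pos x) => pos_form x * p
  | Gen (Mom y) => mom_op y p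
  | Add t u => term_op t p + term_op u p
  | Mul t u => term_op t (term_op u p)
  end.

Lemma mom_op_linear y a p q : mom_op y (a *: p + q) = a *: mom_op y p + mom_op y q.
Proof.
rewrite /mom_op scaler_sumr -big_split; apply: eq_bigr => i _.
by rewrite pdunklD pdunklZ scalerDr !scalerA mulrC.
Qed.

Lemma grp_op_linear w a p q : grp_op w (a *: p + q) = a *: grp_op w p + grp_op w q.
Proof. by rewrite /grp_op msymD msymZ scalerDr !scalerA mulrC. Qed.

Lemma term_op_is_linear t : linear (term_op t).
Proof.
elim: t => [b|[w|x|y]|t IHt u IHu|t IHt u IHu] a p q /=.
- by rewrite scalerDr !scalerA mulrC.
- exact: grp_op_linear.
- by rewrite mulrDr scalerAr.
- exact: mom_op_linear.
- by rewrite IHt IHu scalerDr addrACA.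
- by rewrite IHu IHt.
Qed.
HB.instance Definition _ t := GRing.isLinear.Build K P P *:%R (term_op t)
  (term_op_is_linear t).

Lemma pos_formD x x' : pos_form (x + x') = pos_form x + pos_form x'.
Proof.
by rewrite -big_split; apply: eq_bigr => i _; rewrite add_lfunE scalerDl.
Qed.

Lemma pos_formZ a x : pos_form (a *: x) = a *: pos_form x.
Proof.
by rewrite scaler_sumr; apply: eq_bigr => i _; rewrite scale_lfunE scalerA.
Qed.

Lemma grp_opM u v p : grp_op (u * v)%g p = grp_op u (grp_op v p).
Proof.
by rewrite /grp_op msymZ scalerA -msymMm invMg odd_permM signr_addb.
Qed.

Lemma grp_pos w x p : grp_op w (pos_form x * p) = pos_form (dact w x) * grp_op w p.
Proof.
rewrite /grp_op msymM scalerAr; congr (_ * _).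
rewrite msym_sum (reindex_inj (@perm_inj _ w)); apply: eq_bigr => i _.
by rewrite dact_hproj msymZ msymX1 permK.
Qed.

Lemma grp_mom w y p : grp_op w (mom_op y p) = mom_op (hact w y) (grp_op w p).
Proof.
rewrite /grp_op msym_sum scaler_sumr (reindex_inj (@perm_inj _ w)).
apply: eq_bigr => i _.
by rewrite hactE msymZ dunkl_msym permK pdunklZ !scalerA mulrC.
Qed.

Lemma mom_op_comm y y' p : mom_op y (mom_op y' p) = mom_op y' (mom_op y p).
Proof.
have E z z' : mom_op z (mom_op z' p) =
    \sum_i \sum_j (hcoord z i * hcoord z' j) *: D i (D j p).
  apply: eq_bigr => i _; rewrite pdunkl_sum scaler_sumr.
  by apply: eq_bigr => j _; rewrite pdunklZ scalerA.
rewrite !E exchange_big; apply: eq_bigr => i _; apply: eq_bigr => j _.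
by rewrite dunkl_comm mulrC.
Qed.

(** Reduces to the commutator of a Dunkl operator with a variable. The sign by which [grp_op] twists
    a transposition cancels that of the parameter [- c], so that the relation comes out with [c]. *)
Lemma mom_pos y x p : mom_op y (pos_form x * p) = pos_form x * mom_op y p +
  (x y *: p - c *: \sum_(s : 'I_n * 'I_n | (s.1 < s.2)%N)
     (hroot s.1 s.2 y * x (hcoroot s.1 s.2)) *: grp_op (tperm s.1 s.2) p).
Proof.
pose x' i := x (hproj K i); pose S i j := msym (tperm i j) p.
have -> : mom_op y (pos_form x * p) =
    \sum_i \sum_l (hcoord y i * x' l) *: D i ('X_l * p).
  apply: eq_bigr => i _; rewrite mulr_suml pdunkl_sum scaler_sumr.
  by apply: eq_bigr => j _; rewrite -scalerAl pdunklZ scalerA.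
have comm i : \sum_l (hcoord y i * x' l) *: D i ('X_l * p) =
    pos_form x * (hcoord y i *: D i p) + (hcoord y i * x' i) *: p +
    c *: \sum_(j | j != i) (hcoord y i * (x' i - x' j)) *: S i j.
  under eq_bigr do rewrite dunkl_mulX scalerDr.
  rewrite big_split /= -addrA; congr (_ + _).
    rewrite mulr_suml; apply: eq_bigr => l _.
    by rewrite -scalerAl -scalerAr scalerA mulrC.
  rewrite (bigD1 i) //= eqxx scalerBr -addrA; congr (_ + _).
  rewrite -scalerN -scaleNr opprK !scaler_sumr -big_split /=; apply: eq_bigr => j ji.
  rewrite (negPf ji) !scalerA -scalerDl /S; congr (_ *: _).
  by rewrite mulrBr mulrBr mulrN mulrC [_ * x' j * c]mulrC.
rewrite (eq_bigr _ (fun i _ => comm i)) !big_split /= -addrA; congr (_ + _).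
  by rewrite /mom_op mulr_sumr.
rewrite -scaler_suml -dual_hproj; congr (_ + _).
rewrite -scaler_sumr -scalerN -sumrN; congr (_ *: _).
rewrite sum_offdiag; apply: eq_bigr => -[i j] /= ij.
rewrite /grp_op odd_tperm -val_eqE ltn_eqF //= expr1 scaleN1r scalerN opprK.
rewrite tpermV /S [tperm j i]tpermC -scalerDl hrootE dual_hcoroot.
by congr (_ *: _); rewrite /x'; ring.
Qed.

Lemma term_op_cong t u p : cong (@rca_rel K n c) t u -> term_op t p = term_op u p.
Proof.
move=> tu; elim: tu p => {t u}
  [t u tu|t|t u _ IH|t u v _ IH1 _ IH2|t t' u u' _ IH1 _ IH2|t t' u u' _ IH1 _ IH2
  |t u v|t u|t|t u v|t|t|t u v|t u v|t|a b|a b|a t] p //=.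
- case: tu p => [|u' v|x x'|a x|y y'|a y|w x|w y|x x'|y y'|y x] p /=.
  + by rewrite /grp_op odd_perm1 expr0 scale1r invg1 msym1m scale1r.
  + exact: grp_opM.
  + by rewrite pos_formD mulrDl.
  + by rewrite pos_formZ scalerAl.
  + rewrite /mom_op -big_split; apply: eq_bigr => i _.
    by rewrite hcoordD scalerDl.
  + rewrite /mom_op scaler_sumr; apply: eq_bigr => i _.
    by rewrite hcoordZ scalerA.
  + exact: grp_pos.
  + exact: grp_mom.
  + by rewrite scaleN1r mulrCA subrr scale0r.
  + by rewrite scaleN1r mom_op_comm subrr scale0r.
  + rewrite !scaleN1r mom_pos addrAC subrr add0r; congr (_ - _ *: _).
    rewrite (big_morph (fun t => term_op t p) (id1 := 0) (op1 := +%R)) ?scale0r //.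
    exact: scale0r.
- by rewrite IH1 IH2.
- by rewrite IH1 IH2.
- by rewrite IH2 IH1.
- by rewrite addrA.
- by rewrite addrC.
- by rewrite scale0r add0r.
- by rewrite scale1r.
- by rewrite scale1r.
- by rewrite raddfD.
- by rewrite !scale0r.
- by rewrite scalerDl.
- by rewrite scalerA.
- by rewrite linearZ.
Qed.

End PolynomialRepresentation.

(** * Quotients of the polynomial representation and a criterion for asphericity *)

Section QuotientModule.
Variables (K : numFieldType) (n : nat) (c : K).
Local Notation P := {mpoly K[n]}.
Local Notation D := (pdunkl setT (- c)).
Variables (I : zmodClosed P).
Definition rca_stable : Prop := forall t p, p \in I -> term_op c t p \in I.
Hypothesis stableI : rca_stable.

(** The proof of stability is an argument of the type, so that the module structure, whose laws rest
    on it, can be attached to the quotient. *)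
Definition quot_rep of rca_stable : Type := Quotient.quot I.
Local Notation M := (quot_rep stableI).
HB.instance Definition _ := GRing.Zmodule.on M.
Local Notation cls := (fun p : P => (\pi p)%qT : M).

Lemma quot_repP p q : cls p = cls q <-> p - q \in I.
Proof. by rewrite Quotient.idealrBE; split=> [->|/eqP]. Qed.

Lemma quot_rep_ind (Q : M -> Prop) : (forall p, Q (cls p)) -> forall m, Q m.
Proof. by move=> H m; rewrite -[m]reprK; apply: H. Qed.

Lemma clsD p q : cls (p + q) = cls p + cls q.
Proof. exact: (Quotient.pi_add I). Qed.

Lemma cls0 : cls 0 = 0.
Proof. by apply: (addrI (cls 0)); rewrite -clsD !addr0. Qed.

Definition quot_scale (h : rca n c) (m : M) : M := cls (term_op c (repr h) (repr m)).

Lemma quot_scaleE t p : quot_scale (pcls _ t) (cls p) = cls (term_op c t p).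
Proof.
rewrite /quot_scale (term_op_cong _ (repr_pcls _ t)).
apply/quot_repP; rewrite -linearB; apply: stableI.
by apply/quot_repP; rewrite reprK.
Qed.

Fact quot_scaleA a b m : quot_scale a (quot_scale b m) = quot_scale (a * b) m.
Proof.
elim/pcls_ind: a => t; elim/pcls_ind: b => u; elim/quot_rep_ind: m => p.
by rewrite -pclsM !quot_scaleE.
Qed.
Fact quot_scale1 : left_id 1 quot_scale.
Proof. by elim/quot_rep_ind=> p; rewrite quot_scaleE /= scale1r. Qed.
Fact quot_scaleDr : right_distributive quot_scale +%R.
Proof.
move=> a m m'; elim/pcls_ind: a => t; elim/quot_rep_ind: m => p.
by elim/quot_rep_ind: m' => q; rewrite -clsD !quot_scaleE raddfD clsD.
Qed.
Fact quot_scaleDl m : {morph quot_scale^~ m : a b / a + b}.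
Proof.
move=> a b; elim/pcls_ind: a => t; elim/pcls_ind: b => u.
by elim/quot_rep_ind: m => p; rewrite -pclsD !quot_scaleE /= clsD.
Qed.
HB.instance Definition _ := GRing.Zmodule_isLmodule.Build (rca n c) M
  quot_scaleA quot_scale1 quot_scaleDr quot_scaleDl.

Lemma pcls_cls t p : (pcls _ t : rca n c) *: cls p = cls (term_op c t p).
Proof. exact: quot_scaleE. Qed.

(** The order of nilpotency plays the role of the degree: multiplication by a variable raises it by
    at most one, because the commutator with a Dunkl operator only involves permutations, which
    preserve it. *)
Fixpoint dunkl_nil N (p : P) : Prop :=
  if N is N'.+1 then forall i, dunkl_nil N' (D i p) else p = 0.

Lemma dunkl_nil_lin N a p q :
  dunkl_nil N p -> dunkl_nil N q -> dunkl_nil N (a *: p + q).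
Proof.
elim: N p q => [|N IH] p q /=; first by move=> -> ->; rewrite scaler0 addr0.
by move=> Hp Hq i; rewrite pdunklD pdunklZ; apply: IH.
Qed.

Lemma dunkl_nil0 N : dunkl_nil N 0.
Proof. by elim: N => [|N IH] //= i; rewrite linear0. Qed.

Lemma dunkl_nilD N p q : dunkl_nil N p -> dunkl_nil N q -> dunkl_nil N (p + q).
Proof. by rewrite -{2}[p]scale1r; apply: dunkl_nil_lin. Qed.

Lemma dunkl_nilZ N a p : dunkl_nil N p -> dunkl_nil N (a *: p).
Proof.
move=> Hp; rewrite -[_ *: _]addr0; apply: dunkl_nil_lin => //.
exact: dunkl_nil0.
Qed.

Lemma dunkl_nil_sum N (J : finType) (Q : pred J) (F : J -> P) :
  (forall j, dunkl_nil N (F j)) -> dunkl_nil N (\sum_(j | Q j) F j).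
Proof. by move=> H; elim/big_ind: _ => //; [apply: dunkl_nil0|apply: dunkl_nilD]. Qed.

Lemma dunkl_nilS N p : dunkl_nil N p -> dunkl_nil N.+1 p.
Proof.
elim: N p => [|N IH] p; first by move=> /= -> i; rewrite linear0.
by move=> Hp i; apply: IH; apply: Hp.
Qed.

Lemma dunkl_nil_leq N N' p : (N <= N')%N -> dunkl_nil N p -> dunkl_nil N' p.
Proof.
move=> /subnKC <-; elim: (N' - N)%N => [|e IH]; rewrite ?addn0 // addnS.
by move=> /IH /dunkl_nilS.
Qed.

Lemma dunkl_nil_msym N w p : dunkl_nil N p -> dunkl_nil N (msym w p).
Proof.
elim: N p => [|N IH] p /=; first by move=> ->; rewrite msym0.
by move=> Hp i; rewrite -(permKV w i) -dunkl_msym; apply: IH.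
Qed.

Lemma dunkl_nil_mulX N l p : dunkl_nil N p -> dunkl_nil N.+1 ('X_l * p).
Proof.
elim: N p => [|N IH] p; first by move=> /= -> i; rewrite mulr0 linear0.
move=> Hp i; rewrite dunkl_mulX; apply: (@dunkl_nilD N.+1); first exact/IH/Hp.
case: eqP => _; last exact/(@dunkl_nilZ N.+1)/(@dunkl_nil_msym N.+1).
apply: (@dunkl_nilD N.+1) => //; rewrite -scaleNr; apply: (@dunkl_nilZ N.+1).
by apply: (@dunkl_nil_sum N.+1) => j; apply: (@dunkl_nil_msym N.+1).
Qed.

Lemma dunkl_nil_ex p : exists N, dunkl_nil N p.
Proof.
elim/mpoly_mulX_ind: p => [a|p q [N Hp] [N' Hq]|l p [N Hp]].
- by exists 1%N => /= i; rewrite pdunklC.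
- exists (maxn N N'); apply: dunkl_nilD; first exact: dunkl_nil_leq (leq_maxl _ _) Hp.
  exact: dunkl_nil_leq (leq_maxr _ _) Hq.
- by exists N.+1; apply: dunkl_nil_mulX.
Qed.

Lemma dunkl_nil_mom N y p : dunkl_nil N.+1 p -> dunkl_nil N (mom_op c y p).
Proof. by move=> Hp; apply: dunkl_nil_sum => i; apply/dunkl_nilZ/Hp. Qed.

Lemma quot_rep_nilpotent : mom_locally_nilpotent M.
Proof.
elim/quot_rep_ind=> p; have [N Hp] := dunkl_nil_ex p; exists N => ys sz.
have E zs : foldr (fun y v => rca_mom c y *: v) (cls p) zs =
    cls (foldr (mom_op c) p zs).
  by elim: zs => [|z zs IH] //=; rewrite IH pcls_cls.
have H zs N' : dunkl_nil (N' + size zs) p -> dunkl_nil N' (foldr (mom_op c) p zs).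
  elim: zs N' => [|z zs IH] N' /=; first by rewrite addn0.
  by rewrite addnS -addSn => /IH; apply: dunkl_nil_mom.
have p0 : foldr (mom_op c) p ys = 0 by apply: (H ys 0%N); rewrite sz.
by rewrite E p0 cls0.
Qed.

Hypothesis sumX_in : forall p, (\sum_i 'X_i) * p \in I.

Lemma quot_rep_fin_gen : fin_gen_over_poly M.
Proof.
have poly p : exists2 f : rca n c, rca_poly f & forall q, f *: cls q = cls (p * q).
  elim/mpoly_ring_ind: p => [a|i|p q [f Hf Ef] [g Hg Eg]|p q [f Hf Ef] [g Hg Eg]].
  - exists (rca_cst n c a); first exact: rca_poly_cst.
    by move=> q; rewrite pcls_cls mul_mpolyC.
  - exists (rca_pos c (xcoord K i)); first exact: rca_poly_pos.
    move=> q; rewrite pcls_cls; apply/quot_repP; rewrite /= -mulrBl.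
    have -> : pos_form (xcoord K i) - 'X_i = (- n%:R^-1) *: \sum_l 'X_l.
      rewrite /pos_form.
      under eq_bigr do rewrite xcoordE hprojE scalerBl.
      rewrite sumrB -scaler_sumr (bigD1 i) //= eqxx scale1r big1.
        by rewrite addr0 addrAC subrr add0r scaleNr.
      by move=> l; rewrite eq_sym => /negPf ->; rewrite scale0r.
    by rewrite -scalerAl; apply: (stableI (Cst _)).
  - exists (f + g); first exact: rca_poly_add.
    by move=> r; rewrite scalerDl Ef Eg mulrDl clsD.
  - exists (f * g); first exact: rca_poly_mul.
    by move=> r; rewrite -scalerA Eg Ef mulrA.
exists 1%N, (fun=> cls 1); elim/quot_rep_ind=> p.
have [f Hf Ef] := poly p; exists (fun=> f) => //.
by rewrite big_ord1 Ef mulr1.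
Qed.

Hypothesis one_notin : 1 \notin I.
Hypothesis alt_in : forall p, \sum_(w : 'S_n) grp_op w p \in I.

Lemma quot_rep_aspherical : aspherical_value n c.
Proof.
exists M; split; first by split; [apply: quot_rep_fin_gen|apply: quot_rep_nilpotent].
split.
  exists (cls 1) => /esym; rewrite -cls0 => /quot_repP.
  by rewrite sub0r rpredN; apply/negP.
elim/quot_rep_ind=> p; rewrite /rca_sym /rca_cst -scalerA.
have -> : (\sum_w rca_grp c w) *: cls p = cls (\sum_w grp_op w p).
  rewrite scaler_suml (big_morph cls clsD cls0).
  by apply: eq_bigr => w _; rewrite pcls_cls.
rewrite pcls_cls -cls0; apply/quot_repP; rewrite subr0.
exact: (stableI (Cst _)).
Qed.

End QuotientModule.

(** * Singular polynomials and the ideal they generate *)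

Section SingularPolynomials.
Variables (K : numFieldType) (n d : nat) (k : K).
Hypothesis d_le_n : (d <= n)%N.
Local Notation P := {mpoly K[n]}.
Local Notation T := [set i : 'I_n | (i < d)%N].
Local Notation D := (pdunkl T k).

Fixpoint sing m (i : 'I_n) : P :=
  if m is m'.+1 then
    'X_i * sing m' i - (k / m%:R) *: \sum_(j in T) 'X_j * sing m' j
  else 1.

(* The coefficient of [u ^+ m] in the expansion of the product of the
   [(1 - u * 'X_j) ^ k], for [j] in [T]; [sing m i] is that of the same product
   divided by [1 - u * 'X_i]. *)
Definition sing_coef m : P :=
  if m is m'.+1 then - (k / m%:R) *: \sum_(j in T) 'X_j * sing m' j else 1.

Local Arguments sing_coef m : simpl never.

Lemma singS m i : sing m.+1 i = 'X_i * sing m i + sing_coef m.+1.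
Proof. by rewrite /sing_coef /= scaleNr. Qed.

(** The logarithmic derivative in [u] of the product of the [(1 - u * 'X_j) ^ k]. *)
Lemma sing_coefS m :
  m.+1%:R *: sing_coef m.+1 = - k *: \sum_(j in T) 'X_j * sing m j.
Proof.
by rewrite /sing_coef scalerA mulrN mulrCA divff ?pnatr_eq0 // mulr1.
Qed.

Lemma card_T : #|T| = d.
Proof.
rewrite -sum1_card (eq_bigl (fun i : 'I_n => (i < d)%N)).
  by rewrite (big_ord_narrow d_le_n) sum1_card card_ord.
by move=> i; rewrite inE.
Qed.

Definition stab_T (w : 'S_n) := forall i, (w i \in T) = (i \in T).

Lemma stab_tperm i j : i \in T -> j \in T -> stab_T (tperm i j).
Proof. by move=> iT jT l; case: tpermP => [->|->|//]; rewrite iT jT. Qed.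

Lemma sing_msym w m i : stab_T w -> msym w (sing m i) = sing m (w i).
Proof.
move=> wT; elim: m i => [|m IH] i; first exact: msym1.
rewrite /= msymB msymM msymX1 IH msymZ msym_sum; congr (_ - _ *: _).
rewrite [RHS](reindex_inj (@perm_inj _ w)); apply: eq_big => j; first by rewrite wT.
by move=> _; rewrite msymM msymX1 IH.
Qed.

Lemma sing_coef_msym w m : stab_T w -> msym w (sing_coef m) = sing_coef m.
Proof.
case: m => [|m] wT; first exact: msym1.
rewrite /sing_coef msymZ msym_sum; congr (_ *: _).
rewrite [RHS](reindex_inj (@perm_inj _ w)); apply: eq_big => j; first by rewrite wT.
by move=> _; rewrite msymM msymX1 sing_msym.
Qed.

(** Let [F] be the product. The sum of the [F / (1 - u * 'X_i)] is [d F] plus the sum of the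
    [u * 'X_i * F / (1 - u * 'X_i)], and [k] times the latter is [- u F']. *)
Lemma sum_sing m :
  k *: \sum_(i in T) sing m i = (k * d%:R - m%:R) *: sing_coef m.
Proof.
case: m => [|m].
  rewrite /sing_coef /= (eq_bigr (fun=> 1)) // sumr_const card_T.
  by rewrite subr0 -scaler_nat scalerA.
under eq_bigr do rewrite singS.
rewrite big_split /= sumr_const card_T scalerDr scalerBl sing_coefS scaleNr opprK.
by rewrite addrC -scaler_nat scalerA.
Qed.

(** Since [sing m.+1 j - sing_coef m.+1] is ['X_j * sing m j], the second claim multiplied by ['X_j]
    is an identity that makes sense from degree zero on, where both sides vanish; the induction
    carries it in that form. The factor on the right vanishes in the single degree [k * d]. *)
Lemma pdunkl_sing m j : j \in T ->
  (forall i, i \in T -> i != j -> D j (sing m i) = 0) /\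
  D j (sing m.+1 j) = (m.+1%:R - k * d%:R) *: sing m j.
Proof.
move=> jT.
have fixX m' i : i \in T -> i != j -> msym (tperm j i) (sing m' i) = sing m' j.
  by move=> iT ij; rewrite sing_msym ?tpermR //; apply: stab_tperm.
have sumj m' : \sum_(i in T | i != j) msym (tperm j i) (sing m' j) =
    \sum_(i in T) sing m' i - sing m' j.
  rewrite [in RHS](bigD1 j) //= addrC addrK; apply: eq_bigr => i /andP[iT ij].
  by rewrite sing_msym ?tpermL //; apply: stab_tperm.
have step m' : (forall i, i \in T -> i != j -> D j (sing m' i) = 0) ->
    'X_j * D j (sing m' j) = (m'%:R - k * d%:R) *: (sing m' j - sing_coef m') ->
    D j ('X_j * sing m' j) = (m'.+1%:R - k * d%:R) *: sing m' j + k *: sing m' j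
    /\ D j (sing_coef m'.+1) = - k *: sing m' j.
  move=> HA HB.
  have E : D j ('X_j * sing m' j) =
      (m'.+1%:R - k * d%:R) *: sing m' j + k *: sing m' j.
    rewrite pdunkl_mulX eqxx sumj scalerBr sum_sing HB -!mul_mpolyC.
    by rewrite -natr1; ring.
  split=> //; rewrite /sing_coef pdunklZ pdunkl_sum (bigD1 j) //= E.
  have -> : \sum_(i in T | i != j) D j ('X_i * sing m' i) =
      ((d%:R - 1) * k) *: sing m' j.
    rewrite (eq_bigr (fun=> k *: sing m' j)).
      rewrite sumr_const -scaler_nat scalerA; congr (_ * _ *: _).
      rewrite -[in RHS]card_T [in RHS](cardD1 j) jT natrD addrAC subrr add0r.
      by congr _%:R; apply: eq_card => i; rewrite [LHS]unfold_in !inE andbC.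
    move=> i /andP[iT ij]; rewrite pdunkl_mulX (negPf ij) iT HA // mulr0 add0r.
    by rewrite fixX.
  rewrite -!scalerDl scalerA; congr (_ *: _).
  rewrite (_ : _ + (d%:R - 1) * k = m'.+1%:R); last by ring.
  by rewrite mulNr divfK ?pnatr_eq0.
suff [HA HB] : (forall i, i \in T -> i != j -> D j (sing m i) = 0) /\
    'X_j * D j (sing m j) = (m%:R - k * d%:R) *: (sing m j - sing_coef m).
  split=> //; have [E E'] := step m HA HB.
  by rewrite singS pdunklD E E' scaleNr addrK.
elim: m => [|m [HA HB]].
  split; last by rewrite /sing_coef /= subrr scaler0 -mpolyC1 pdunklC mulr0.
  by move=> i _ _; rewrite /= -mpolyC1 pdunklC.
have [E E'] := step m HA HB; split=> [i iT ij|]; rewrite singS pdunklD E'.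
  rewrite pdunkl_mulX (negPf ij) iT HA // mulr0 add0r fixX //.
  by rewrite scaleNr subrr.
by rewrite E scaleNr !addrK -scalerAr.
Qed.

Lemma sing_singular m i j : k * d%:R = m.+1%:R -> i \in T -> j \in T ->
  D j (sing m.+1 i) = 0.
Proof.
move=> km iT jT; have [->|ij] := eqVneq i j; last by have [->] := pdunkl_sing m.+1 jT.
by have [_ ->] := pdunkl_sing m jT; rewrite km subrr scale0r.
Qed.

(** As [sing_coef 0] is 1, this is modulo [sing m i] a monic relation for ['X_i], with coefficients
    invariant under the permutations of [T]. *)
Lemma sing_sum m i : sing m i = \sum_(b < m.+1) 'X_i ^+ b * sing_coef (m - b).
Proof.
elim: m => [|m IH]; first by rewrite big_ord1 expr0 mul1r.
rewrite singS IH [RHS]big_ord_recl expr0 mul1r subn0 addrC mulr_sumr.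
by congr (_ + _); apply: eq_bigr => b _; rewrite /= subSS exprS mulrA.
Qed.

Lemma mderiv_sing m i a : i \in T -> a \notin T -> (sing m i)^`M(a) = 0.
Proof.
move=> iT aT; have na j : j \in T -> (j == a) = false.
  by move=> jT; apply: contraNF aT => /eqP <-.
elim: m i iT => [|m IH] i iT; first by rewrite /= -mpolyC1 mderivC.
rewrite singS /sing_coef mderivD mderivM mderivXU na // IH // mul0r mulr0 addr0.
rewrite mderivZ mderiv_sum big1 ?scaler0 ?addr0 // => j jT.
by rewrite mderivM mderivXU na // IH // mul0r mulr0 addr0.
Qed.

Lemma meval0_sing m i : (sing m.+1 i).@[fun=> 0] = 0.
Proof.
rewrite singS mevalD mevalM mevalXU mul0r add0r /sing_coef mevalZ.
rewrite rmorph_sum big1 ?mulr0 // => j _.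
by rewrite /= mevalM mevalXU mul0r.
Qed.

End SingularPolynomials.

Arguments sing : simpl never.
Arguments sing_coef : simpl never.

(** * Division by a difference of two variables *)

Section VariableSubstitution.
Variables (K : fieldType) (n : nat).
Local Notation P := {mpoly K[n]}.
Variables a b : 'I_n.

Definition subst_var : P -> P :=
  mmap (@mpolyC n K) (fun i => if i == a then 'X_b else 'X_i).
HB.instance Definition _ := GRing.RMorphism.on subst_var.

Lemma subst_varC z : subst_var z%:MP = z%:MP.
Proof. exact: mmapC. Qed.

Lemma subst_varX i : subst_var 'X_i = if i == a then 'X_b else 'X_i.
Proof. by rewrite /subst_var mmapX mmap1U. Qed.

Lemma subst_varB p q : subst_var (p - q) = subst_var p - subst_var q.
Proof. exact: rmorphB. Qed.

Lemma subst_varM p q : subst_var (p * q) = subst_var p * subst_var q.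
Proof. exact: rmorphM. Qed.

Lemma subst_var_sum (I : Type) (r : seq I) (Q : pred I) (F : I -> P) :
  subst_var (\sum_(j <- r | Q j) F j) = \sum_(j <- r | Q j) subst_var (F j).
Proof. exact: rmorph_sum. Qed.

Lemma subst_var_div p : exists q, p - subst_var p = ('X_a - 'X_b) * q.
Proof.
elim/mpoly_ring_ind: p => [z|i|p q [p' Hp] [q' Hq]|p q [p' Hp] [q' Hq]].
- by exists 0; rewrite subst_varC subrr mulr0.
- rewrite subst_varX; case: eqP => [->|_].
    by exists 1; rewrite mulr1.
  by exists 0; rewrite subrr mulr0.
- by exists (p' + q'); rewrite rmorphD opprD addrACA Hp Hq mulrDr.
- exists (p * q' + p' * subst_var q).
  rewrite rmorphM mulrDr mulrCA -Hq mulrA -Hp mulrBr mulrBl.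
  by rewrite addrA subrK.
Qed.

End VariableSubstitution.

(** * The ideal of the singular polynomials and its antisymmetrizations *)

Section SingularIdeal.
Variables (K : numFieldType) (n d r : nat).
Hypotheses (r_lt_d : (r.+1 < d)%N) (d_le_n : (d <= n)%N).
Local Notation P := {mpoly K[n]}.
Local Notation T := [set i : 'I_n | (i < d)%N].
Local Notation k := (r.+1%:R / d%:R : K).
Local Notation f := (@sing K n d k r.+1).
Implicit Types (p q u v : P).

Definition sing_ideal p : Prop :=
  exists q : 'I_n -> P, p = \sum_(i in T) q i * f i.

Lemma sing_ideal0 : sing_ideal 0.
Proof. by exists (fun=> 0); rewrite big1 // => i _; rewrite mul0r. Qed.

Lemma sing_idealD p q : sing_ideal p -> sing_ideal q -> sing_ideal (p + q).
Proof.
move=> [a ->] [b ->]; exists (fun i => a i + b i).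
by rewrite -big_split; apply: eq_bigr => i _; rewrite mulrDl.
Qed.

Lemma sing_idealM p q : sing_ideal q -> sing_ideal (p * q).
Proof.
move=> [a ->]; exists (fun i => p * a i).
by rewrite mulr_sumr; apply: eq_bigr => i _; rewrite mulrA.
Qed.

Lemma sing_idealN p : sing_ideal p -> sing_ideal (- p).
Proof. by rewrite -mulN1r; apply: sing_idealM. Qed.

Lemma sing_idealB p q : sing_ideal p -> sing_ideal q -> sing_ideal (p - q).
Proof. by move=> Hp /sing_idealN; apply: sing_idealD. Qed.

Lemma sing_idealZ a p : sing_ideal p -> sing_ideal (a *: p).
Proof. by rewrite -mul_mpolyC; apply: sing_idealM. Qed.

Lemma sing_ideal_sum (J : finType) (Q : pred J) (F : J -> P) :
  (forall j, Q j -> sing_ideal (F j)) -> sing_ideal (\sum_(j | Q j) F j).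
Proof.
by move=> H; apply: (big_ind sing_ideal); [apply: sing_ideal0|apply: sing_idealD|].
Qed.

Lemma sing_ideal_gen i : i \in T -> sing_ideal (f i).
Proof.
move=> iT; exists (fun j => (j == i)%:R); rewrite (bigD1 i) //= eqxx mul1r.
by rewrite big1 ?addr0 // => j /andP[_ /negPf ->]; rewrite mul0r.
Qed.

Lemma sing_ideal_msym w p : stab_T d w -> sing_ideal p -> sing_ideal (msym w p).
Proof.
move=> wT [q ->]; rewrite msym_sum; apply: sing_ideal_sum => i iT.
by rewrite msymM sing_msym //; apply/sing_idealM/sing_ideal_gen; rewrite wT.
Qed.

Lemma sing_ideal_pdunkl i p :
  i \in T -> sing_ideal p -> sing_ideal (pdunkl T k i p).
Proof.
move=> iT [q ->]; rewrite pdunkl_sum; apply: sing_ideal_sum => j jT.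
have Df : pdunkl T k i (f j) = 0.
  apply: sing_singular => //; rewrite divfK // pnatr_eq0 -lt0n.
  exact: leq_ltn_trans r_lt_d.
rewrite pdunklM Df mulr0 add0r; apply: sing_idealB.
  exact/sing_idealM/sing_ideal_gen.
apply: sing_idealZ; apply: sing_ideal_sum => l /andP[lT _].
apply: sing_idealM; apply: sing_ideal_msym; first exact: stab_tperm.
exact: sing_ideal_gen.
Qed.

Lemma sing_ideal_mderiv a p :
  a \notin T -> sing_ideal p -> sing_ideal p^`M(a).
Proof.
move=> aT [q ->]; rewrite mderiv_sum; apply: sing_ideal_sum => j jT.
by rewrite mderivM mderiv_sing // mulr0 addr0; apply/sing_idealM/sing_ideal_gen.
Qed.

Lemma subst_var_sing a b m i : i \in T -> a \notin T ->
  subst_var a b (sing d k m i) = sing d k m i.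
Proof.
move=> iT aT; have na j : j \in T -> (j == a) = false.
  by move=> jT; apply: contraNF aT => /eqP <-.
elim: m i iT => [|m IH] i iT; first by rewrite /sing rmorph1.
rewrite singS /sing_coef scaleNr subst_varB subst_varM subst_varX na // IH //.
rewrite -!mul_mpolyC subst_varM subst_varC.
congr (_ - _ * _); rewrite subst_var_sum; apply: eq_bigr => j jT.
by rewrite subst_varM subst_varX na // IH.
Qed.

(* The generators do not involve ['X_a], so that ['X_a - 'X_b] is a monic
   polynomial in ['X_a] over a ring containing them. *)
Lemma sing_ideal_nzd a b p : a \notin T -> a != b ->
  sing_ideal (('X_a - 'X_b) * p) -> sing_ideal p.
Proof.
move=> aT ab [q Eq].
have Eq' : \sum_(i in T) subst_var a b (q i) * f i = 0.
  have := congr1 (subst_var a b) Eq.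
  rewrite subst_varM subst_varB !subst_varX eqxx [b == a]eq_sym (negPf ab) subrr mul0r.
  move=> H; rewrite [RHS]H subst_var_sum; apply: eq_bigr => i iT.
  by rewrite subst_varM subst_var_sing.
exists (fun i => sval (cid (subst_var_div a b (q i)))).
apply: (mulfI (mpolyXB_neq0 K ab)); rewrite Eq.
transitivity (\sum_(i in T) q i * f i - \sum_(i in T) subst_var a b (q i) * f i).
  by rewrite Eq' subr0.
rewrite -sumrB mulr_sumr.
by apply: eq_bigr => i _; case: cid => t /= Et; rewrite mulrA -Et mulrBl.
Qed.

Definition full_sing_ideal p : Prop := forall w, sing_ideal (msym w p).

(** For a pair not contained in [T], the divided difference times its root is
    [p - msym (tperm i j) p]; this lies in the ideal because every translate of [p] does, and the
    root can be cancelled. The pairs inside [T] are handled by singularity of the generators, and in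
    a direction outside [T] the generators are constants. *)
Lemma sing_ideal_dunkl i p :
  full_sing_ideal p -> sing_ideal (pdunkl setT k i p).
Proof.
move=> Hp; have Hp1 : sing_ideal p by rewrite -[p]msym1m.
have dd j : j != i -> i \notin T \/ j \notin T -> sing_ideal (divdiff i j p).
  move=> ji out; have ij : i != j by rewrite eq_sym.
  have H : sing_ideal (('X_i - 'X_j) * divdiff i j p).
    by rewrite divdiffE; apply: sing_idealB.
  case: out => [/sing_ideal_nzd H'|/sing_ideal_nzd H']; first exact: (H' j).
  apply: (H' i) => //; rewrite -opprB mulNr; exact: sing_idealN.
case: (boolP (i \in T)) => iT.
  have -> : pdunkl setT k i p = pdunkl T k i p -
      k *: \sum_(j | (j != i) && (j \notin T)) divdiff i j p.
    rewrite dunklE pdunklE -addrA -opprD -scalerDr; congr (_ - _ *: _).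
    rewrite (bigID (fun j => j \in T)) /=; congr (_ + _).
    by apply: eq_bigl => j; rewrite andbC.
  apply: sing_idealB; first exact: sing_ideal_pdunkl.
  by apply/sing_idealZ/sing_ideal_sum => j /andP[ji jT]; apply: dd => //; right.
rewrite dunklE; apply: sing_idealB; first exact: sing_ideal_mderiv.
by apply/sing_idealZ/sing_ideal_sum => j ji; apply: dd => //; left.
Qed.

Definition alt_T p : P := \sum_(w : 'S_n | perm_on T w) (-1) ^+ w *: msym w p.

Lemma alt_T_lin a p q : alt_T (a *: p + q) = a *: alt_T p + alt_T q.
Proof.
rewrite /alt_T scaler_sumr -big_split; apply: eq_bigr => w _.
by rewrite msymD msymZ scalerDr !scalerA mulrC.
Qed.
HB.instance Definition _ := GRing.isLinear.Build K P P *:%R alt_T alt_T_lin.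

Lemma alt_TB p q : alt_T (p - q) = alt_T p - alt_T q.
Proof. exact: linearB. Qed.

Lemma alt_T_sum (J : finType) (F : J -> P) :
  alt_T (\sum_j F j) = \sum_j alt_T (F j).
Proof. exact: linear_sum. Qed.

Lemma alt_T_ideal p : sing_ideal p -> sing_ideal (alt_T p).
Proof.
move=> Hp; apply: sing_ideal_sum => w wT; apply: sing_idealZ.
by apply: sing_ideal_msym => // i; apply: perm_closed.
Qed.

Lemma perm_on_tperm i j : i \in T -> j \in T -> perm_on T (tperm i j).
Proof.
move=> iT jT; apply/subsetP => l; rewrite unfold_in.
by case: (tpermP i j l) => [->|->|_ _] //; rewrite eqxx.
Qed.

Lemma alt_T_tperm i j p : i \in T -> j \in T -> i != j ->
  msym (tperm i j) p = p -> alt_T p = 0.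
Proof.
move=> iT jT ij Hp; have sT : perm_on T (tperm i j).
  exact: perm_on_tperm.
suff E : alt_T p = - alt_T p.
  have := scaler_eq0 (2%:R : K) (alt_T p).
  by rewrite scaler_nat mulr2n {1}E addNr eqxx pnatr_eq0 => /esym/eqP.
rewrite {1}/alt_T (reindex_inj (mulgI (tperm i j))) -sumrN.
apply: eq_big => [w|w _].
  apply/idP/idP => H; last exact: perm_onM.
  by rewrite -[w](mulKg (tperm i j)) tpermV; apply: perm_onM.
by rewrite odd_permM odd_tperm ij msymMm Hp signr_addb expr1 mulN1r scaleNr.
Qed.

Local Notation Tmon l := (\prod_(i in T) 'X_i ^+ l i).

Lemma Tmon_upd (l l' : 'I_n -> nat) i e : i \in T ->
  l i = (e + l' i)%N -> (forall j, j != i -> l j = l' j) ->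
  Tmon l = 'X_i ^+ e * Tmon l' :> P.
Proof.
move=> iT li lj; rewrite (bigD1 i) // [in RHS](bigD1 i) //= li exprD mulrA.
by congr (_ * _); apply: eq_bigr => j /andP[_ ji]; rewrite lj.
Qed.

(** The invariant factor [u] absorbs the coefficients [sing_coef] that appear when a power above [r]
    is reduced, so that the induction bears on the exponents in [T] alone. *)
Lemma alt_T_mon (l : 'I_n -> nat) u :
  (forall w, perm_on T w -> msym w u = u) -> sing_ideal (alt_T (Tmon l * u)).
Proof.
have [N] := ubnP (\sum_(i in T) l i)%N; elim: N l u => // N IH l u lN Hu.
have [/existsP[i /andP[iT li]]|/existsPn small] :=
    boolP [exists i, (i \in T) && (r < l i)%N].
  (* In [l' e], a factor ['X_i ^+ r.+1] has been replaced by ['X_i ^+ e]. *)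
  pose l' e j := if j == i then (l i - r.+1 + e)%N else l j.
  have El' e : Tmon (l' e) = 'X_i ^+ e * Tmon (l' 0) :> P.
    apply: Tmon_upd => //; rewrite /l' ?eqxx; first by lia.
    by move=> j /negPf ->.
  have -> : Tmon l = 'X_i ^+ r.+1 * Tmon (l' 0) :> P.
    apply: Tmon_upd => //; rewrite /l' ?eqxx; first by lia.
    by move=> j /negPf ->.
  have := sing_sum d k r.+1 i; rewrite big_ord_recr /= subnn mulr1 => E.
  have -> : 'X_i ^+ r.+1 * Tmon (l' 0) * u = Tmon (l' 0) * u * f i -
      \sum_(b < r.+1) Tmon (l' b) * (sing_coef n d k (r.+1 - b) * u).
    rewrite E mulrDr mulr_sumr.
    rewrite (eq_bigr (fun b : 'I_r.+1 =>
      Tmon (l' b) * (sing_coef n d k (r.+1 - b) * u))).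
      by rewrite addrAC subrr add0r; ring.
    by move=> b _; rewrite [in RHS]El'; ring.
  rewrite alt_TB alt_T_sum; apply: sing_idealB.
    by apply/alt_T_ideal/sing_idealM/sing_ideal_gen.
  apply: sing_ideal_sum => b _; apply: IH => [|w wT].
    rewrite -ltnS (leq_trans _ lN) // ltnS (bigD1 i) // [X in (_ < X)%N](bigD1 i) //=.
    rewrite {1}/l' eqxx (eq_bigr l) => [|j /andP[_ /negPf ji]]; last by rewrite /l' ji.
    by rewrite ltn_add2r; have := ltn_ord b; lia.
  by rewrite msymM Hu // sing_coef_msym // => j; apply: perm_closed.
have [i iT [j jT [ij lij]]] :
    exists2 i, i \in T & exists2 j, j \in T & i != j /\ l i = l j.
  (* The exponents now take at most [r.+1] values, fewer than the [d] letters of [T]. *)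
  pose g i : 'I_r.+1 := inord (l i).
  have : ~~ dinjectiveb g T.
    apply: contraL r_lt_d => /dinjectiveP /card_in_imset; rewrite card_T // => <-.
    by rewrite -leqNgt (leq_trans (max_card _)) // card_ord.
  case/dinjectivePn => i iT [j /andP[/= ji jT] gij]; exists i => //; exists j => //.
  split; first by rewrite eq_sym.
  have lt a : a \in T -> (l a < r.+1)%N.
    by move=> aT; have := small a; rewrite aT /= -leqNgt.
  by have := congr1 val gij; rewrite /= !inordK ?lt.
rewrite (alt_T_tperm iT jT ij); first exact: sing_ideal0.
have sT : stab_T d (tperm i j) by apply: stab_tperm.
rewrite msymM Hu ?perm_on_tperm //; congr (_ * _); rewrite rmorph_prod /=.
rewrite [RHS](reindex_inj (@perm_inj _ (tperm i j))) /=.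
apply: eq_big => a; first by rewrite sT.
move=> _; rewrite rmorphXn /= msymX1.
by case: (tpermP i j a) => [->|->|_ _]; rewrite ?lij.
Qed.

Lemma alt_T_all p : sing_ideal (alt_T p).
Proof.
elim/mpolyind: p => [|a m p _ _ Hp]; first by rewrite linear0; apply: sing_ideal0.
rewrite alt_T_lin; apply: sing_idealD => //; apply: sing_idealZ.
(* The variables outside [T] are fixed by the permutations of [T] and form the factor [u]. *)
rewrite mpolyXE_id (bigID (fun i => i \in T)) /=; apply: alt_T_mon => w wT.
rewrite rmorph_prod; apply: eq_bigr => i iT /=.
by rewrite rmorphXn /= msymX1 (out_perm wT).
Qed.

(** The antisymmetrization [a] over all permutations is sent by [alt_T] to a multiple of itself, by
    the number of permutations of [T], which is invertible. The translates of [a] are [a] up to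
    sign. *)
Lemma full_sing_ideal_alt p :
  full_sing_ideal (\sum_(w : 'S_n) (-1) ^+ w *: msym w p).
Proof.
pose a := \sum_(w : 'S_n) (-1) ^+ w *: msym w p.
have av (v : 'S_n) : msym v a = (-1) ^+ v *: a.
  rewrite msym_sum [in RHS]/a scaler_sumr [RHS](reindex_inj (mulIg v)).
  apply: eq_bigr => w _.
  rewrite msymZ -msymMm scalerA; congr (_ *: _).
  by rewrite odd_permM signr_addb mulrCA -signr_addb addbb mulr1.
move=> v; rewrite av; apply: sing_idealZ.
have := alt_T_all a; rewrite /alt_T.
rewrite (eq_bigr (fun=> a)) => [|w _]; last first.
  by rewrite av scalerA -signr_addb addbb scale1r.
rewrite sumr_const => /(sing_idealZ (#|[pred w : 'S_n | perm_on T w]|%:R^-1)).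
rewrite -scaler_nat scalerA mulVf ?scale1r // pnatr_eq0 -lt0n.
by apply/card_gt0P; exists 1%g; rewrite !inE perm_on1.
Qed.

End SingularIdeal.

(** * The aspherical quotient at a negative fraction *)

Section AsphericalValue.
Variables (K : numFieldType) (n d r : nat).
Hypotheses (r_lt_d : (r.+1 < d)%N) (d_le_n : (d <= n)%N).
Local Notation P := {mpoly K[n]}.
Local Notation k := (r.+1%:R / d%:R : K).
Local Notation sigma := (\sum_(i < n) 'X_i : P).
Local Notation full := (@full_sing_ideal K n d r).
Implicit Types p : P.

(** The multiples of [sigma] are added to pass from [n] variables to functions on the reflection
    representation. *)
Definition aspherical_ideal p : bool :=
  `[<exists u v : P, full u /\ p = u + sigma * v>].

Lemma aspherical_idealP p :
  reflect (exists u v : P, full u /\ p = u + sigma * v) (p \in aspherical_ideal).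
Proof. exact: asboolP. Qed.

Lemma full_sing_idealP p : full p -> p \in aspherical_ideal.
Proof. by move=> Hp; apply/aspherical_idealP; exists p, 0; rewrite mulr0 addr0. Qed.

Lemma full_sing_idealMl p q : full q -> full (p * q).
Proof. by move=> Hq w; rewrite msymM; apply: sing_idealM. Qed.

Fact aspherical_ideal_zmod : zmod_closed aspherical_ideal.
Proof.
split=> [|p q /aspherical_idealP[u [v [Hu ->]]] /aspherical_idealP[u' [v' [Hu' ->]]]].
  by apply: full_sing_idealP => w; rewrite msym0; apply: sing_ideal0.
apply/aspherical_idealP; exists (u - u'), (v - v'); split; last by ring.
by move=> w; rewrite msymB; apply: sing_idealB.
Qed.
HB.instance Definition _ := GRing.isZmodClosed.Build P aspherical_ideal
  aspherical_ideal_zmod.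

Lemma aspherical_idealMl p q : q \in aspherical_ideal -> p * q \in aspherical_ideal.
Proof.
move=> /aspherical_idealP[u [v [Hu ->]]]; apply/aspherical_idealP.
by exists (p * u), (p * v); split; [apply: full_sing_idealMl|ring].
Qed.

Lemma sigma_aspherical_ideal p : sigma * p \in aspherical_ideal.
Proof.
apply/aspherical_idealP; exists 0, p; split; last by rewrite add0r.
by move=> w; rewrite msym0; apply: sing_ideal0.
Qed.

Lemma msym_sigma w : msym w sigma = sigma.
Proof.
rewrite msym_sum [RHS](reindex_inj (@perm_inj _ w)).
by apply: eq_bigr => i _; rewrite msymX1.
Qed.

(** Each Dunkl operator has commutator 1 with [sigma], and the coordinates of [y], by which these
    are weighted, sum to zero. *)
Lemma mom_op_sigma c y p : mom_op c y (sigma * p) = sigma * mom_op c y p.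
Proof.
rewrite /mom_op mulr_sumr.
have E i : pdunkl setT (- c) i (sigma * p) = sigma * pdunkl setT (- c) i p + p.
  rewrite mulr_suml pdunkl_sum.
  under eq_bigr do rewrite dunkl_mulX.
  rewrite big_split /= -mulr_suml; congr (_ + _).
  rewrite (bigD1 i) //= eqxx scaler_sumr.
  rewrite [X in _ + X](eq_bigr (fun j => (- c) *: msym (tperm i j) p)) ?subrK //.
  by move=> j /negPf ->.
rewrite (eq_bigr (fun i => sigma * (hcoord y i *: pdunkl setT (- c) i p) +
                           hcoord y i *: p)).
  by rewrite big_split /= -scaler_suml sum_hcoord scale0r addr0.
by move=> i _; rewrite E scalerDr scalerAr.
Qed.

Lemma aspherical_ideal_stable :
  rca_stable (- k) (GRing.ZmodClosed.clone _ aspherical_ideal _).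
Proof.
elim=> [a|[w|x|y]|t IHt u IHu|t IHt u IHu] p Hp /=.
- by rewrite -mul_mpolyC; apply: aspherical_idealMl.
- rewrite /grp_op -mul_mpolyC; apply: aspherical_idealMl.
  case/aspherical_idealP: Hp => [u [v [Hu ->]]]; apply/aspherical_idealP.
  exists (msym w^-1%g u), (msym w^-1%g v); split.
    by move=> w'; rewrite -msymMm; apply: Hu.
  by rewrite msymD msymM msym_sigma.
- exact: aspherical_idealMl.
- case/aspherical_idealP: Hp => [u [v [Hu ->]]].
  rewrite -[u]scale1r mom_op_linear scale1r mom_op_sigma.
  apply: rpredD; last exact: sigma_aspherical_ideal.
  apply: rpred_sum => i _; rewrite -mul_mpolyC; apply: aspherical_idealMl.
  (* [sing_ideal_dunkl] only lands in [sing_ideal]; by equivariance each translate is again a Dunkl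
     operator applied to a translate of [u]. *)
  apply: full_sing_idealP => w; rewrite dunkl_msym opprK.
  by apply: sing_ideal_dunkl => // w'; rewrite -msymMm; apply: Hu.
- by apply: rpredD; [apply: IHt|apply: IHu].
- exact/IHt/IHu.
Qed.

Lemma aspherical_value_frac : aspherical_value n (- k).
Proof.
apply: (quot_rep_aspherical aspherical_ideal_stable).
- exact: sigma_aspherical_ideal.
- apply/negP => /aspherical_idealP[u [v [Hu /(congr1 (meval (fun=> 0)))]]].
  have [q Eq] := Hu 1%g; rewrite msym1m in Eq.
  rewrite meval1 mevalD mevalM Eq !rmorph_sum /= !big1 => [|i _|i _].
  + by rewrite mul0r addr0 => /eqP; rewrite oner_eq0.
  + by rewrite mevalXU.
  + by rewrite mevalM meval0_sing mulr0.
- move=> p; apply: full_sing_idealP.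
  rewrite (reindex_inj invg_inj) /=.
  have -> : \sum_(w : 'S_n) grp_op w^-1 p = \sum_(w : 'S_n) (-1) ^+ w *: msym w p.
    by apply: eq_bigr => w _; rewrite /grp_op invgK odd_permV.
  exact: full_sing_ideal_alt.
Qed.

End AsphericalValue.

(** * The support of a module *)

(** Collects the transpositions that move [l], the only ones to contribute to a commutator with
    ['X_l]. *)
Lemma sum_pairs_at (V : nmodType) n (l : 'I_n) (A : 'I_n -> V) :
  \sum_(s : 'I_n * 'I_n | (s.1 < s.2)%N)
    (if s.1 == l then A s.2 else if s.2 == l then A s.1 else 0) =
  \sum_(j | j != l) A j.
Proof.
pose F i j := if i == l then A j else 0.
transitivity (\sum_i \sum_(j | j != i) F i j).
  rewrite sum_offdiag; apply: eq_bigr => -[i j] /= ij; rewrite /F.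
  have [il|_] := eqVneq i l; last by rewrite add0r.
  by rewrite -il -val_eqE gtn_eqF ?addr0.
rewrite (bigD1 l) //= [X in _ + X]big1 ?addr0 => [|i /negPf il].
  by apply: eq_bigr => j _; rewrite /F eqxx.
by rewrite big1 // => j _; rewrite /F il.
Qed.

(* Modules over the rational Cherednik algebra, restricted to the polynomial
   subalgebra: the scalars act through [%:MP]. *)
Record rca_action (K : numFieldType) (n : nat) (c : K)
    (V : lmodType {mpoly K[n]}) := RcaAction {
  grp_act : 'S_n -> V -> V;
  mom_act : refl_rep K n -> V -> V;
  grp_actD : forall w m m', grp_act w (m + m') = grp_act w m + grp_act w m';
  grp_act1 : forall m, grp_act 1%g m = m;
  grp_actM : forall u w m, grp_act (u * w)%g m = grp_act u (grp_act w m);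
  grp_actZ : forall w p m, grp_act w (p *: m) = msym w^-1%g p *: grp_act w m;
  mom_actD : forall y m m', mom_act y (m + m') = mom_act y m + mom_act y m';
  mom_actC : forall y a m, mom_act y (a%:MP *: m) = a%:MP *: mom_act y m;
  grp_mom_act : forall w y m,
    grp_act w (mom_act y m) = mom_act (hact w y) (grp_act w m);
  mom_actX : forall y l m, mom_act y ('X_l *: m) = 'X_l *: mom_act y m +
    ((hcoord y l)%:MP *: m - c%:MP *: \sum_(j | j != l)
       (hcoord y l - hcoord y j)%:MP *: grp_act (tperm l j) m);
  sum_var_act : forall m : V, (\sum_i 'X_i : {mpoly K[n]}) *: m = 0
}.

(** * The annihilator and the Euler field *)

Section Annihilator.
Variables (K : numFieldType) (n : nat) (c : K) (V : lmodType {mpoly K[n]}).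
Variable A : rca_action c V.
Local Notation P := {mpoly K[n]}.
Local Notation G := (grp_act A).
Local Notation Y := (mom_act A).
Implicit Types (p q : P) (m : V) (i j l : 'I_n).

Definition kills p : Prop := forall m, p *: m = 0.

Lemma killsD p q : kills p -> kills q -> kills (p + q).
Proof. by move=> Hp Hq m; rewrite scalerDl Hp Hq addr0. Qed.

Lemma killsM p q : kills q -> kills (p * q).
Proof. by move=> Hq m; rewrite -scalerA Hq scaler0. Qed.

Lemma killsN p : kills p -> kills (- p).
Proof. by move=> Hp m; rewrite scaleNr Hp oppr0. Qed.

Lemma mom_act0 y : Y y 0 = 0.
Proof. by apply: (addrI (Y y 0)); rewrite -mom_actD !addr0. Qed.

Lemma grp_act0 w : G w 0 = 0.
Proof. by apply: (addrI (G w 0)); rewrite -grp_actD !addr0. Qed.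

Lemma grp_act_sum w (I : Type) (r : seq I) (Q : pred I) (F : I -> V) :
  G w (\sum_(i <- r | Q i) F i) = \sum_(i <- r | Q i) G w (F i).
Proof. exact: (big_morph _ (grp_actD A w) (grp_act0 w)). Qed.

(** The means to show annihilators stable under the vector field [e D]: if [p] annihilates the
    module, both terms with [Z] vanish, and so does the last. Commutators with the variables
    determine all others. *)
Lemma derivation_act (D : P -> P) (e : P) (Z : V -> V) :
  (forall a, D a%:MP = 0) -> (forall p q, D (p + q) = D p + D q) ->
  (forall p q, D (p * q) = p * D q + D p * q) ->
  (forall m m', Z (m + m') = Z m + Z m') ->
  (forall a m, Z (a%:MP *: m) = a%:MP *: Z m) ->
  (forall l m, Z ('X_l *: m) = 'X_l *: Z m + (e * D 'X_l) *: m) ->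
  forall p m, Z (p *: m) = p *: Z m + (e * D p) *: m.
Proof.
move=> DC DD DM ZD ZC ZX p; elim/mpoly_mulX_ind: p => [a|p q Hp Hq|l p Hp] m.
- by rewrite ZC DC mulr0 scale0r addr0.
- by rewrite scalerDl ZD Hp Hq DD mulrDr !scalerDl addrACA.
- rewrite -[X in Z X]scalerA ZX Hp scalerDr -addrA !scalerA -scalerDl DM.
  by congr (_ + _ *: _); ring.
Qed.

Definition euler p : P := \sum_i 'X_i * p^`M(i).

Lemma euler_lin a p q : euler (a *: p + q) = a *: euler p + euler q.
Proof.
rewrite /euler scaler_sumr -big_split; apply: eq_bigr => i _.
by rewrite mderivD mderivZ mulrDr scalerAr.
Qed.

Lemma kills_euler p : kills p -> kills (euler p).
Proof.
(* Up to a constant, the Euler element of the algebra: its commutator with ['X_l] is ['X_l]. *)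
pose Z m := (\sum_i 'X_i *: Y (hproj K i) m) -
  c%:MP *: \sum_(s : 'I_n * 'I_n | (s.1 < s.2)%N) G (tperm s.1 s.2) m.
have H : forall p m, Z (p *: m) = p *: Z m + (1 * euler p) *: m.
  apply: derivation_act => [a|q r|q r|m m'|a m|l m].
  - by rewrite /euler big1 // => i _; rewrite mderivC mulr0.
  - by rewrite /euler -big_split; apply: eq_bigr => i _; rewrite mderivD mulrDr.
  - rewrite /euler mulr_sumr mulr_suml -big_split; apply: eq_bigr => i _.
    by rewrite mderivM /=; ring.
  - rewrite /Z addrACA -opprD -scalerDr -!big_split; congr (_ - _ *: _).
      by apply: eq_bigr => i _; rewrite mom_actD scalerDr.
    by apply: eq_bigr => i _; rewrite grp_actD.
  - rewrite /Z scalerBr scalerA mulrC -scalerA; congr (_ - _ *: _).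
      rewrite scaler_sumr; apply: eq_bigr => i _.
      by rewrite mom_actC !scalerA mulrC.
    rewrite scaler_sumr; apply: eq_bigr => i _.
    by rewrite grp_actZ msymC.
  - have EG : \sum_(s : 'I_n * 'I_n | (s.1 < s.2)%N) G (tperm s.1 s.2) ('X_l *: m) =
        'X_l *: (\sum_(s : 'I_n * 'I_n | (s.1 < s.2)%N) G (tperm s.1 s.2) m) +
        \sum_(j | j != l) ('X_j - 'X_l) *: G (tperm l j) m.
      rewrite -sum_pairs_at scaler_sumr -big_split; apply: eq_bigr => -[i j] /= ij.
      rewrite grp_actZ tpermV msymX1.
      case: (tpermP i j l) => [->|->|/eqP/negPf il /eqP/negPf jl].
      + by rewrite eqxx -scalerDl addrC subrK.
      + rewrite eqxx -val_eqE /= ltn_eqF // [tperm j i]tpermC.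
        by rewrite -scalerDl addrC subrK.
      + by rewrite ![_ == l]eq_sym il jl addr0.
    have EX : euler 'X_l = 'X_l.
      rewrite /euler (bigD1 l) //= mderivXU eqxx mulr1 big1 ?addr0 // => i.
      by rewrite mderivXU eq_sym => /negPf ->; rewrite mulr0.
    have sumd j : \sum_i ((j == i)%:R : K)%:MP * 'X_i = 'X_j :> P.
      rewrite (bigD1 j) //= eqxx mpolyC1 mul1r big1 ?addr0 // => i.
      by rewrite eq_sym => /negPf ->; rewrite mpolyC0 mul0r.
    have EY : \sum_i 'X_i *: Y (hproj K i) ('X_l *: m) =
        'X_l *: (\sum_i 'X_i *: Y (hproj K i) m) + 'X_l *: m -
        c%:MP *: \sum_(j | j != l) ('X_l - 'X_j) *: G (tperm l j) m.
      under eq_bigr do rewrite mom_actX !scalerDr scalerN.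
      rewrite !big_split /= sumrN -addrA; congr (_ + (_ - _)).
      + by rewrite scaler_sumr; apply: eq_bigr => i _; rewrite !scalerA mulrC.
      + rewrite -[in RHS](sumd l) scaler_suml.
        transitivity (\sum_i (((l == i)%:R : K)%:MP * 'X_i) *: m -
                      (n%:R^-1 : K)%:MP *: ((\sum_i 'X_i) *: m)).
          rewrite scaler_suml scaler_sumr -sumrB; apply: eq_bigr => i _.
          by rewrite !scalerA -scalerBl hprojE mpolyCB; congr (_ *: _); ring.
        by rewrite (sum_var_act A) scaler0 subr0.
      + transitivity (\sum_i c%:MP *: \sum_(j | j != l) 'X_i *:
            ((hcoord (hproj K i) l - hcoord (hproj K i) j)%:MP *: G (tperm l j) m)).
          apply: eq_bigr => i _.
          by rewrite scalerA mulrC -scalerA scaler_sumr.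
        rewrite -scaler_sumr exchange_big; congr (_ *: _); apply: eq_bigr => j _.
        rewrite -[in RHS](sumd l) -[in RHS](sumd j) -sumrB scaler_suml.
        apply: eq_bigr => i _; rewrite scalerA !hprojE; congr (_ *: _).
        by rewrite !mpolyCB; ring.
    have ED : \sum_(j | j != l) ('X_l - 'X_j) *: G (tperm l j) m =
        - \sum_(j | j != l) ('X_j - 'X_l) *: G (tperm l j) m.
      by rewrite -sumrN; apply: eq_bigr => j _; rewrite -scaleNr opprB.
    rewrite /Z EY EG EX ED mul1r scalerN opprK scalerDr scalerBr opprD.
    by rewrite !scalerA [c%:MP * _]mulrC addrACA subrr addr0 addrAC.
move=> Hp m; have := H p m; rewrite Hp mul1r /Z.
rewrite Hp add0r => <-.
rewrite big1 => [|i _]; last by rewrite mom_act0 scaler0.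
by rewrite big1 => [|i _]; [rewrite scaler0 subr0|rewrite grp_act0].
Qed.

End Annihilator.

(** * Differentiation along a point and restriction to its line *)

Section Stratum.
Variables (K : numFieldType) (n : nat) (c : K) (V : lmodType {mpoly K[n]}).
Variable A : rca_action c V.
Variable b : 'I_n -> K.
Hypothesis sum_b : \sum_i b i = 0.
Local Notation P := {mpoly K[n]}.
Local Notation G := (grp_act A).
Local Notation Y := (mom_act A).
Local Notation kills := (@kills K n V).
Implicit Types (p q : P) (m : V) (i j l : 'I_n).

(** Both orders of each pair occur, so that the stabilizer of [b] fixes [delta] without a sign. *)
Definition delta : P :=
  \prod_(s : 'I_n * 'I_n | b s.1 != b s.2) ('X_s.1 - 'X_s.2).

Definition delta_cofactor i j : P :=
  \prod_(s : 'I_n * 'I_n | (b s.1 != b s.2) && (s != (i, j))) ('X_s.1 - 'X_s.2).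

Lemma deltaE i j : b i != b j -> delta = ('X_i - 'X_j) * delta_cofactor i j.
Proof. by move=> bij; rewrite /delta (bigD1 (i, j)). Qed.

Definition ddir p : P := \sum_i (b i)%:MP * p^`M(i).

Lemma ddirC a : ddir a%:MP = 0.
Proof. by rewrite /ddir big1 // => i _; rewrite mderivC mulr0. Qed.

Lemma ddirD p q : ddir (p + q) = ddir p + ddir q.
Proof. by rewrite /ddir -big_split; apply: eq_bigr => i _; rewrite mderivD mulrDr. Qed.

Lemma ddirM p q : ddir (p * q) = p * ddir q + ddir p * q.
Proof.
rewrite /ddir mulr_sumr mulr_suml -big_split; apply: eq_bigr => i _.
by rewrite mderivM /=; ring.
Qed.

Lemma ddirX l : ddir 'X_l = (b l)%:MP.
Proof.
rewrite /ddir (bigD1 l) //= mderivXU eqxx mulr1 big1 ?addr0 // => i.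
by rewrite mderivXU eq_sym => /negPf ->; rewrite mulr0.
Qed.

Lemma kills_ddir p : kills p -> kills (delta * ddir p).
Proof.
(* [C] is the reflection part of the momentum along [b], its denominators cleared by [delta]; once
   it is subtracted in [Z], the commutators are those of [delta] times the derivative along [b].
   Where [b i = b j] the cofactor is no quotient by a root, but its coefficient is zero. *)
pose C m := \sum_(s : 'I_n * 'I_n | (s.1 < s.2)%N)
  ((b s.1 - b s.2)%:MP * delta_cofactor s.1 s.2) *: G (tperm s.1 s.2) m.
pose Z m := delta *: Y (hvec b) m - c%:MP *: C m.
have cof i j : (b i - b j)%:MP * delta_cofactor i j * ('X_i - 'X_j) =
    delta * (b i - b j)%:MP.
  have [->|bij] := eqVneq (b i) (b j); first by rewrite subrr mpolyC0 !mul0r mulr0.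
  by rewrite (deltaE bij); ring.
have CX l m : C ('X_l *: m) = 'X_l *: C m -
    delta *: \sum_(j | j != l) (b l - b j)%:MP *: G (tperm l j) m.
  have -> : - (delta *: \sum_(j | j != l) (b l - b j)%:MP *: G (tperm l j) m) =
      \sum_(j | j != l) (- (delta * (b l - b j)%:MP)) *: G (tperm l j) m.
    by rewrite scaler_sumr -sumrN; apply: eq_bigr => j _; rewrite scalerA scaleNr.
  rewrite -sum_pairs_at scaler_sumr -big_split; apply: eq_bigr => -[i j] /= ij.
  rewrite grp_actZ tpermV msymX1.
  case: (tpermP i j l) => [->|->|/eqP/negPf il /eqP/negPf jl].
  - rewrite eqxx -cof !scalerA -scalerDl; congr (_ *: _); ring.
  - rewrite eqxx -val_eqE /= ltn_eqF // [tperm j i]tpermC !scalerA -scalerDl.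
    have -> : (b j - b i)%:MP = - (b i - b j)%:MP :> P by rewrite -mpolyCN opprB.
    by congr (_ *: _); rewrite mulrN opprK -cof; ring.
  - by rewrite ![_ == l]eq_sym il jl addr0 !scalerA mulrC.
have CD m m' : C (m + m') = C m + C m'.
  by rewrite /C -big_split; apply: eq_bigr => i _; rewrite grp_actD scalerDr.
have CC a m : C (a%:MP *: m) = a%:MP *: C m.
  rewrite /C scaler_sumr; apply: eq_bigr => i _.
  by rewrite grp_actZ msymC !scalerA mulrC.
have H : forall p m, Z (p *: m) = p *: Z m + (delta * ddir p) *: m.
  apply: derivation_act => [a|q r|q r|m m'|a m|l m].
  - exact: ddirC.
  - exact: ddirD.
  - exact: ddirM.
  - by rewrite /Z mom_actD CD !scalerDr opprD addrACA.
  - by rewrite /Z mom_actC CC scalerBr !scalerA mulrC [a%:MP * c%:MP]mulrC.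
  - have E : Y (hvec b) ('X_l *: m) = 'X_l *: Y (hvec b) m + ((b l)%:MP *: m -
        c%:MP *: \sum_(j | j != l) (b l - b j)%:MP *: G (tperm l j) m).
      rewrite mom_actX hvecE //; congr (_ + (_ - _ *: _)).
      by apply: eq_bigr => j _; rewrite hvecE.
    have cancel (u v w x : V) : u + (v - w) - (x - w) = u - x + v.
      by rewrite opprB -addrA [v - w + _]addrA subrK -addrA [- x + v]addrC.
    rewrite /Z E CX ddirX !(scalerDr, scalerN) !scalerA.
    by rewrite [delta * 'X_l]mulrC [c%:MP * 'X_l]mulrC [c%:MP * delta]mulrC cancel.
move=> Hp m; have := H p m; rewrite !Hp add0r => <-.
rewrite /Z /C mom_act0 scaler0 add0r big1 ?scaler0 ?oppr0 // => i _.
by rewrite grp_act0 scaler0.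
Qed.

(** A uniform way to say that [p] annihilates the localization away from the zeros of [delta]. *)
Definition loc_kills p : Prop := exists k, kills (delta ^+ k * p).

Lemma loc_kills_ddir p : loc_kills p -> loc_kills (ddir p).
Proof.
(* One factor [delta] comes from [kills_ddir], the other turns the derivative of [delta ^+ k] into a
   multiple of [delta ^+ k]. *)
move=> [k Hk]; exists (k + 2)%N.
have H := kills_ddir Hk; rewrite ddirM in H.
have E e : exists q, delta * ddir (delta ^+ e) = delta ^+ e * q.
  elim: e => [|e [q Eq]]; first by exists 0; rewrite expr0 -mpolyC1 ddirC !mulr0.
  exists (q + ddir delta); rewrite exprS ddirM mulrDr mulrCA Eq; ring.
have [q Eq] := E k.
have -> : delta ^+ (k + 2) * ddir p = delta * (delta * (delta ^+ k * ddir p +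
    ddir (delta ^+ k) * p)) - (delta * q) * (delta ^+ k * p).
  have -> : delta * q * (delta ^+ k * p) = delta * ((delta ^+ k * q) * p) by ring.
  by rewrite -Eq exprD; ring.
by apply: killsD; [apply: killsM|apply/killsN/killsM].
Qed.

Definition line : P -> {poly K} := mmap (@polyC K) (fun i => b i *: 'X).
HB.instance Definition _ := GRing.RMorphism.on line.

Lemma lineC a : line a%:MP = a%:P. Proof. exact: mmapC. Qed.
Lemma lineX i : line 'X_i = b i *: 'X.
Proof. by rewrite /line mmapX mmap1U. Qed.
Lemma lineD p q : line (p + q) = line p + line q. Proof. exact: rmorphD. Qed.
Lemma lineB p q : line (p - q) = line p - line q. Proof. exact: rmorphB. Qed.
Lemma lineM p q : line (p * q) = line p * line q. Proof. exact: rmorphM. Qed.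

Lemma line_ddir p : line (ddir p) = (line p)^`().
Proof.
elim/mpoly_mulX_ind: p => [a|p q Hp Hq|l p Hp].
- by rewrite ddirC rmorph0 lineC derivC.
- by rewrite ddirD !lineD Hp Hq derivD.
- rewrite ddirM lineD !lineM Hp ddirX lineC lineX derivM derivZ derivX.
  by rewrite alg_polyC addrC.
Qed.

Lemma line_euler p : line (euler p) = 'X * (line p)^`().
Proof.
elim/mpoly_mulX_ind: p => [a|p q Hp Hq|l p Hp].
- rewrite /euler big1 => [|i _]; last by rewrite mderivC mulr0.
  by rewrite rmorph0 lineC derivC mulr0.
- have -> : euler (p + q) = euler p + euler q.
    by have := euler_lin 1 p q; rewrite !scale1r.
  by rewrite !lineD Hp Hq derivD mulrDr.
- have -> : euler ('X_l * p) = 'X_l * euler p + 'X_l * p.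
    rewrite /euler mulr_sumr (eq_bigr (fun i => 'X_l * ('X_i * p^`M(i)) +
        ('X_l : P)^`M(i) * 'X_i * p)) => [|i _]; last by rewrite mderivM; ring.
    rewrite big_split /=; congr (_ + _).
    rewrite (bigD1 l) //= mderivXU eqxx mul1r big1 ?addr0 // => i.
    by rewrite mderivXU eq_sym => /negPf ->; rewrite !mul0r.
  rewrite lineD !lineM Hp lineX derivM derivZ derivX -!mul_polyC; ring.
Qed.

Lemma horner_line p : (line p).[1] = p.@[b].
Proof.
elim/mpoly_mulX_ind: p => [a|p q Hp Hq|l p Hp].
- by rewrite lineC hornerC mevalC.
- by rewrite lineD hornerD mevalD Hp Hq.
- by rewrite lineM lineX hornerM hornerZ hornerX mulr1 mevalM mevalXU Hp.
Qed.

Definition deg_lt N p := forall mon, (N <= mdeg mon)%N -> p@_mon = 0.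

Lemma deg_lt_ex p : exists N, deg_lt N p.
Proof.
exists (msize p) => mon sz; apply: memN_msupp_eq0; apply: contraL sz => supp.
by rewrite -ltnNge; apply: msize_mdeg_lt.
Qed.

Lemma mcoeff_euler p mon : (euler p)@_mon = (mdeg mon)%:R * p@_mon.
Proof.
elim/mpolyind: p => [|a m p _ _ Hp].
  by rewrite /euler big1 ?mcoeff0 ?mulr0 // => i _; rewrite mderiv0 mulr0.
rewrite euler_lin !mcoeffD !mcoeffZ Hp mulrDr; congr (_ + _).
have -> : euler 'X_[m] = (mdeg m)%:R *: 'X_[m] :> P.
  rewrite mdegE /euler natr_sum scaler_suml; apply: eq_bigr => i _.
  rewrite mderivX -scalerAr.
  have [->|mi] := eqVneq (m i) 0%N; first by rewrite !scale0r.
  congr (_ *: _); rewrite -mpolyXD; congr 'X_[_].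
  apply/mnmP => j; rewrite mnmDE mnmBE mnm1E.
  case: eqP => [<-|_]; last by rewrite subn0.
  by rewrite subnKC // lt0n.
rewrite mcoeffZ mcoeffX mulrCA; case: eqP => [->//|_].
by rewrite !mulr0.
Qed.

Lemma deg_lt_ddir N p : deg_lt N.+1 p -> deg_lt N (ddir p).
Proof.
move=> Hp mon Nmon; rewrite /ddir (raddf_sum (mcoeff mon)) big1 // => i _ /=.
by rewrite mcoeffCM mcoeff_deriv Hp ?mul0rn ?mulr0 // mdegD mdeg1 addn1.
Qed.

(** Let [N] bound the degree of [p]. Then [N p - euler p] also annihilates and has degree below [N].
    If it survives on the line, induction applies. Otherwise [p] restricts to a monomial of degree
    [N], so that its [N]-th derivative along [b] is a nonzero constant; some power of [delta] times
    this constant annihilates. *)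
Lemma loc_kills_line p : kills p -> line p != 0 -> exists k, kills (delta ^+ k).
Proof.
have [N] := deg_lt_ex p; elim: N p => [|N IH] p degp Hp.
  suff -> : p = 0 by rewrite rmorph0 eqxx.
  by apply/mpolyP => mon; rewrite mcoeff0 degp.
pose q := N%:R%:MP * p - euler p.
have Hq : kills q.
  by apply: killsD; [apply: killsM|apply/killsN/(kills_euler A)].
have degq : deg_lt N q.
  move=> mon; rewrite /q mcoeffB mcoeffCM mcoeff_euler -mulrBl leq_eqVlt.
  case/predU1P=> [<-|/degp ->]; last by rewrite mulr0.
  by rewrite subrr mul0r.
have [Eq p0|q0 _] := eqVneq (line q) 0; last exact: (IH q).
have coefp e : e != N -> (line p)`_e = 0.
  move=> eN; have := congr1 (fun s : {poly K} => s`_e) Eq.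
  rewrite /q lineB lineM lineC line_euler coef0 coefB coefCM coefXM coef_deriv.
  case: e eN => [|e] eN /=.
    rewrite subr0 => /eqP; rewrite mulf_eq0 pnatr_eq0 eq_sym (negPf eN).
    by move/eqP.
  rewrite -[_ *+ e.+1]mulr_natl -mulrBl => /eqP; rewrite mulf_eq0 subr_eq0 eqr_nat.
  by rewrite eq_sym (negPf eN) => /eqP.
have lcN : (line p)`_N != 0.
  apply: contraNneq p0 => pN; apply/eqP/polyP => e; rewrite coef0.
  by have [->|/coefp] := eqVneq e N.
have iter_loc e : loc_kills (iter e ddir p).
  by elim: e => [|e IHe]; [exists 0%N; rewrite mul1r|apply: loc_kills_ddir].
have iter_deg e : (e <= N)%N -> deg_lt (N - e).+1 (iter e ddir p).
  elim: e => [|e IHe] eN; first by rewrite subn0.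
  by apply: deg_lt_ddir; rewrite subnSK //; apply/IHe/ltnW.
have iter_line e : line (iter e ddir p) = (line p)^`(e).
  by elim: e => [|e IHe] //=; rewrite line_ddir IHe.
have := iter_deg N (leqnn N); rewrite subnn => deg1.
pose a := (iter N ddir p)@_0%MM.
have Ea : iter N ddir p = a%:MP.
  apply/mpolyP => mon; rewrite mcoeffC.
  have [->|mon0] := eqVneq mon 0%MM; first by rewrite mulr1.
  by rewrite mulr0 deg1 // lt0n mdeg_eq0.
have a0 : a != 0.
  have := congr1 (fun s : {poly K} => s`_0) (iter_line N).
  rewrite Ea lineC coefC eqxx coef_derivn addn0 ffactnn => ->.
  by rewrite mulrn_eq0 negb_or lcN -lt0n fact_gt0.
have [e He] := iter_loc N; exists e => m.
have := He (a^-1%:MP *: m); rewrite scalerA Ea -mulrA -mpolyCM divff // mpolyC1.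
by rewrite mulr1.
Qed.

End Stratum.

(** In each term of the binomial expansion one of the two exponents is large enough. *)
Lemma ideal_expD (R : comNzRingType) (Q : R -> Prop) (x y : R) e e' :
  Q 0 -> (forall u v, Q u -> Q v -> Q (u + v)) -> (forall u v, Q v -> Q (u * v)) ->
  Q (x ^+ e) -> Q (y ^+ e') -> Q ((x + y) ^+ (e + e')).
Proof.
move=> Q0 QD QM Hx Hy; rewrite exprDn; apply: (big_ind Q) => // i _.
rewrite -mulr_natl; apply: (QM); have [le|lt] := leqP e (e + e' - i).
  by rewrite -[X in x ^+ X](subnKC le) exprD -mulrA mulrC; apply: (QM).
have le : (e' <= i)%N by lia.
by rewrite -[X in y ^+ X](subnKC le) exprD mulrCA mulrC; apply: (QM).
Qed.

(** * The choice of a point of the support *)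

Section StratumExists.
Variables (K : numFieldType) (n : nat) (V : lmodType {mpoly K[n]}).
Local Notation P := {mpoly K[n]}.
Local Notation kills := (@kills K n V).
Implicit Types (p q : P).

Lemma kills0 : kills 0. Proof. by move=> m; rewrite scale0r. Qed.

Lemma kills_expD p q e e' :
  kills (p ^+ e) -> kills (q ^+ e') -> kills ((p + q) ^+ (e + e')).
Proof. by apply: ideal_expD; [apply: kills0|apply: killsD|apply: killsM]. Qed.

(** For a maximal [S] with [D S] not nilpotent, a root is outside [S] exactly when its product with
    [D S] is nilpotent. This is an equivalence relation on the letters, transitive because sums of
    nilpotents are nilpotent; its classes become the level sets of [b]. *)
Lemma stratum_exists : (exists m : V, m <> 0) -> exists b : 'I_n -> K,
  [/\ \sum_i b i = 0, forall k, ~ kills (delta b ^+ k) &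
      forall i j, b i = b j -> exists k, kills ((('X_i - 'X_j) * delta b) ^+ k)].
Proof.
move=> [m0 m0n0].
pose D (S : {set 'I_n * 'I_n}) : P := \prod_(s in S) ('X_s.1 - 'X_s.2).
pose good S := `[<forall k, ~ kills (D S ^+ k)>].
have good0 : good set0.
  apply/asboolP => k /(_ m0); rewrite /D big_set0 expr1n scale1r.
  exact: m0n0.
have [S /maxsetP[/asboolP goodS maxS]] := ex_maxset (ex_intro good set0 good0).
pose nil i j := exists k, kills ((('X_i - 'X_j) * D S) ^+ k).
have nilP i j : nil i j <-> (i, j) \notin S.
  split=> [[k Hk]|ijS].
    apply/negP => ijS; apply: (goodS (k + k)%N).
    rewrite exprD {1}/D (bigD1 (i, j)) //= exprMn mulrAC mulrC -exprMn.
    exact: killsM.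
  apply: contrapT => Hn; have : good ((i, j) |: S).
    apply/asboolP => k Hk; apply: Hn; exists k.
    by rewrite /D big_setU1 in Hk.
  move=> /maxS /(_ (subsetUr _ _)) E; case/negP: ijS.
  by rewrite -E !inE eqxx.
have nil_refl i : nil i i by exists 1%N; rewrite subrr mul0r expr1; apply: kills0.
have nil_sym i j : nil i j -> nil j i.
  move=> [k Hk]; exists k; rewrite -opprB mulNr exprNn.
  exact: killsM.
have nil_trans i j l : nil i j -> nil j l -> nil i l.
  move=> [k Hk] [k' Hk']; exists (k + k')%N.
  have -> : ('X_i - 'X_l) * D S = ('X_i - 'X_j) * D S + ('X_j - 'X_l) * D S by ring.
  exact: kills_expD.
pose C i := [set j | (i, j) \notin S].
have CP i j : C i = C j <-> nil i j.
  split=> [E|ij].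
    have : j \in C i by rewrite E inE; apply/nilP.
    by rewrite inE => /nilP.
  apply/setP => l; rewrite !inE; apply/idP/idP => /nilP H; apply/nilP.
    exact: nil_trans (nil_sym _ _ ij) H.
  exact: nil_trans ij H.
(* Distinct classes receive distinct integers; the mean is then subtracted to make the sum zero. *)
pose rk i : K := (enum_rank (C i))%:R.
pose b i := rk i - (\sum_j rk j) / n%:R.
have bP i j : b i = b j <-> nil i j.
  rewrite -CP; split=> [/addIr /eqP|E]; last by rewrite /b /rk E.
  by rewrite eqr_nat => /eqP /val_inj /enum_rank_inj.
have deltaD : delta b = D S.
  apply: eq_bigl => -[i j] /=; apply/idP/idP => [bij|ijS].
    apply/negP => /negP /nilP /bP /eqP; exact/negP.
  by apply/eqP => /bP /nilP; rewrite ijS.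
exists b; split=> [|k|i j /bP].
- rewrite /b sumrB sumr_const card_ord -[_ *+ n]mulr_natr.
  have [n0|n0] := eqVneq n 0%N; last by rewrite divfK ?subrr // pnatr_eq0.
  rewrite big1 ?mul0r ?subr0 // => i _; case: i => i lin; exfalso.
  by rewrite n0 in lin.
- by rewrite deltaD.
- by rewrite deltaD.
Qed.

End StratumExists.

(** * The fiber at a point of the support *)

Section Fiber.
Variables (K : numFieldType) (n : nat) (c : K) (V : lmodType {mpoly K[n]}).
Variable A : rca_action c V.
Variable b : 'I_n -> K.
Hypothesis sum_b : \sum_i b i = 0.
Local Notation P := {mpoly K[n]}.
Local Notation kills := (@kills K n V).
Local Notation delta := (delta b).
Hypothesis delta_nonnil : forall k, ~ kills (delta ^+ k).
Variables (r : nat) (g : 'I_r -> V).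
Hypothesis gen : forall m, exists q : 'I_r -> P, m = \sum_t q t *: g t.
Implicit Types (p q : P) (m : V) (i j l : 'I_n).

(* The equations of [b] in the fixed space of its stabilizer. *)
Definition fiber_eqn i : P :=
  \sum_(j | b j == b i) 'X_j - (b i *+ #|[pred j | b j == b i]|)%:MP.

Lemma meval_fiber_eqn i : (fiber_eqn i).@[b] = 0.
Proof.
rewrite mevalB mevalC rmorph_sum /= (eq_bigr (fun=> b i)) => [|j /eqP <-].
  by rewrite sumr_const subrr.
by rewrite mevalXU.
Qed.

Definition in_fiber0 m := exists v : 'I_n -> V, m = \sum_i fiber_eqn i *: v i.

Lemma in_fiber0D m m' : in_fiber0 m -> in_fiber0 m' -> in_fiber0 (m + m').
Proof.
move=> [v ->] [v' ->]; exists (fun i => v i + v' i).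
by rewrite -big_split; apply: eq_bigr => i _; rewrite scalerDr.
Qed.

Lemma in_fiber0Z p m : in_fiber0 m -> in_fiber0 (p *: m).
Proof.
move=> [v ->]; exists (fun i => p *: v i).
by rewrite scaler_sumr; apply: eq_bigr => i _; rewrite !scalerA mulrC.
Qed.

Lemma in_fiber0_eqn i m : in_fiber0 (fiber_eqn i *: m).
Proof.
exists (fun j => if j == i then m else 0); rewrite (bigD1 i) //= eqxx.
by rewrite big1 ?addr0 // => j /negPf ->; rewrite scaler0.
Qed.

(* The kernel of the map from the module to the fiber at [b] of its
   localization away from the zeros of [delta]. *)
Definition fiber_ker m := exists k, in_fiber0 (delta ^+ k *: m).

Lemma fiber_kerP k m : fiber_ker (delta ^+ k *: m) -> fiber_ker m.
Proof. by move=> [e]; rewrite scalerA -exprD; exists (e + k)%N. Qed.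

Lemma fiber_ker0 m : in_fiber0 m -> fiber_ker m.
Proof. by move=> H; exists 0%N; rewrite scale1r. Qed.

Lemma in_fiber0_exp k e m : (k <= e)%N ->
  in_fiber0 (delta ^+ k *: m) -> in_fiber0 (delta ^+ e *: m).
Proof. by move=> /subnK <- H; rewrite exprD -scalerA; apply: in_fiber0Z. Qed.

Lemma fiber_kerD m m' : fiber_ker m -> fiber_ker m' -> fiber_ker (m + m').
Proof.
move=> [k Hk] [k' Hk']; exists (maxn k k'); rewrite scalerDr; apply: in_fiber0D.
  by apply: (in_fiber0_exp _ Hk); apply: leq_maxl.
by apply: (in_fiber0_exp _ Hk'); apply: leq_maxr.
Qed.

Lemma fiber_kerZ p m : fiber_ker m -> fiber_ker (p *: m).
Proof.
move=> [k Hk]; exists k; rewrite scalerA mulrC -scalerA.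
exact: in_fiber0Z.
Qed.

Lemma meval_delta : delta.@[b] != 0.
Proof.
rewrite rmorph_prod /=; apply/prodf_neq0 => -[i j] /= bij.
by rewrite mevalB !mevalXU subr_eq0.
Qed.

(* Nakayama's lemma: otherwise some polynomial not vanishing at [b] would
   annihilate the module. *)
Lemma fiber_nontrivial : exists m, ~ fiber_ker m.
Proof.
apply: contrapT => Hn; have all m : fiber_ker m.
  by apply: contrapT => Hm; apply: Hn; exists m.
have [k Hk] : exists k, forall t, in_fiber0 (delta ^+ k *: g t).
  have [e He] := fin_all_exists (fun t => all (g t)).
  exists (\max_t e t) => t; apply: (in_fiber0_exp _ (He t)).
  exact: (leq_bigmax t).
have row t : exists q : 'I_r -> P, delta ^+ k *: g t = \sum_s q s *: g s /\
    forall s, (q s).@[b] = 0.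
  have [v ->] := Hk t; have [q Hq] := fin_all_exists (fun i => gen (v i)).
  exists (fun s => \sum_i fiber_eqn i * q i s); split=> [|s]; last first.
    rewrite rmorph_sum big1 // => i _ /=.
    by rewrite mevalM meval_fiber_eqn mul0r.
  rewrite (eq_bigr (fun i => \sum_s (fiber_eqn i * q i s) *: g s)).
    by rewrite exchange_big; apply: eq_bigr => s _; rewrite scaler_suml.
  move=> i _; rewrite [in LHS]Hq scaler_sumr.
  by apply: eq_bigr => s _; rewrite scalerA.
have [q Hq] := fin_all_exists row.
(* [Q] annihilates the column of generators, hence its determinant annihilates the module; at [b]
   that determinant is a power of the value of [delta]. *)
pose Q : 'M[P]_r := \matrix_(t, s) ((delta ^+ k) *+ (t == s) - q t s).
have Qg t : \sum_s Q t s *: g s = 0.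
  under eq_bigr do rewrite mxE scalerBl.
  rewrite sumrB -(Hq t).1 (bigD1 t) //= eqxx big1 ?addr0 ?subrr // => s.
  by rewrite eq_sym => /negPf ->; rewrite scale0r.
have kdet : kills (\det Q).
  have detg u : \det Q *: g u = 0.
    transitivity (\sum_s (\adj Q *m Q) u s *: g s).
      rewrite mul_adj_mx (bigD1 u) //= !mxE eqxx big1 ?addr0 // => s.
      by rewrite mxE eq_sym => /negPf ->; rewrite scale0r.
    under eq_bigr do rewrite mxE scaler_suml.
    rewrite exchange_big big1 // => t _.
    under eq_bigr do rewrite -scalerA.
    by rewrite -scaler_sumr Qg scaler0.
  move=> m; have [a ->] := gen m; rewrite scaler_sumr big1 // => t _.
  by rewrite scalerA mulrC -scalerA detg scaler0.
have detb : (\det Q).@[b] != 0.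
  rewrite -det_map_mx (_ : map_mx _ Q = (delta.@[b] ^+ k)%:M); last first.
    apply/matrixP => t s; rewrite !mxE /= mevalB (Hq t).2 subr0.
    by case: eqP => _; rewrite ?mulr1n ?mulr0n ?meval0 ?rmorphXn.
  by rewrite det_scalar !expf_neq0 // meval_delta.
have [|e] := loc_kills_line A sum_b kdet; last exact: delta_nonnil.
by apply: contraNneq detb => E; rewrite -horner_line E horner0.
Qed.

End Fiber.

(** * Finite dimension of the fiber *)

(** A spanning family of minimal length has unique coefficients modulo [J], and these are the
    coordinates. Column vectors thus stand for the quotient space. *)
Lemma quotient_coordinates (K : fieldType) n (V : lmodType {mpoly K[n]})
    (J : V -> Prop) (I : finType) (v : I -> V) :
  J 0 -> (forall m m', J m -> J m' -> J (m + m')) ->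
  (forall a m, J m -> J (a%:MP *: m)) ->
  (forall m, exists a : I -> K, J (m - \sum_i (a i)%:MP *: v i)) ->
  exists N (cr : V -> 'cV[K]_N), [/\ forall m m', cr (m + m') = cr m + cr m',
    forall a m, cr (a%:MP *: m) = a *: cr m,
    forall x, exists m, cr m = x & forall m, cr m = 0 <-> J m].
Proof.
move=> J0 JD JZ span.
have JB m m' : J m -> J m' -> J (m - m').
  by move=> Hm Hm'; rewrite -scaleN1r -mpolyC1 -mpolyCN; apply/JD/JZ.
pose spans N (u : 'I_N -> V) :=
  forall m, exists a : 'I_N -> K, J (m - \sum_i (a i)%:MP *: u i).
have [N /asboolP[u Hu] minN] : {N | `[<exists u : 'I_N -> V, spans N u>] &
    forall N', `[<exists u : 'I_N' -> V, spans N' u>] -> (N <= N')%N}.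
  have ex : exists N, `[<exists u : 'I_N -> V, spans N u>].
    exists #|I|; apply/asboolP; exists (v \o enum_val) => m.
    have [a Ha] := span m; exists (a \o enum_val).
    by rewrite -(big_enum_val (fun i => (a i)%:MP *: v i)) in Ha *.
  by exists (ex_minn ex); case: ex_minnP.
have free (a : 'I_N -> K) : J (\sum_i (a i)%:MP *: u i) -> forall i, a i = 0.
  move=> Ha i; apply/eqP/negPn/negP => ai.
  case: N u Hu minN a Ha i ai => [|N] u Hu minN a Ha i ai; first by case: i {ai}.
  suff /minN : `[<exists u : 'I_N -> V, spans N u>] by rewrite ltnn.
  apply/asboolP; exists (u \o lift i) => m; have [e He] := Hu m.
  (* A relation with [a i != 0] eliminates [u i], against minimality. *)
  exists (fun j => e (lift i j) - e i / a i * a (lift i j)).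
  have -> : m -
      \sum_j (e (lift i j) - e i / a i * a (lift i j))%:MP *: (u \o lift i) j =
      m - \sum_j (e j)%:MP *: u j + (e i / a i)%:MP *: \sum_j (a j)%:MP *: u j.
    rewrite !(bigD1_ord i) //= scalerDr scalerA -mpolyCM divfK //.
    have -> : \sum_j (e (lift i j) - e i / a i * a (lift i j))%:MP *: u (lift i j) =
        \sum_j (e (lift i j))%:MP *: u (lift i j) -
        (e i / a i)%:MP *: \sum_j (a (lift i j))%:MP *: u (lift i j).
      rewrite scaler_sumr -sumrB; apply: eq_bigr => j _.
      by rewrite mpolyCB scalerBl mpolyCM scalerA.
    rewrite opprB opprD -[RHS]addrA [X in _ = _ + X]addrACA addNr add0r.
    by rewrite [- _ + _ in RHS]addrC.
  by apply: JD => //; apply: JZ.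
pose cf m := sval (cid (Hu m)).
have cfP m : J (m - \sum_i (cf m i)%:MP *: u i) by rewrite /cf; case: cid.
have cfU m (a : 'I_N -> K) : J (m - \sum_i (a i)%:MP *: u i) -> cf m =1 a.
  move=> Ha i; apply/eqP; rewrite -subr_eq0; apply/eqP.
  apply: (free (fun i => cf m i - a i)).
  have := JB _ _ Ha (cfP m); rewrite opprB addrC addrA subrK -sumrB.
  by under eq_bigr do rewrite -scalerBl -mpolyCB.
exists N, (fun m => \col_i cf m i); split=> [m m'|a m|x|m].
- apply/colP => i; rewrite !mxE; apply: (cfU _ (fun i => cf m i + cf m' i)).
  have := JD _ _ (cfP m) (cfP m'); rewrite addrACA -opprD -big_split /=.
  by under eq_bigr do rewrite -scalerDl -mpolyCD.
- apply/colP => i; rewrite !mxE; apply: (cfU _ (fun i => a * cf m i)).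
  have := JZ a _ (cfP m); rewrite scalerBr scaler_sumr.
  by under eq_bigr do rewrite scalerA -mpolyCM.
- exists (\sum_i (x i 0)%:MP *: u i); apply/colP => i; rewrite mxE.
  by apply: (cfU _ (fun i => x i 0)); rewrite subrr.
- split=> [/colP E|Hm]; last first.
    apply/colP => i; rewrite !mxE; apply: (cfU _ (fun=> 0)).
    by rewrite big1 ?subr0 // => j _; rewrite mpolyC0 scale0r.
  have := cfP m; rewrite big1 ?subr0 // => i _.
  by have := E i; rewrite !mxE => ->; rewrite mpolyC0 scale0r.
Qed.

Section FiberCoordinates.
Variables (K : numFieldType) (n : nat) (V : lmodType {mpoly K[n]}).
Variable b : 'I_n -> K.
Local Notation P := {mpoly K[n]}.
Local Notation delta := (delta b).
Hypothesis nilp : forall i j, b i = b j ->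
  exists k, @kills K n V ((('X_i - 'X_j) * delta) ^+ k).
Variables (r : nat) (g : 'I_r -> V).
Hypothesis gen : forall m, exists q : 'I_r -> P, m = \sum_t q t *: g t.
Implicit Types (p q : P) (m : V) (i j l : 'I_n).

Definition fiber_kills p := forall m : V, fiber_ker b (p *: m).

Lemma fiber_kills0 : fiber_kills 0.
Proof.
move=> m; rewrite scale0r -(scale0r (0 : V)); apply: fiber_kerZ; apply: fiber_ker0.
by exists (fun=> 0); rewrite big1 // => i _; rewrite scaler0.
Qed.

Lemma fiber_killsD p q : fiber_kills p -> fiber_kills q -> fiber_kills (p + q).
Proof. by move=> Hp Hq m; rewrite scalerDl; apply: fiber_kerD. Qed.

Lemma fiber_killsM p q : fiber_kills q -> fiber_kills (p * q).
Proof. by move=> Hq m; rewrite -scalerA; apply: fiber_kerZ. Qed.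

Definition fiber_nilp p := exists e, fiber_kills (p ^+ e).

Lemma fiber_nilpD p q : fiber_nilp p -> fiber_nilp q -> fiber_nilp (p + q).
Proof.
move=> [e He] [e' He']; exists (e + e')%N; apply: (ideal_expD (Q := fiber_kills)) => //.
- exact: fiber_kills0.
- exact: fiber_killsD.
- exact: fiber_killsM.
Qed.

Lemma fiber_nilpM p q : fiber_nilp q -> fiber_nilp (p * q).
Proof. by move=> [e He]; exists e; rewrite exprMn; apply: fiber_killsM. Qed.

Lemma fiber_nilp0 : fiber_nilp 0.
Proof. by exists 1%N; rewrite expr1; apply: fiber_kills0. Qed.

(** The size of the block times ['X_i - b i] is the sum of the ['X_i - 'X_j] over the block plus an
    equation of the fiber. The differences are nilpotent up to powers of [delta], which [fiber_ker]
    ignores, and the equation vanishes on the fiber. *)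
Lemma fiber_nilp_var i : fiber_nilp ('X_i - (b i)%:MP).
Proof.
pose N := #|[pred j | b j == b i]|.
have N0 : N%:R != 0 :> K.
  by rewrite pnatr_eq0 -lt0n; apply/card_gt0P; exists i; rewrite !inE.
have -> : 'X_i - (b i)%:MP = (N%:R^-1)%:MP *
    (\sum_(j | b j == b i) ('X_i - 'X_j) + fiber_eqn b i) :> P.
  have -> : \sum_(j | b j == b i) ('X_i - 'X_j) + fiber_eqn b i =
      N%:R%:MP * ('X_i - (b i)%:MP) :> P.
    rewrite /fiber_eqn sumrB addrA subrK sumr_const -/N mulrBr -mpolyCM mulr_natl.
    by rewrite mpolyC_nat mulr_natl.
  by rewrite mulrA -mpolyCM mulVf // mpolyC1 mul1r.
apply: fiber_nilpM; apply: fiber_nilpD; last first.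
  exists 1%N => m; apply: fiber_ker0; rewrite expr1.
  exact: in_fiber0_eqn.
apply: (big_ind fiber_nilp) => [||j /eqP bji].
- exact: fiber_nilp0.
- exact: fiber_nilpD.
have [k Hk] := nilp (esym bji); exists k => m; exists k.
rewrite scalerA -exprMn mulrC Hk; exists (fun=> 0).
by rewrite big1 // => l _; rewrite scaler0.
Qed.

Lemma fiber_coordinates : exists N (cr : V -> 'cV[K]_N),
  [/\ forall m m', cr (m + m') = cr m + cr m',
    forall a m, cr (a%:MP *: m) = a *: cr m,
    forall x, exists m, cr m = x & forall m, cr m = 0 <-> fiber_ker b m].
Proof.
have [N HN] : exists N, forall i, fiber_kills (('X_i - (b i)%:MP) ^+ N.+1).
  have [e He] := fin_all_exists fiber_nilp_var.
  exists (\max_i e i) => i.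
  have le : (e i <= (\max_j e j).+1)%N by apply/leqW/(leq_bigmax i).
  by rewrite -(subnK le) exprD; apply: fiber_killsM.
pose E := {ffun 'I_n -> 'I_N.+1}.
pose mono (e : E) : P := \prod_i ('X_i - (b i)%:MP) ^+ e i.
pose sp p := exists a : E -> K, fiber_kills (p - \sum_e (a e)%:MP * mono e).
have sp_kills p : fiber_kills p -> sp p.
  move=> Hp; exists (fun=> 0); rewrite big1 ?subr0 // => e _.
  by rewrite mpolyC0 mul0r.
have spD p q : sp p -> sp q -> sp (p + q).
  move=> [a Ha] [a' Ha']; exists (fun e => a e + a' e).
  have -> : p + q - \sum_e (a e + a' e)%:MP * mono e =
      (p - \sum_e (a e)%:MP * mono e) + (q - \sum_e (a' e)%:MP * mono e).
    rewrite addrACA -opprD -big_split; congr (_ - _).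
    by apply: eq_bigr => e _; rewrite mpolyCD mulrDl.
  exact: fiber_killsD.
have spZ z p : sp p -> sp (z%:MP * p).
  move=> [a Ha]; exists (fun e => z * a e).
  have -> : z%:MP * p - \sum_e (z * a e)%:MP * mono e =
      z%:MP * (p - \sum_e (a e)%:MP * mono e).
    rewrite mulrBr mulr_sumr; congr (_ - _).
    by apply: eq_bigr => e _; rewrite mpolyCM mulrA.
  exact: fiber_killsM.
have sp_mono e : sp (mono e).
  exists (fun e' => (e' == e)%:R); rewrite (bigD1 e) //= eqxx mpolyC1 mul1r.
  rewrite big1 ?addr0 ?subrr; first exact: fiber_kills0.
  by move=> e' /negPf ->; rewrite mpolyC0 mul0r.
have spT l e : sp (('X_l - (b l)%:MP) * mono e).
  have [lt|ge] := ltnP (e l).+1 N.+1.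
    pose e' : E := [ffun i => if i == l then Ordinal lt else e i].
    suff -> : ('X_l - (b l)%:MP) * mono e = mono e' by [].
    rewrite /mono (bigD1 l) // [in RHS](bigD1 l) //= ffunE eqxx exprS mulrA.
    by congr (_ * _); apply: eq_bigr => i /negPf il; rewrite ffunE il.
  apply: sp_kills; rewrite /mono (bigD1 l) //= mulrA -exprS mulrC.
  apply: fiber_killsM; suff -> : (e l).+1 = N.+1 by apply: HN.
  by apply/eqP; rewrite eqn_leq ge ltn_ord.
have sp_sum (F : E -> P) : (forall e, sp (F e)) -> sp (\sum_e F e).
  move=> H; apply: (big_ind sp) => //.
  exact/sp_kills/fiber_kills0.
have spX l p : sp p -> sp ('X_l * p).
  move=> Hp; have -> : 'X_l * p = ('X_l - (b l)%:MP) * p + (b l)%:MP * p by ring.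
  apply: (spD); last exact: spZ.
  have [a Ha] := Hp.
  rewrite -[p](subrK (\sum_e (a e)%:MP * mono e)) mulrDr; apply: (spD).
    exact/sp_kills/fiber_killsM.
  rewrite mulr_sumr; apply: sp_sum => e; rewrite mulrCA; exact/spZ/spT.
have spA p : sp p.
  elim/mpoly_mulX_ind: p => [a|p q|l p]; [|exact: spD|exact: spX].
  rewrite -[a%:MP]mulr1; apply: (spZ).
  have -> : 1 = mono [ffun=> ord0] by rewrite /mono big1 // => i _; rewrite ffunE expr0.
  exact: sp_mono.
apply: (quotient_coordinates (v := fun et : E * 'I_r => mono et.1 *: g et.2)).
- by have := fiber_kills0 0; rewrite scaler0.
- exact: fiber_kerD.
- by move=> a m; apply: fiber_kerZ.
move=> m; have [q ->] := gen m; have [a Ha] := fin_all_exists (fun t => spA (q t)).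
exists (fun et => a et.2 et.1).
have -> : \sum_t q t *: g t -
    \sum_(et : E * 'I_r) (a et.2 et.1)%:MP *: (mono et.1 *: g et.2) =
    \sum_t (q t - \sum_e (a t e)%:MP * mono e) *: g t.
  rewrite -(pair_bigA _ (fun e t => (a t e)%:MP *: (mono e *: g t))) exchange_big /=.
  rewrite -sumrB; apply: eq_bigr => t _; rewrite scalerBl scaler_suml.
  by congr (_ - _); apply: eq_bigr => e _; rewrite scalerA.
apply: (big_ind (fiber_ker b)) => [||t _]; [|exact: fiber_kerD|exact: Ha].
by have := fiber_kills0 0; rewrite scaler0.
Qed.

End FiberCoordinates.

(** * The Cherednik algebra of the stabilizer acting on the fiber *)

Section FiberOperators.
Variables (K : numFieldType) (n : nat) (c : K) (V : lmodType {mpoly K[n]}).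
Variable A : rca_action c V.
Variable b : 'I_n -> K.
Local Notation P := {mpoly K[n]}.
Local Notation G := (grp_act A).
Local Notation Y := (mom_act A).
Local Notation delta := (delta b).
Local Notation J := (@fiber_ker K n V b).
Variables (N : nat) (cr : V -> 'cV[K]_N).
Hypothesis crD : forall m m', cr (m + m') = cr m + cr m'.
Hypothesis crC : forall a m, cr (a%:MP *: m) = a *: cr m.
Hypothesis cr_surj : forall x, exists m, cr m = x.
Hypothesis crP : forall m, cr m = 0 <-> J m.
Implicit Types (p q : P) (m : V) (i j l : 'I_n) (w : 'S_n).

Lemma cr0 : cr 0 = 0.
Proof. by apply: (addrI (cr 0)); rewrite -crD !addr0. Qed.

Lemma cr_sum (I : Type) (r : seq I) (Q : pred I) (F : I -> V) :
  cr (\sum_(i <- r | Q i) F i) = \sum_(i <- r | Q i) cr (F i).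
Proof. exact: (big_morph _ crD cr0). Qed.

Lemma crN m : cr (- m) = - cr m.
Proof. by apply: (addrI (cr m)); rewrite -crD !subrr cr0. Qed.

Lemma mx_crP (B C : 'M[K]_N) : (forall m, B *m cr m = C *m cr m) -> B = C.
Proof.
move=> H; apply/matrixP => i j; have [m Hm] := cr_surj (delta_mx j 0).
have := H m; rewrite Hm => /colP /(_ i).
rewrite !mxE (bigD1 j) //= [in RHS](bigD1 j) //= !mxE !eqxx !mulr1.
rewrite !big1 ?addr0 // => l /negPf lj; by rewrite mxE lj mulr0.
Qed.

(** The matrix of the map induced on the fiber, meaningful when [T] is linear and vanishes on [J];
    its columns are computed on chosen lifts of the basis vectors. *)
Definition mxop (T : V -> 'cV[K]_N) : 'M[K]_N :=
  \matrix_(i, j) T (sval (cid (cr_surj (delta_mx j 0)))) i 0.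

Lemma mxopE (T : V -> 'cV[K]_N) m :
  (forall m m', T (m + m') = T m + T m') ->
  (forall a m, T (a%:MP *: m) = a *: T m) ->
  (forall m, J m -> T m = 0) -> T m = mxop T *m cr m.
Proof.
move=> TD TC TJ; pose e (t : 'I_N) := sval (cid (cr_surj (delta_mx t 0))).
have T0 : T 0 = 0 by apply: (addrI (T 0)); rewrite -TD !addr0.
have Tsum (F : 'I_N -> V) : T (\sum_j F j) = \sum_j T (F j).
  exact: (big_morph _ TD T0).
have ce t : cr (e t) = delta_mx t 0 by rewrite /e; case: cid.
have Hm : T (m - \sum_t (cr m t 0)%:MP *: e t) = 0.
  apply/TJ/crP; rewrite crD crN cr_sum; apply/eqP; rewrite subr_eq0.
  rewrite [X in X == _]matrix_sum_delta; apply/eqP/eq_bigr => j _.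
  by rewrite big_ord1 crC ce.
rewrite -[m in LHS](subrK (\sum_t (cr m t 0)%:MP *: e t)) TD Hm add0r Tsum.
apply/colP => i; rewrite summxE mxE; apply: eq_bigr => j _.
by rewrite TC !mxE mulrC.
Qed.

Definition rho p := mxop (fun m => cr (p *: m)).

Lemma rhoE p m : cr (p *: m) = rho p *m cr m.
Proof.
apply: (mxopE (T := fun m => cr (p *: m))) => [m1 m2|a m1|m1 Hm1].
- by rewrite scalerDr crD.
- by rewrite scalerA mulrC -scalerA crC.
- exact/crP/fiber_kerZ.
Qed.

Lemma rhoM p q : rho (p * q) = rho p *m rho q.
Proof. by apply: mx_crP => m; rewrite -mulmxA -!rhoE scalerA. Qed.

Lemma rhoD p q : rho (p + q) = rho p + rho q.
Proof. by apply: mx_crP => m; rewrite mulmxDl -!rhoE scalerDl crD. Qed.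

Lemma rhoC a : rho a%:MP = a%:M.
Proof. by apply: mx_crP => m; rewrite -rhoE crC mul_scalar_mx. Qed.

Lemma rho_unit p : (forall m, J (p *: m) -> J m) -> rho p \in unitmx.
Proof.
move=> H; rewrite unitmxE unitfE -det_tr; apply/det0P => -[v v0 Hv].
have [m Hm] := cr_surj v^T.
case/negP: v0; rewrite -[v]trmxK -Hm -trmx0; apply/eqP; congr _^T.
by apply/crP/H/crP; rewrite rhoE Hm -[rho p]trmxK -trmx_mul Hv trmx0.
Qed.

Lemma rho_root_unit i j : b i != b j -> rho ('X_i - 'X_j) \in unitmx.
Proof.
move=> bij; apply: rho_unit => m Hm; apply: (fiber_kerP (k := 1)).
rewrite expr1 (deltaE bij) mulrC -scalerA; exact: fiber_kerZ.
Qed.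

Definition stab w := [forall i, b (w i) == b i].

Lemma stabP w : reflect (forall i, b (w i) = b i) (stab w).
Proof. by apply: (iffP forallP) => H i; apply/eqP. Qed.

Lemma stabV w : stab w -> stab w^-1%g.
Proof. by move=> /stabP H; apply/stabP => i; rewrite -[in RHS](permKV w i) H. Qed.

Lemma stabM u w : stab u -> stab w -> stab (u * w)%g.
Proof. by move=> /stabP Hu /stabP Hw; apply/stabP => i; rewrite permM Hw Hu. Qed.

Lemma stab_tperm_b i j : b i = b j -> stab (tperm i j).
Proof. by move=> bij; apply/stabP => l; case: tpermP => [->|->|]. Qed.

Lemma msym_delta w : stab w -> msym w delta = delta.
Proof.
move=> /stabP Hw; rewrite rmorph_prod /=.
rewrite [RHS](reindex_inj (h := fun s : 'I_n * 'I_n => (w s.1, w s.2))) /=.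
  by apply: eq_big => [s|s _]; rewrite ?Hw // msymB !msymX1.
by move=> [i j] [i' j'] /= [/perm_inj -> /perm_inj ->].
Qed.

Lemma msym_fiber_eqn w i : stab w -> msym w (fiber_eqn b i) = fiber_eqn b i.
Proof.
move=> /stabP Hw; rewrite msymB msymC msym_sum; congr (_ - _).
rewrite [RHS](reindex_inj (@perm_inj _ w)).
by apply: eq_big => [j|j _]; rewrite ?Hw ?msymX1.
Qed.

Lemma fiber_ker_grp w m : stab w -> J m -> J (G w m).
Proof.
move=> Hw [k [v Hv]]; exists k; exists (fun i => G w (v i)).
have Hw' := stabV Hw.
have -> : delta ^+ k *: G w m = G w (delta ^+ k *: m).
  by rewrite grp_actZ rmorphXn /= msym_delta.
rewrite Hv grp_act_sum; apply: eq_bigr => i _.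
by rewrite grp_actZ msym_fiber_eqn.
Qed.

Definition gam w := mxop (fun m => cr (G w m)).

Lemma gamE w m : stab w -> cr (G w m) = gam w *m cr m.
Proof.
move=> Hw; apply: (mxopE (T := fun m => cr (G w m))) => [m1 m2|a m1|m1 Hm1].
- by rewrite grp_actD crD.
- by rewrite grp_actZ msymC crC.
- exact/crP/fiber_ker_grp.
Qed.

Lemma gamM u w : stab u -> stab w -> gam (u * w)%g = gam u *m gam w.
Proof.
move=> Hu Hw; apply: mx_crP => m.
by rewrite -mulmxA -!gamE ?stabM // grp_actM.
Qed.

Lemma gam1 : gam 1%g = 1%:M.
Proof.
apply: mx_crP => m; rewrite -gamE ?grp_act1 ?mul1mx //.
by apply/stabP => i; rewrite perm1.
Qed.

Lemma gam_rho w p : stab w -> gam w *m rho p = rho (msym w^-1%g p) *m gam w.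
Proof.
move=> Hw; apply: mx_crP => m.
by rewrite -!mulmxA -rhoE -!gamE // -rhoE grp_actZ.
Qed.

Definition root_inv i j := invmx (rho ('X_i - 'X_j)).

Lemma gam_root_inv w i j : stab w -> b i != b j ->
  gam w *m root_inv i j = root_inv (w^-1%g i) (w^-1%g j) *m gam w.
Proof.
move=> Hw bij; have /stabP Hw' := stabV Hw.
apply: (canLR (mulmxK (rho_root_unit bij))).
rewrite -mulmxA gam_rho // msymB !msymX1 mulmxA /root_inv mulVmx ?mul1mx //.
by apply: rho_root_unit; rewrite !Hw'.
Qed.

Lemma root_inv_rho i j p : b i != b j ->
  root_inv i j *m rho p = rho p *m root_inv i j.
Proof.
move=> bij; have U := rho_root_unit bij.
apply: (canLR (mulKmx U)); rewrite mulmxA -rhoM mulrC rhoM -mulmxA mulmxV //.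
by rewrite mulmx1.
Qed.

(* The part of the momentum operator supported on the stratum of [b]: the
   reflections that move the stratum are removed. *)
Definition pair_op (y : refl_rep K n) m : 'cV[K]_N :=
  \sum_(s : 'I_n * 'I_n | b s.1 != b s.2) (hcoord y s.1 - hcoord y s.2) *:
    (root_inv s.1 s.2 *m cr (G (tperm s.1 s.2) m)).

(** Each reflection occurs in [pair_op] for both orders of its letters, whence the half. *)
Definition local_mom y m := cr (Y y m) - (c / 2%:R) *: pair_op y m.

Lemma sum_pairs_at_b (U : zmodType) (F : 'I_n -> U) l :
  \sum_(s : 'I_n * 'I_n | b s.1 != b s.2)
    (if s.1 == l then F s.2 else if s.2 == l then F s.1 else 0) =
  (\sum_(j | b j != b l) F j) *+ 2.
Proof.
pose H i j := if i == l then F j else 0; pose H' i j := if j == l then F i else 0.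
rewrite (eq_bigr (fun s => H s.1 s.2 + H' s.1 s.2)) => [|[i j] /= bij]; last first.
  rewrite /H /H'; case: eqP => [il|_]; last by rewrite add0r.
  case: eqP => [jl|_]; last by rewrite addr0.
  by rewrite il jl eqxx in bij.
rewrite big_split /= mulr2n -!(pair_big_dep xpredT (fun i j => b i != b j)) /=.
congr (_ + _).
  rewrite (bigD1 l) //= [X in _ + X]big1 ?addr0 => [|i /negPf il].
    by apply: eq_big => [j|j _]; rewrite ?[b l == _]eq_sym // /H eqxx.
  by rewrite big1 // => j _; rewrite /H il.
rewrite (exchange_big_dep xpredT) //= (bigD1 l) //= [X in _ + X]big1 ?addr0.
  by apply: eq_big => // j _; rewrite /H' eqxx.
by move=> j /negPf jl; rewrite big1 // => i _; rewrite /H' jl.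
Qed.

Lemma pair_opX y l m : pair_op y ('X_l *: m) = rho 'X_l *m pair_op y m -
  (\sum_(j | b j != b l) (hcoord y l - hcoord y j) *: cr (G (tperm l j) m)) *+ 2.
Proof.
rewrite -mulNrn -sumrN -sum_pairs_at_b mulmx_sumr -big_split.
apply: eq_bigr => -[i j] /= bij; rewrite grp_actZ tpermV msymX1 -scalemxAr.
have nij : i != j by apply: contraNneq bij => ->.
have E p q : rho p - rho q = rho (p - q).
  by rewrite -[- q]mulN1r -mpolyC1 -mpolyCN rhoD rhoM rhoC mul_scalar_mx scaleN1r.
have red p : root_inv i j *m cr (p *: G (tperm i j) m) =
    rho p *m (root_inv i j *m cr (G (tperm i j) m)).
  by rewrite rhoE mulmxA root_inv_rho // -mulmxA.
have cancel (x : 'cV[K]_N) : rho ('X_i - 'X_j) *m (root_inv i j *m x) = x.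
  by rewrite mulmxA mulmxV ?rho_root_unit // mul1mx.
rewrite red; set x := root_inv i j *m _.
case: (tpermP i j l) => [->|->|/eqP/negPf il /eqP/negPf jl].
- rewrite eqxx -scalerN -scalerDr; congr (_ *: _).
  rewrite -(cancel (cr (G (tperm i j) m))) -/x -mulNmx -mulmxDl; congr (_ *m x).
  by rewrite -E // opprB addrC subrK.
- rewrite eqxx (negPf nij) [tperm j i]tpermC -scaleNr opprB -scalerDr; congr (_ *: _).
  rewrite -(cancel (cr (G (tperm i j) m))) -/x -mulmxDl; congr (_ *m x).
  by rewrite -E // addrC subrK.
- by rewrite ![_ == l]eq_sym il jl addr0.
Qed.

(** The terms of [pair_opX] cancel the reflections outside the stabilizer of [b]; what remains is
    the commutation relation of its Cherednik algebra. *)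
Lemma local_momX y l m : local_mom y ('X_l *: m) = rho 'X_l *m local_mom y m +
  (hcoord y l *: cr m - c *: \sum_(j | (j != l) && (b j == b l))
     (hcoord y l - hcoord y j) *: cr (G (tperm l j) m)).
Proof.
rewrite /local_mom pair_opX mom_actX crD crD crN !crC cr_sum rhoE.
rewrite (eq_bigr (fun j => (hcoord y l - hcoord y j) *:
  cr (G (tperm l j) m))) => [|j _]; last by rewrite crC.
rewrite (bigID (fun j => b j == b l)) /= scalerDr.
have -> : \sum_(i < n | (i != l) && (b i != b l))
    (hcoord y l - hcoord y i) *: cr (G (tperm l i) m) =
    \sum_(i | b i != b l) (hcoord y l - hcoord y i) *: cr (G (tperm l i) m).
  by apply: eq_bigl => i; case: eqVneq => //= ->; rewrite eqxx.
have cancel (u v s s' t : 'cV[K]_N) : u + (v - (s + s')) - (t - s') = u - t + (v - s).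
  rewrite opprB opprD !addrA subrK addrAC; congr (_ - _); exact: addrAC.
by rewrite mulmxBr -scalemxAr scalerBr -scaler_nat scalerA divfK ?pnatr_eq0 ?cancel.
Qed.

(** The vectors in the reflection representation of the stabilizer; their momenta descend to the
    fiber. *)
Definition balanced (y : refl_rep K n) :=
  forall l, \sum_(j | b j == b l) hcoord y j = 0.

Lemma pair_opD y m m' : pair_op y (m + m') = pair_op y m + pair_op y m'.
Proof.
rewrite /pair_op -big_split; apply: eq_bigr => s _.
by rewrite grp_actD crD mulmxDr scalerDr.
Qed.

Lemma pair_opC y a m : pair_op y (a%:MP *: m) = a *: pair_op y m.
Proof.
rewrite /pair_op scaler_sumr; apply: eq_bigr => s _.
by rewrite grp_actZ msymC crC -scalemxAr !scalerA mulrC.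
Qed.

Lemma local_momD y m m' : local_mom y (m + m') = local_mom y m + local_mom y m'.
Proof. by rewrite /local_mom mom_actD crD pair_opD scalerDr opprD addrACA. Qed.

Lemma local_momC y a m : local_mom y (a%:MP *: m) = a *: local_mom y m.
Proof.
by rewrite /local_mom mom_actC crC pair_opC scalerBr !scalerA [_ * a]mulrC.
Qed.

Lemma local_mom0 y : local_mom y 0 = 0.
Proof. by apply: (addrI (local_mom y 0)); rewrite -local_momD !addr0. Qed.

Lemma local_mom_sum y (I : Type) (r : seq I) (Q : pred I) (F : I -> V) :
  local_mom y (\sum_(i <- r | Q i) F i) = \sum_(i <- r | Q i) local_mom y (F i).
Proof. exact: (big_morph _ (local_momD y) (local_mom0 y)). Qed.

Lemma rho_sum (I : Type) (r : seq I) (Q : pred I) (F : I -> P) :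
  rho (\sum_(i <- r | Q i) F i) = \sum_(i <- r | Q i) rho (F i).
Proof. by apply: (big_morph rho rhoD); rewrite -mpolyC0 rhoC raddf0. Qed.

Lemma rho_fiber_eqn i : rho (fiber_eqn b i) = 0.
Proof.
apply: mx_crP => m; rewrite mul0mx -rhoE.
exact/crP/fiber_ker0/in_fiber0_eqn.
Qed.

(** The derivative of a block sum along a balanced vector is zero, and the reflection terms cancel
    in pairs, [hcoord y i - hcoord y j] being antisymmetric. *)
Lemma local_mom_fiber_eqn y l m : balanced y ->
  local_mom y (fiber_eqn b l *: m) = 0.
Proof.
move=> Hy; rewrite /fiber_eqn -mpolyCN scalerDl local_momD local_momC scaler_suml.
rewrite local_mom_sum.
under eq_bigr do rewrite local_momX.
rewrite big_split /= sumrB -scaler_suml Hy scale0r sub0r -scaler_sumr.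
have -> : \sum_(i | b i == b l) \sum_(j | (j != i) && (b j == b i))
    (hcoord y i - hcoord y j) *: cr (G (tperm i j) m) = 0.
  pose F i j := (hcoord y i - hcoord y j) *: cr (G (tperm i j) m).
  have E : \sum_(i | b i == b l) \sum_(j | (j != i) && (b j == b i)) F i j =
      \sum_(i | b i == b l) \sum_(j | (b j == b l) && (j != i)) F i j.
    by apply: eq_bigr => i /eqP bi; apply: eq_bigl => j; rewrite bi andbC.
  have E2 : \sum_(i | b i == b l) \sum_(j | (b j == b l) && (j != i)) F i j =
      - \sum_(i | b i == b l) \sum_(j | (b j == b l) && (j != i)) F i j.
    rewrite -sumrN (exchange_big_dep (fun j => b j == b l)) /=; last first.
      by move=> i j _ /andP[].
    apply: eq_bigr => i bi; rewrite -sumrN; apply: eq_big => j.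
      by rewrite bi /= [i == j]eq_sym.
    by move=> _; rewrite /F tpermC -scaleNr opprB.
  rewrite -/(F _ _) E; apply/eqP; have := scaler_eq0 (2%:R : K)
    (\sum_(i | b i == b l) \sum_(j | (b j == b l) && (j != i)) F i j).
  by rewrite scaler_nat mulr2n {1}E2 addNr eqxx pnatr_eq0 => /esym.
rewrite scaler0 oppr0 addr0 -mulmx_suml -rho_sum -mul_scalar_mx -rhoC -mulmxDl -rhoD.
by rewrite mpolyCN -/(fiber_eqn b l) rho_fiber_eqn mul0mx.
Qed.

(** On [J] the correction terms of [local_momX] vanish, so that [local_mom y] commutes there with
    polynomials. A power of [delta] moves [m] into the multiples of the equations, and [delta] is
    injective on the fiber. *)
Lemma local_mom_ker y m : balanced y -> J m -> local_mom y m = 0.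
Proof.
move=> Hy Jm.
have H p m' : J m' -> local_mom y (p *: m') = rho p *m local_mom y m'.
  move=> Jm'; elim/mpoly_mulX_ind: p => [a|p q Hp Hq|l p Hp].
  - by rewrite local_momC rhoC mul_scalar_mx.
  - by rewrite scalerDl local_momD Hp Hq rhoD mulmxDl.
  - have Jp : J (p *: m') by apply: fiber_kerZ.
    rewrite -scalerA local_momX Hp (crP _).2 // scaler0 big1 ?scaler0 ?subr0 ?addr0.
      by rewrite rhoM mulmxA.
    move=> j /andP[_ /eqP bj]; rewrite (crP _).2 ?scaler0 //.
    by apply: fiber_ker_grp => //; apply: stab_tperm_b.
have [k [v Hv]] := Jm.
have : local_mom y (delta ^+ k *: m) = 0.
  rewrite Hv local_mom_sum big1 // => i _; exact: local_mom_fiber_eqn.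
rewrite H // => E; have [m' Em'] := cr_surj (local_mom y m).
rewrite -Em' in E *; apply/crP/(fiber_kerP (k := k))/crP.
by rewrite rhoE.
Qed.

Definition eta y := mxop (local_mom y).

Lemma etaE y m : balanced y -> local_mom y m = eta y *m cr m.
Proof.
move=> Hy; apply: mxopE => [m1 m2|a m1|m1].
- exact: local_momD.
- exact: local_momC.
- exact: local_mom_ker.
Qed.

Lemma eta_rho y l : balanced y -> eta y *m rho 'X_l = rho 'X_l *m eta y +
  ((hcoord y l)%:M - c *: \sum_(j | (j != l) && (b j == b l))
     (hcoord y l - hcoord y j) *: gam (tperm l j)).
Proof.
move=> Hy; apply: mx_crP => m.
rewrite -mulmxA -rhoE -etaE // local_momX mulmxDl mulmxBl -mulmxA -etaE //.
congr (_ + (_ - _)); first by rewrite mul_scalar_mx.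
rewrite -scalemxAl mulmx_suml; congr (_ *: _); apply: eq_bigr => j /andP[_ /eqP bj].
by rewrite gamE -?scalemxAl //; apply: stab_tperm_b.
Qed.

Lemma gam_eta w y : stab w -> hact w y = y -> balanced y ->
  gam w *m eta y = eta y *m gam w.
Proof.
move=> Hw wy Hy; apply: mx_crP => m.
rewrite -!mulmxA -etaE // -gamE // -etaE // /local_mom mulmxBr -gamE //.
rewrite grp_mom_act wy -scalemxAr; congr (_ - _ *: _).
rewrite /pair_op mulmx_sumr; have /stabP Hw' := stabV Hw; have /stabP Hs := Hw.
rewrite [RHS](reindex_inj (h := fun s : 'I_n * 'I_n => (w^-1%g s.1, w^-1%g s.2))) /=.
  apply: eq_big => [s|[i j] /= bij]; first by rewrite !Hw'.
  have yw l : hcoord y (w^-1%g l) = hcoord y l.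
    by rewrite -[in LHS]wy hactE permKV.
  rewrite !yw -scalemxAr mulmxA gam_root_inv // -mulmxA -gamE //.
  congr (_ *: (_ *m cr _)).
  rewrite -!grp_actM; congr (G _ m).
  by rewrite -tpermJ conjgE invgK -!mulgA mulVg mulg1.
by move=> [i j] [i' j'] /= [/perm_inj -> /perm_inj ->].
Qed.

Hypothesis nilp : forall i j, b i = b j ->
  exists k, @kills K n V ((('X_i - 'X_j) * delta) ^+ k).
Hypothesis sum_grp0 : forall m, \sum_w G w m = 0.

(** ['X_i - b j] is the nonzero scalar [b i - b j] plus a nilpotent; the factorization of
    [x ^+ e - y ^+ e] inverts it. *)
Lemma fiber_ker_shift i j m :
  b i != b j -> J (('X_i - (b j)%:MP) *: m) -> J m.
Proof.
move=> bij Hm; have [e He] := fiber_nilp_var nilp i.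
pose x : P := (b i - b j)%:MP; pose y : P := - ('X_i - (b i)%:MP).
have Jx : J (x ^+ e *: m).
  rewrite -[x ^+ e](subrK (y ^+ e)) scalerDl; apply: fiber_kerD; last first.
    by rewrite exprNn; apply: fiber_killsM.
  rewrite subrXX mulrC -scalerA; apply: fiber_kerZ.
  suff -> : x - y = 'X_i - (b j)%:MP by [].
  by rewrite /x /y opprK mpolyCB; ring.
have x1 : ((b i - b j)^-1)%:MP ^+ e * x ^+ e = 1 :> P.
  by rewrite -exprMn /x -mpolyCM mulVf ?subr_eq0 // mpolyC1 expr1n.
by rewrite -[m]scale1r -x1 -scalerA; apply: fiber_kerZ.
Qed.

(** Distinguishes [b] from its other translates. [delta] would not do: a permutation that exchanges
    two blocks of equal size fixes it. *)
Definition separator : P :=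
  \prod_(s : 'I_n * 'I_n | b s.1 != b s.2) ('X_s.1 - (b s.2)%:MP).

Lemma separator_ker e m : J (separator ^+ e *: m) -> J m.
Proof.
have H : forall m', J (separator *: m') -> J m'.
  apply: (big_ind (fun p => forall m', J (p *: m') -> J m')) =>
    [m'|p q Hp Hq m'|s bs m'].
  - by rewrite scale1r.
  - by rewrite -scalerA => /Hp /Hq.
  - exact: fiber_ker_shift.
by elim: e => [|e IH]; rewrite ?scale1r // exprS -scalerA => /H.
Qed.

Lemma msym_separator w : stab w -> msym w separator = separator.
Proof.
move=> /stabP Hw; rewrite rmorph_prod /=.
rewrite [RHS](reindex_inj (h := fun s : 'I_n * 'I_n => (w s.1, w s.2))) /=.
  by apply: eq_big => [s|s _]; rewrite ?Hw // msymB msymX1 msymC.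
by move=> [i j] [i' j'] /= [/perm_inj -> /perm_inj ->].
Qed.

Lemma separator_nilp w : ~~ stab w -> fiber_nilp V b (msym w separator).
Proof.
move=> /forallPn[i bwi]; rewrite /separator (bigD1 (i, w i)) /=; last by rewrite eq_sym.
rewrite msymM mulrC; apply: fiber_nilpM.
by rewrite msymB msymX1 msymC; apply: fiber_nilp_var.
Qed.

(** Take the vanishing sum over all permutations at [separator ^+ e *: m]. Outside the stabilizer
    the terms die in the fiber; inside, they commute with [separator], which is injective there. *)
Lemma sum_gam0 : \sum_(w | stab w) gam w = 0.
Proof.
have [e He] : exists e, forall w, ~~ stab w -> fiber_kills V b (msym w separator ^+ e).
  have H w : exists e, ~~ stab w -> fiber_kills V b (msym w separator ^+ e).
    by have [_|/separator_nilp[e He]] := boolP (stab w); [exists 0%N|exists e].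
  have [e He] := fin_all_exists H.
  exists (\max_w e w) => w Hw; rewrite -(subnK (leq_bigmax w)) exprD.
  exact/fiber_killsM/He.
apply: mx_crP => m; rewrite mul0mx mulmx_suml.
transitivity (cr (\sum_(w | stab w) G w m)).
  by rewrite cr_sum; apply: eq_bigr => w Hw; rewrite -gamE.
apply/crP/(separator_ker (e := e)).
have := sum_grp0 (separator ^+ e *: m); rewrite (bigID stab) /= => /eqP.
rewrite addr_eq0 => /eqP E; rewrite scaler_sumr.
have -> : \sum_(w | stab w) separator ^+ e *: G w m =
    \sum_(w | stab w) G w (separator ^+ e *: m).
  apply: eq_bigr => w Hw.
  by rewrite grp_actZ rmorphXn /= msym_separator // stabV.
rewrite E -scaleN1r; apply: fiber_kerZ.
apply: (big_ind J) => [||w Hw]; [by apply/crP/cr0|exact: fiber_kerD|].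
rewrite grp_actZ rmorphXn /=; apply: He.
by apply: contra Hw => /stabV; rewrite invgK.
Qed.

(** * Partial symmetrizers and their traces *)

Definition stab_upto k w := stab w && [forall i : 'I_n, (k <= i)%N ==> (w i == i)].

Lemma stab_uptoP k w : reflect (stab w /\ forall i : 'I_n, (k <= i)%N -> w i = i)
  (stab_upto k w).
Proof.
apply: (iffP andP) => -[Hw H]; split=> //.
  by move=> i ki; have /forallP /(_ i) := H; rewrite ki => /eqP.
by apply/forallP => i; apply/implyP => ki; apply/eqP/H.
Qed.

Definition partial_sym k := \sum_(w | stab_upto k w) gam w.

Lemma partial_sym0 : partial_sym 0 = 1%:M.
Proof.
rewrite /partial_sym (big_pred1 1%g) ?gam1 // => w /=.
apply/stab_uptoP/eqP => [[_ H]|->]; first by apply/permP => i; rewrite H ?perm1.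
by split=> [|i _]; [apply/stabP => i|]; rewrite perm1.
Qed.

Lemma partial_symn : partial_sym n = 0.
Proof.
rewrite -sum_gam0; apply: eq_bigl => w.
apply/stab_uptoP/idP => [[]//|Hw]; split=> // i ni.
by have := ltn_ord i; rewrite ltnNge ni.
Qed.

Lemma stab_upto_lt k w i : stab_upto k w -> (w i < k)%N = (i < k)%N.
Proof.
case/stab_uptoP => _ H; apply/idP/idP; rewrite !ltnNge; apply: contra => ki.
  by rewrite H.
by rewrite -(perm_inj (H _ ki)).
Qed.

(** Coset decomposition according to the image [j] of the letter [i]: each element is one that fixes
    [i], followed by [tperm i j]. *)
Lemma partial_symS (i : 'I_n) : partial_sym i.+1 = partial_sym i +
  \sum_(j : 'I_n | (j < i)%N && (b j == b i)) partial_sym i *m gam (tperm i j).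
Proof.
rewrite {1}/partial_sym.
rewrite (partition_big (fun w : 'S_n => w i)
  (fun j : 'I_n => (j <= i)%N && (b j == b i))) /=; last first.
  move=> w Hw; have /stab_uptoP[/stabP Hb _] := Hw.
  by rewrite Hb eqxx andbT -ltnS (stab_upto_lt _ Hw).
have E j : (j <= i)%N -> b j == b i ->
    \sum_(w | stab_upto i.+1 w && (w i == j)) gam w =
    \sum_(w | stab_upto i w) gam (w * tperm i j)%g.
  move=> ji /eqP bj; rewrite (reindex_inj (mulIg (tperm i j))) /=.
  have Ht : stab (tperm i j) by apply: stab_tperm_b.
  have tfix (l : 'I_n) : (i < l)%N -> tperm i j l = l.
    by move=> il; rewrite tpermD // -val_eqE ltn_eqF // (leq_ltn_trans ji).
  apply: eq_bigl => w; apply/andP/stab_uptoP => [[/stab_uptoP[Hw H] /eqP]|[Hw H]].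
    rewrite permM => wi; split=> [|l].
      by rewrite -[w](mulgK (tperm i j)) tpermV; apply: stabM.
    rewrite leq_eqVlt => /predU1P[/val_inj <-|il].
      by apply: (@perm_inj _ (tperm i j)); rewrite wi tpermL.
    by apply: (@perm_inj _ (tperm i j)); rewrite [RHS]tfix // -permM H.
  split; last by rewrite permM H ?tpermL.
  apply/stab_uptoP; split=> [|l il]; first exact: stabM.
  by rewrite permM H ?tfix // ltnW.
rewrite (bigD1 i) ?leqnn ?eqxx //= E // tperm1; congr (_ + _).
  by apply: eq_bigr => w _; rewrite mulg1.
apply: eq_big => [j|j /andP[/andP[ji bj] _]].
  by rewrite ltn_neqAle -val_eqE /= andbAC [RHS]andbC andbA [RHS]andbC andbA andbAC.
rewrite E // mulmx_suml; apply: eq_bigr => w /stab_uptoP[Hw _].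
by rewrite gamM //; apply/stab_tperm_b/esym/eqP.
Qed.

Lemma trace_step (i : 'I_n) (d := #|[pred j | b j == b i]|)
    (m := #|[pred j : 'I_n | (j < i)%N && (b j == b i)]|) :
  (0 < m)%N ->
  c * d%:R * \tr (partial_sym i.+1) = (c * d%:R + m%:R) * \tr (partial_sym i).
Proof.
move=> m0; have d0 : (0 < d)%N by apply/card_gt0P; exists i; rewrite !inE.
have m0' : m%:R != 0 :> K by rewrite pnatr_eq0 -lt0n.
have d0' : d%:R != 0 :> K by rewrite pnatr_eq0 -lt0n.
(* [f] depends only on the block and on whether [l] comes before [i], hence is fixed by the group
   summed so far. The constants make it balanced, with [f i - f j] equal to [m%:R^-1] for the
   earlier letters of the block and to zero for the later ones. *)
pose f (l : 'I_n) : K :=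
  if b l == b i then d%:R^-1 - (if (l < i)%N then m%:R^-1 else 0) else 0.
have sumf : \sum_(j | b j == b i) f j = 0.
  rewrite (eq_bigr (fun j => d%:R^-1 - (if (j < i)%N then m%:R^-1 else 0))); last first.
    by move=> j bj; rewrite /f bj.
  rewrite sumrB sumr_const -big_mkcondr sumr_const -[_^-1 *+ _]mulr_natr mulVf //.
  rewrite -[_^-1 *+ _]mulr_natr (_ : #|_| = m) ?mulVf ?subrr //.
  by apply: eq_card => j; rewrite !inE andbC.
have f0 : \sum_j f j = 0.
  rewrite (bigID (fun j => b j == b i)) /= sumf add0r big1 // => j /negPf bj.
  by rewrite /f bj.
pose y := hvec f.
have Hy : balanced y.
  move=> l; under eq_bigr do rewrite hvecE //.
  have [->//|bl] := eqVneq (b l) (b i).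
  by rewrite big1 // => j /eqP bj; rewrite /f bj (negPf bl).
have yE l : hcoord y l = f l by rewrite hvecE.
have comm : partial_sym i *m eta y = eta y *m partial_sym i.
  rewrite mulmx_suml mulmx_sumr; apply: eq_bigr => w Hw.
  have /stab_uptoP[Hs Hfix] := Hw; apply: gam_eta => //.
  apply: hcoordP => l; rewrite hactE !yE /f (stabP _ Hs).
  by rewrite (stab_upto_lt _ Hw).
pose t := \tr (partial_sym i).
pose u := \sum_(j : 'I_n | (j < i)%N && (b j == b i))
  \tr (partial_sym i *m gam (tperm i j)).
have tS : \tr (partial_sym i.+1) = t + u.
  by rewrite partial_symS mxtraceD; congr (_ + _); apply: raddf_sum.
pose B := (hcoord y i)%:M - c *: \sum_(j | (j != i) && (b j == b i))
     (hcoord y i - hcoord y j) *: gam (tperm i j).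
(* [B] is the commutator of [eta y] with [rho 'X_i], and [partial_sym i] commutes with [eta y];
   cyclicity of the trace concludes. *)
have trB : \tr (partial_sym i *m B) = 0.
  have -> : B = eta y *m rho 'X_i - rho 'X_i *m eta y.
    by rewrite eta_rho // addrC addKr.
  rewrite mulmxBr raddfB /= mulmxA comm -mulmxA mxtrace_mulC -mulmxA.
  by rewrite mulmxA subrr.
have fi : f i = d%:R^-1 by rewrite /f eqxx ltnn subr0.
have EB : B = d%:R^-1%:M - (c / m%:R) *: \sum_(j : 'I_n | (j < i)%N && (b j == b i))
    gam (tperm i j).
  rewrite /B yE fi -scalerA; congr (_ - _ *: _); rewrite scaler_sumr.
  rewrite (bigID (fun j : 'I_n => (j < i)%N)) /= [X in _ + X]big1 ?addr0.
    apply: eq_big => [j|j /andP[/andP[_ bj] ji]].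
      by rewrite -val_eqE /=; case: ltngtP => //=; rewrite ?andbF ?andbT.
    by rewrite yE /f bj ji opprB addrC subrK.
  move=> j /andP[/andP[_ bj] /negPf ji].
  by rewrite yE /f bj ji subr0 subrr scale0r.
have key : d%:R^-1 * t = c / m%:R * u.
  apply/eqP; rewrite -subr_eq0 -trB EB mulmxBr mul_mx_scalar -scalemxAr.
  rewrite raddfB /= !mxtraceZ mulmx_sumr; apply/eqP; congr (_ - _ * _).
  exact/esym/raddf_sum.
have Et : t = d%:R * (c / m%:R * u) by rewrite -key mulVKf.
rewrite tS -/t mulrDr mulrDl; congr (_ + _).
by rewrite Et; field.
Qed.

Lemma aspherical_ratio : (exists m, ~ J m) ->
  exists m d : nat, [/\ (0 < m)%N, (m < d)%N, (d <= n)%N & c * d%:R + m%:R = 0].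
Proof.
move=> [m0 Jm0]; apply: contrapT => Hn.
have H k : (k <= n)%N -> \tr (partial_sym k) != 0.
  elim: k => [|k IH] kn.
    (* The trace is the dimension of the fiber, which is not zero. *)
    rewrite partial_sym0 mxtrace1 pnatr_eq0; apply: contra_notN Jm0 => /eqP N0.
    apply/crP/colP => i; exfalso; case: i => i; rewrite N0; exact/negP.
  pose i := Ordinal kn; have := IH (ltnW kn); rewrite -[k]/(i : nat).
  (* The first letter of a block leaves the partial sum unchanged. *)
  have [m_0|m_gt0] := posnP #|[pred j : 'I_n | (j < i)%N && (b j == b i)]|.
    rewrite partial_symS big_pred0 ?addr0 // => j.
    by have := card0_eq m_0 j; rewrite inE.
  move=> t0; apply/negP => /eqP tS; have := trace_step m_gt0; rewrite tS mulr0.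
  move/esym/eqP; rewrite mulf_eq0 (negPf t0) orbF => /eqP E; apply: Hn.
  exists #|[pred j : 'I_n | (j < i)%N && (b j == b i)]|, #|[pred j | b j == b i]|.
  split=> //; last first.
    by rewrite -[X in (_ <= X)%N]card_ord; apply: max_card.
  apply: proper_card; apply/properP; split.
    by apply/subsetP => j; rewrite !inE => /andP[].
  by exists i; rewrite !inE ?ltnn.
have := H n (leqnn n); rewrite partial_symn.
by rewrite -(scale0r 0) mxtraceZ mul0r eqxx.
Qed.

End FiberOperators.

(** * The polynomial subalgebra *)

Section PolynomialAction.
Variables (K : numFieldType) (n : nat) (c : K).
Local Notation P := {mpoly K[n]}.
Local Notation H := (rca n c).
Implicit Types (p q : P) (mon : 'X_{1..n}).

Lemma rca_cstD a b : rca_cst n c (a + b) = rca_cst n c a + rca_cst n c b.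
Proof. by rewrite -pclsD; apply/pclsP/cong_cstD. Qed.

Lemma rca_cstM a b : rca_cst n c (a * b) = rca_cst n c a * rca_cst n c b.
Proof. by rewrite -pclsM; apply/pclsP/cong_cstM. Qed.

Lemma rca_cst1 : rca_cst n c 1 = 1. Proof. by []. Qed.
Lemma rca_cst0 : rca_cst n c 0 = 0. Proof. by []. Qed.

Lemma rca_cstC a (h : H) : rca_cst n c a * h = h * rca_cst n c a.
Proof. by elim/pcls_ind: h => t; rewrite -!pclsM; apply/pclsP/cong_cstC. Qed.

Lemma rca_pos_comm (x y : refl_dual K n) :
  rca_pos c x * rca_pos c y = rca_pos c y * rca_pos c x.
Proof.
apply/eqP; rewrite -subr_eq0 -!pclsM -pclsB; apply/eqP.
exact/pclsP/cong_rel/rca_pos_pos.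
Qed.

Lemma rca_posDE (x y : refl_dual K n) : rca_pos c (x + y) = rca_pos c x + rca_pos c y.
Proof. by rewrite -pclsD; apply/pclsP/cong_rel/rca_posD. Qed.

Lemma rca_posZE a (x : refl_dual K n) :
  rca_pos c (a *: x) = rca_cst n c a * rca_pos c x.
Proof. by rewrite -pclsM; apply/pclsP/cong_rel/rca_posZ. Qed.

Lemma rca_pos0 : rca_pos c (0 : refl_dual K n) = 0.
Proof. by rewrite -(scale0r 0) rca_posZE rca_cst0 mul0r. Qed.

Lemma rca_pos_sum (I : Type) (r : seq I) (Q : pred I) (F : I -> refl_dual K n) :
  rca_pos c (\sum_(i <- r | Q i) F i) = \sum_(i <- r | Q i) rca_pos c (F i).
Proof. exact: (big_morph _ rca_posDE rca_pos0). Qed.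

Definition rca_var i : H := rca_pos c (xcoord K i).

Definition rca_mon mon : H := \prod_i rca_var i ^+ mon i.

Definition of_mpoly p : H := \sum_(mon <- msupp p) rca_cst n c p@_mon * rca_mon mon.

Lemma rca_mon0 : rca_mon 0%MM = 1.
Proof. by rewrite /rca_mon big1 // => i _; rewrite mnm0E expr0. Qed.

Lemma rca_monD m1 m2 : rca_mon (m1 + m2)%MM = rca_mon m1 * rca_mon m2.
Proof.
rewrite /rca_mon -prodrM_comm => [|i j _ _].
  by apply: eq_bigr => i _; rewrite mnmDE exprD.
by apply/commrX/commr_sym/commrX; apply: rca_pos_comm.
Qed.

Lemma of_mpolyE p N : (msize p <= N)%N ->
  of_mpoly p = \sum_(mon : 'X_{1..n < N}) rca_cst n c p@_mon * rca_mon mon.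
Proof.
move=> le_pN; set I : subFinType _ := 'X_{1..n < N}.
rewrite /of_mpoly (ssrcomplements.big_mksub I) ?msupp_uniq //=; first last.
  by move=> x /msize_mdeg_lt /leq_trans; apply.
rewrite big_rmcond //= => j /memN_msupp_eq0 ->.
by rewrite rca_cst0 mul0r.
Qed.

Lemma of_mpolyD p q : of_mpoly (p + q) = of_mpoly p + of_mpoly q.
Proof.
pose N := maxn (msize (p + q)) (maxn (msize p) (msize q)).
rewrite !(@of_mpolyE _ N) ?leq_max ?leqnn ?orbT // -big_split.
by apply: eq_bigr => mon _; rewrite mcoeffD rca_cstD mulrDl.
Qed.

Lemma of_mpolyZ a p : of_mpoly (a *: p) = rca_cst n c a * of_mpoly p.
Proof.
pose N := maxn (msize (a *: p)) (msize p).
rewrite !(@of_mpolyE _ N) ?leq_max ?leqnn ?orbT // mulr_sumr.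
by apply: eq_bigr => mon _; rewrite mcoeffZ rca_cstM mulrA.
Qed.

Lemma of_mpolyXm mon : of_mpoly 'X_[mon] = rca_mon mon.
Proof. by rewrite /of_mpoly msuppX big_seq1 mcoeffX eqxx rca_cst1 mul1r. Qed.

Lemma of_mpolyC a : of_mpoly a%:MP = rca_cst n c a.
Proof.
by rewrite -[_%:MP]mulr1 mul_mpolyC of_mpolyZ -mpolyX0 of_mpolyXm rca_mon0 mulr1.
Qed.

Lemma of_mpoly0 : of_mpoly 0 = 0.
Proof. by rewrite -mpolyC0 of_mpolyC rca_cst0. Qed.

Lemma of_mpolyX i : of_mpoly 'X_i = rca_var i.
Proof.
rewrite of_mpolyXm /rca_mon -[RHS](big_pred1_eq *%R i rca_var) big_mkcond /=.
by apply: eq_bigr => j _; rewrite mnm1E eq_sym; case: eqP.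
Qed.

Lemma of_mpolyM p q : of_mpoly (p * q) = of_mpoly p * of_mpoly q.
Proof.
elim/mpolyind: p => [|a m p _ _ Hp]; first by rewrite mul0r of_mpoly0 mul0r.
rewrite mulrDl !of_mpolyD Hp mulrDl; congr (_ + _).
rewrite -scalerAl !of_mpolyZ -mulrA; congr (_ * _) => {a p Hp}.
elim/mpolyind: q => [|a m' q _ _ Hq]; first by rewrite mulr0 of_mpoly0 mulr0.
rewrite mulrDr !of_mpolyD Hq mulrDr; congr (_ + _).
rewrite -scalerAr !of_mpolyZ -mpolyXD !of_mpolyXm rca_monD.
by rewrite mulrA rca_cstC -mulrA.
Qed.

End PolynomialAction.

(** * Relations between polynomials, permutations and momenta *)

Section AlgebraRelations.
Variables (K : numFieldType) (n : nat) (c : K).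
Local Notation P := {mpoly K[n]}.
Local Notation H := (rca n c).
Local Notation phi := (of_mpoly c).
Implicit Types (p q : P) (w : 'S_n) (y : refl_rep K n).

Lemma rca_grpME u w : rca_grp c (u * w)%g = rca_grp c u * rca_grp c w.
Proof. by rewrite -pclsM; apply/pclsP/cong_rel/rca_grpM. Qed.

Lemma rca_grp1E : rca_grp c (1%g : 'S_n) = 1.
Proof. exact/pclsP/cong_rel/rca_grp1. Qed.

Lemma rca_grp_mom_comm w y :
  rca_grp c w * rca_mom c y = rca_mom c (hact w y) * rca_grp c w.
Proof. by rewrite -!pclsM; apply/pclsP/cong_rel/rca_grp_mom. Qed.

Lemma dact_xcoord w i : dact w (xcoord K i) = xcoord K (w^-1%g i).
Proof. by apply/lfunP => y; rewrite comp_lfunE !xcoordE hactE. Qed.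

Lemma rca_grp_var w i : rca_grp c w * rca_var c i = rca_var c (w^-1%g i) * rca_grp c w.
Proof.
by rewrite /rca_var -dact_xcoord -!pclsM; apply/pclsP/cong_rel/rca_grp_pos.
Qed.

Lemma rca_grp_mpoly w p :
  rca_grp c w * phi p = phi (msym w^-1%g p) * rca_grp c w.
Proof.
elim/mpoly_mulX_ind: p => [a|p q Hp Hq|l p Hp].
- by rewrite msymC of_mpolyC rca_cstC.
- by rewrite msymD !of_mpolyD mulrDr Hp Hq mulrDl.
- by rewrite msymM msymX1 !of_mpolyM !of_mpolyX mulrA rca_grp_var -mulrA Hp mulrA.
Qed.

Lemma rca_mom_var y l : rca_mom c y * phi 'X_l = phi 'X_l * rca_mom c y +
  (rca_cst n c (hcoord y l) - rca_cst n c c * \sum_(j | j != l)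
     rca_cst n c (hcoord y l - hcoord y j) * rca_grp c (tperm l j)).
Proof.
rewrite of_mpolyX; apply/eqP; rewrite addrC -subr_eq; apply/eqP.
rewrite rca_commutator xcoordE; congr (_ - _ * _).
rewrite -sum_pairs_at; apply: eq_bigr => -[i j] /= ij.
rewrite hrootE xcoordE hcorootE ![l == _]eq_sym.
case: eqVneq => [<-|il].
  by rewrite -val_eqE gtn_eqF // subr0 mulr1.
case: eqVneq => [<-|jl]; last by rewrite subrr mulr0 rca_cst0 mul0r.
by rewrite sub0r mulrN1 opprB tpermC.
Qed.

Lemma sum_rca_var : phi (\sum_i 'X_i : P) = 0.
Proof.
rewrite (big_morph phi (@of_mpolyD _ _ _) (@of_mpoly0 _ _ _)).
under eq_bigr do rewrite of_mpolyX.
rewrite -rca_pos_sum (_ : \sum_i _ = 0) ?rca_pos0 //.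
apply/lfunP => y; rewrite sum_lfunE zero_lfunE -[RHS](sum_hcoord y).
by apply: eq_bigr => i _; rewrite xcoordE.
Qed.

Lemma rca_polyE h : rca_poly h -> exists p, h = phi p.
Proof.
elim=> {h} [a|x|f g _ [p ->] _ [q ->]|f g _ [p ->] _ [q ->]].
- by exists a%:MP; rewrite of_mpolyC.
- exists (\sum_i x (hproj K i) *: 'X_i).
  rewrite [x in LHS]dual_xcoord rca_pos_sum.
  rewrite (big_morph phi (@of_mpolyD _ _ _) (@of_mpoly0 _ _ _)).
  by apply: eq_bigr => i _; rewrite rca_posZE of_mpolyZ of_mpolyX.
- by exists (p + q); rewrite of_mpolyD.
- by exists (p * q); rewrite of_mpolyM.
Qed.

End AlgebraRelations.

(** A copy of [M], to carry a module structure over polynomials beside the one over the algebra. *)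
Definition poly_mod (K : numFieldType) (n : nat) (c : K)
  (M : lmodType (rca n c)) : Type := M.

Section PolyModule.
Variables (K : numFieldType) (n : nat) (c : K) (M : lmodType (rca n c)).
Local Notation P := {mpoly K[n]}.
Local Notation V := (poly_mod M).

HB.instance Definition _ := GRing.Zmodule.on V.

Definition poly_scale (p : P) (m : V) : V := of_mpoly c p *: (m : M).

Fact poly_scaleA p q m : poly_scale p (poly_scale q m) = poly_scale (p * q) m.
Proof. by rewrite /poly_scale of_mpolyM scalerA. Qed.
Fact poly_scale1 : left_id 1 poly_scale.
Proof. by move=> m; rewrite /poly_scale -mpolyC1 of_mpolyC scale1r. Qed.
Fact poly_scaleDr : right_distributive poly_scale +%R.
Proof. by move=> p m m'; rewrite /poly_scale scalerDr. Qed.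
Fact poly_scaleDl m : {morph poly_scale^~ m : p q / p + q}.
Proof. by move=> p q; rewrite /poly_scale of_mpolyD scalerDl. Qed.

HB.instance Definition _ := GRing.Zmodule_isLmodule.Build P V
  poly_scaleA poly_scale1 poly_scaleDr poly_scaleDl.

Lemma poly_modE (p : P) (m : V) : p *: m = of_mpoly c p *: (m : M).
Proof. by []. Qed.

Definition poly_grp (w : 'S_n) (m : V) : V := rca_grp c w *: (m : M).
Definition poly_mom (y : refl_rep K n) (m : V) : V := rca_mom c y *: (m : M).

Definition poly_action : rca_action c V.
Proof.
apply: (@RcaAction _ _ _ _ poly_grp poly_mom).
- by move=> w m m'; rewrite /poly_grp scalerDr.
- by move=> m; rewrite /poly_grp rca_grp1E scale1r.
- by move=> u w m; rewrite /poly_grp rca_grpME scalerA.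
- by move=> w p m; rewrite /poly_grp !poly_modE !scalerA rca_grp_mpoly.
- by move=> y m m'; rewrite /poly_mom scalerDr.
- by move=> y a m; rewrite /poly_mom !poly_modE !scalerA of_mpolyC rca_cstC.
- by move=> w y m; rewrite /poly_grp /poly_mom !scalerA rca_grp_mom_comm.
- move=> y l m; rewrite /poly_mom !poly_modE scalerA rca_mom_var scalerDl scalerBl.
  rewrite !of_mpolyC -!scalerA.
  suff -> : \sum_(j | j != l)
        (hcoord y l - hcoord y j)%:MP_[n] *: poly_grp (tperm l j) m =
      (\sum_(j | j != l) rca_cst n c (hcoord y l - hcoord y j) *
        rca_grp c (tperm l j)) *: (m : M) by [].
  by rewrite scaler_suml; apply: eq_bigr => j _; rewrite poly_modE of_mpolyC scalerA.
- by move=> m; rewrite poly_modE sum_rca_var scale0r.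
Defined.

End PolyModule.

(** * The two inclusions *)

Lemma aspherical_value_ratio (K : numFieldType) (n : nat) (c : K) :
  aspherical_value n c ->
  exists m d : nat, [/\ (0 < m)%N, (m < d)%N, (d <= n)%N & c * d%:R + m%:R = 0].
Proof.
move=> [M [[[r [g gen]] _] [nz asph]]].
pose V : lmodType {mpoly K[n]} := poly_mod M; pose A : rca_action c V := poly_action M.
have genV (m : V) : exists q : 'I_r -> {mpoly K[n]}, m = \sum_t q t *: (g t : V).
  have [f Hf ->] := gen m.
  have /choice [q Hq] : forall t, exists p, f t = of_mpoly c p.
    by move=> t; apply: rca_polyE.
  by exists q; apply: eq_bigr => t _; rewrite Hq.
have sum_grp0 (m : V) : \sum_w grp_act A w m = 0.
  pose N := #|[set: 'S_n]|; have N0 : (N%:R : K) != 0.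
    by rewrite pnatr_eq0 -lt0n /N cardsT; apply/card_gt0P; exists 1%g.
  have := asph m; rewrite /rca_sym -scalerA.
  move=> /(congr1 (fun v => rca_cst n c N%:R *: v)).
  by rewrite scaler0 scalerA -rca_cstM mulfV // rca_cst1 scale1r scaler_suml.
have [b [sum_b delta_nonnil delta_nil]] := @stratum_exists _ _ V nz.
have [N [cr [crD crC cr_surj crP]]] := fiber_coordinates delta_nil genV.
apply: (aspherical_ratio crD crC cr_surj crP delta_nil sum_grp0).
exact: (fiber_nontrivial A sum_b delta_nonnil genV).
Qed.

Lemma Qset_ratio (R : realType) (n m d : nat) : (0 < m)%N -> (m < d)%N -> (d <= n)%N ->
  Qset R n (- (m%:R / d%:R) : complex R).
Proof.
move=> m0 md dn; have d0 : (0 < d)%N by apply: leq_trans md.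
pose q : rat := - (m%:R / d%:R); exists q.
have q_d : q * d%:R = - m%:R by rewrite mulNr divfK // pnatr_eq0 -lt0n.
split.
- by rewrite ltrN2 ltr_pdivrMr ?ltr0n // mul1r ltr_nat.
- by rewrite oppr_lt0 divr_gt0 ?ltr0n.
(* The fraction [m / d] need not be reduced; its denominator in lowest terms divides [d]. *)
- have E : numq q * d%:Z = - m%:Z * denq q.
    apply/eqP; rewrite -(eqr_int rat) !rmorphM /= rmorphN /= numqE.
    by rewrite mulrAC q_d.
  have /dvdn_leq : (`|denq q| %| d)%N.
    have : (`|denq q| %| `|numq q| * d)%N.
      by rewrite -[d in (_ * d)%N]absz_nat -abszM E abszM dvdn_mull.
    by rewrite Gauss_dvdr // coprime_sym coprime_num_den.
  move=> /(_ d0) qd; rewrite -absz_denq lez_nat.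
  exact: leq_trans dn.
- by rewrite rmorphN fmorph_div !rmorph_nat.
Qed.

Lemma Qset_ratioV (R : realType) (n : nat) (c : complex R) : Qset R n c ->
  exists r d : nat, [/\ (r.+1 < d)%N, (d <= n)%N & c = - (r.+1%:R / d%:R)].
Proof.
move=> [q [q_gtN1 q_lt0 dq ->]].
have num_lt0 : numq q < 0 by rewrite numq_lt0.
have num_gt : - denq q < numq q.
  by rewrite -(ltr_int rat) numqE rmorphN /= -mulN1r ltr_pM2r // ltr0z denq_gt0.
(* The negative integer [Negz r] is [- r.+1], which gives the numerator [r.+1]. *)
case numE : (numq q) num_lt0 num_gt => [//|r] _ num_gt.
exists r, `|denq q|%N; split.
- by move: num_gt; rewrite NegzE -absz_denq ltrN2.
- by rewrite -lez_nat absz_denq.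
- by rewrite /ratr numE NegzE mulrNz mulNr -[denq q in LHS]absz_denq.
Qed.

Theorem corollary4p2 (R : realType) (n : nat) (hn : (0 < n)%N) :
  Sigma R n = Qset R n.
Proof.
apply/classical_sets.seteqP; split=> c.
  move=> /aspherical_value_ratio [m [d [m0 md dn E]]].
  have d0 : (d%:R : complex R) != 0 by rewrite pnatr_eq0 -lt0n (leq_trans _ md).
  suff -> : c = - (m%:R / d%:R) by apply: Qset_ratio.
  by apply/(mulIf d0); rewrite mulNr divfK //; apply/eqP; rewrite -addr_eq0 E eqxx.
move=> /Qset_ratioV [r [d [rd dn ->]]]; exact: aspherical_value_frac.
Qed.
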